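(* Let $X$ be a stationary Gaussian process on $\mathbb R$ with covariance function $K(x,y)=\tilde K(x-y)$ of the form described in the context, with smoothness parameter $\nu>0$. Let $\theta\in\{1,2\}$, let $\ell$ be a positive integer, let $\varphi:\mathbb R\to\mathbb R$ be twice continuously differentiable with $\varphi(0)=0$, $\varphi(1)=1$ and $\min_{0\le s\le 1}\varphi^{(1)}(s)>0$, let $t_i=t_{n,i}=\varphi((i-1)/(n-1))$, $i=1,\dots,n$, and let $V_{\theta,\ell}$ be the $\ell$th-order quadratic variation based on $X(t_1),\dots,X(t_n)$ defined in the context. All asymptotics are as $n\to\infty$. (a) Suppose $\nu\in(0,\ell)$ and $\ell\in\{1,\dots,\lfloor (n-1)/\theta\rfloor\wedge 10\}$. Then $$E(V_{\theta,\ell})\sim f_{\theta,\ell}(\nu)\asymp n^{2\ell+1-2\nu}.$$ In addition, if $\tilde K^{(2\ell)}(\cdot)$ is a continuous function on an open interval containing $(0,1]$ such that $|\tilde K^{(2\ell)}(t)|\le C_\ell t^{2\nu-2\ell}$ for all $t\in(0,1]$, for some constant $C_\ell$, then $$\operatorname{Var}\{V_{\theta,\ell}/E(V_{\theta,\ell})\}=\begin{cases}O(n^{-1}), & \text{if } \nu<(4\ell-1)/4,\\ O\{n^{-1}\log(n)\}, & \text{if } \nu=(4\ell-1)/4,\\ O(n^{-4\ell+4\nu}), & \text{if } \nu>(4\ell-1)/4,\end{cases}$$ and $V_{\theta,\ell}/E(V_{\theta,\ell})\to 1$ almost surely as $n\to\infty$. (b) Suppose $\nu=\ell$. Then $E(V_{\theta,\ell})\sim(-1)^{\ell+1}\beta_\ell^*(2\ell)!\,n\log(n)$.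 In addition, if $\tilde K^{(2\ell)}(\cdot)$ is a continuous function on an open interval containing $(0,1]$ such that $|\tilde K^{(2\ell)}(t)|\le C_\ell\log(2/t)$ for all $t\in(0,1]$, for some constant $C_\ell$, then $\operatorname{Var}\{V_{\theta,\ell}/E(V_{\theta,\ell})\}=O\{\log^{-2}(n)\}$ as $n\to\infty$. (c) Suppose $\nu>\ell$. Then $E(V_{\theta,\ell})\sim(-1)^\ell\beta_\ell(2\ell)!\,n$. In addition, if $\tilde K^{(2\ell)}(\cdot)$ is a continuous and not identically $0$ function on an open interval containing $(0,1]$, then $$\liminf_{n\to\infty}\operatorname{Var}\{V_{\theta,\ell}/E(V_{\theta,\ell})\}>0.$$
   Context: Notation: $\lfloor\cdot\rfloor$ is the greatest integer function; $a\wedge b=\min(a,b)$; $a_n\sim b_n$ means $\lim_{n\to\infty} a_n/b_n=1$; $a_n\asymp b_n$ means $0<\liminf a_n/b_n\le\limsup a_n/b_n<\infty$. Covariance model. $X$ is a stationary, isotropic Gaussian random field on $\mathbb R$ (dimension $d=1$) with constant mean $\mu$ and covariance function $$K(x,y)=\operatorname{Cov}\{X(x),X(y)\}=\sum_{j=0}^{\lfloor\nu\rfloor}\beta_j|x-y|^{2j}+\beta_\nu^*G_\nu(|x-y|)+r(x,y),\qquad x,y\in\mathbb R,$$ where $\nu>0$, $\beta_\nu^*\ne0$, $\beta_0,\dots,\beta_{\lfloor\nu\rfloor}$ are constants; $r(x,y)=O(|x-y|^{2\nu+\tau})$ as $|x-y|\to0$ for some constant $\tau>0$; and $G_\nu:[0,\infty)\to\mathbb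 R$ satisfies $G_\nu(0)=0$ and, for $s>0$, $G_\nu(s)=s^{2\nu}$ if $\nu\notin\mathbb Z$, $G_\nu(s)=s^{2\nu}\log(s)$ if $\nu\in\mathbb Z$. Write $\tilde K(x-y)=K(x,y)$, and $\tilde K^{(2\ell)}$ for the $2\ell$th derivative of $\tilde K$ where it exists. Quadratic variation. The points satisfy $0=t_1<\dots<t_n=1$; write $X_i=X(t_i)$. For $\theta\in\{1,2\}$, $\ell\in\{1,\dots,\lfloor(n-1)/\theta\rfloor\}$ and $1\le i\le n-\theta\ell$ define $$a_{\theta,\ell;i,k}=\frac{\ell!}{\prod_{0\le j\le\ell,\,j\ne k}(t_{i+\theta k}-t_{i+\theta j})},\quad k=0,\dots,\ell,\qquad \nabla_{\theta,\ell}X_i=\sum_{k=0}^\ell a_{\theta,\ell;i,k}X_{i+\theta k},$$ $$V_{\theta,\ell}=\sum_{i=1}^{n-\theta\ell}(\nabla_{\theta,\ell}X_i)^2,$$ and, for $\nu\in(0,\ell)$, $$f_{\theta,\ell}(\nu)=2\beta_\nu^*\sum_{i=1}^{n-\theta\ell}\ \sum_{0\le k_1<k_2\le\ell}a_{\theta,\ell;i,k_1}a_{\theta,\ell;i,k_2}G_\nu(t_{i+\theta k_2}-t_{i+\theta k_1}).$$ The integers $\theta,\ell$ are fixed as $n\to\infty$, and for all $n$ the observations come from the same realization of $X$. *)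

(* Defs.v *)
From HB Require Import structures.
From mathcomp Require Import all_boot all_order all_algebra.
From mathcomp Require Import all_classical all_reals all_analysis.

Set Implicit Arguments.
Unset Strict Implicit.
Unset Printing Implicit Defensive.

Import Order.TTheory GRing.Theory Num.Theory.
Import numFieldNormedType.Exports.

Local Open Scope classical_set_scope.
Local Open Scope ring_scope.

Section GaussianProcess.
Context d (T : measurableType d) (R : realType) (P : probability T R).

(* Degenerate laws are allowed. They are listed apart because the library's
   normal_prob m 0 is the uniform law on [0, 1], not the Dirac mass at m. *)
Definition gaussian_rv (Y : T -> R) : Prop :=
  (exists m s : R, 0 < s /\
     forall A : set R, measurable A -> P (Y @^-1` A) = normal_prob m s A) \/
  (exists m : R,
     forall A : set R, measurable A -> P (Y @^-1` A) = \d_m A).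

Definition gaussian_process (X : R -> {RV P >-> R}) : Prop :=
  forall (m : nat) (x c : 'I_m -> R),
    gaussian_rv (fun w => \sum_(k < m) c k * X (x k) w).

(* In dimension one isotropy is automatic: Kt is even because the covariance
   is symmetric. *)
Definition stationary_gaussian_process
    (X : R -> {RV P >-> R}) (mu : R) (Kt : R -> R) : Prop :=
  [/\ gaussian_process X,
      forall x, 'E_P[X x]%E = mu%:E &
      forall x y, covariance P (X x) (X y) = (Kt (x - y))%:E].

End GaussianProcess.

Section CovarianceModel.
Context (R : realType).

Definition Gfun (nu s : R) : R :=
  if s == 0 then 0
  else if nu \is a Num.int then s `^ (2 * nu) * ln s
  else s `^ (2 * nu).

(* For nu > 0, Num.truncn nu is the natural number floor(nu).  The diagonal
   x = y is not excluded in the bound on r, so that r x x = 0. *)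
Definition covariance_model (nu bstar : R) (beta : nat -> R) (Kt : R -> R)
    : Prop :=
  exists (r : R -> R -> R) (tau : R),
    [/\ 0 < tau,
        exists C delta : R, 0 < delta /\
          forall x y, `|x - y| < delta ->
            `|r x y| <= C * `|x - y| `^ (2 * nu + tau) &
        forall x y, Kt (x - y) =
          \sum_(j < (Num.truncn nu).+1) beta j * `|x - y| ^+ (2 * j)
          + bstar * Gfun nu `|x - y| + r x y].

End CovarianceModel.

Section QuadraticVariation.
Context (R : realType).

(* Points are indexed from 1, as in t_1 < ... < t_n. *)
Definition design (phi : R -> R) (n i : nat) : R :=
  phi ((i%:R - 1) / (n%:R - 1)).

Definition acoef (t : nat -> R) (theta l i k : nat) : R :=
  l`!%:R /
  \prod_(0 <= j < l.+1 | j != k) (t (i + theta * k)%N - t (i + theta * j)%N).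

Definition nabla (t : nat -> R) (theta l : nat) (x : R -> R) (i : nat) : R :=
  \sum_(0 <= k < l.+1) acoef t theta l i k * x (t (i + theta * k)%N).

(* The sum is empty for the finitely many n with n <= theta * l. *)
Definition quadvar (t : nat -> R) (n theta l : nat) (x : R -> R) : R :=
  \sum_(1 <= i < (n - theta * l).+1) nabla t theta l x i ^+ 2.

Definition fvar (t : nat -> R) (n theta l : nat) (bstar nu : R) : R :=
  2 * bstar * \sum_(1 <= i < (n - theta * l).+1)
    \sum_(0 <= k2 < l.+1) \sum_(0 <= k1 < k2)
      acoef t theta l i k1 * acoef t theta l i k2 *
      Gfun nu (t (i + theta * k2)%N - t (i + theta * k1)%N).

Context d (T : measurableType d) (P : probability T R).

Definition V (phi : R -> R) (theta l : nat) (X : R -> {RV P >-> R}) (n : nat)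
    (w : T) : R :=
  quadvar (design phi n) n theta l (fun s => X s w).

Definition EV (phi : R -> R) (theta l : nat) (X : R -> {RV P >-> R}) (n : nat)
    : R := fine ('E_P[V phi theta l X n])%E.

Definition normV (phi : R -> R) (theta l : nat) (X : R -> {RV P >-> R})
    (n : nat) (w : T) : R :=
  V phi theta l X n w / EV phi theta l X n.

End QuadraticVariation.

Section Asymptotics.
Context (R : realType).

Definition asymp_equiv (u v : nat -> R) : Prop :=
  (fun n => u n / v n) @ \oo --> (1 : R).

Definition same_order (u v : nat -> R) : Prop :=
  (0 < limn_einf (fun n => (u n / v n)%:E))%E /\
  (limn_esup (fun n => (u n / v n)%:E) < +oo)%E.

(* u is extended-real valued so that the bound also asserts finiteness. *)
Definition ebigO (u : nat -> \bar R) (v : nat -> R) : Prop :=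
  exists C : R, \forall n \near \oo, (`|u n| <= (C * `|v n|)%:E)%E.

End Asymptotics.

Section Smoothness.
Context (R : realType).

(* f is of class C^m on the open set I; the derivability clause is needed
   because derive1n is total. *)
Definition class_C (m : nat) (f : R -> R) (I : set R) : Prop :=
  (forall j, (j < m)%N -> forall t, I t -> derivable (derive1n j f) t 1) /\
  (forall t, I t -> {for t, continuous (derive1n m f)}).

Definition open_interval_over01 (I : set R) : Prop :=
  [/\ open I, is_interval I & `]0, 1]%classic `<=` I].

End Smoothness.

(* Main.v *)
Require Import Defs.
From HB Require Import structures.
From mathcomp Require Import all_boot all_order all_algebra.
From mathcomp Require Import all_classical all_reals all_analysis.
From mathcomp Require Import measurable_realfun ring lra zify.

Set Implicit Arguments.
Unset Strict Implicit.
Unset Printing Implicit Defensive.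

Import Order.TTheory GRing.Theory Num.Theory.
Import numFieldNormedType.Exports.

Local Open Scope classical_set_scope.
Local Open Scope ring_scope.

(** Each l-th order divided difference Y_i = nabla_i X is a linear
    combination of values of X whose coefficients annihilate polynomials of
    degree < l. The family (Y_i) is therefore centred Gaussian, and V =
    sum_i Y_i^2 has all its moments governed by the matrix Sigma_ij =
    Cov(Y_i, Y_j): its mean is the trace of Sigma and its variance is 2
    sum_ij Sigma_ij^2. The problem becomes one about the two numbers tr
    Sigma and sum_ij Sigma_ij^2.

    Trace. Rescaled by the local step h_i = theta phi'(s_i) / (n - 1), the
    points of the i-th window tend to the grid 0, ..., l, uniformly in i. On
    a window the covariance is a polynomial in the squared lag, plus the
    principal irregular term bstar G_nu, plus a smaller error. The even
    powers below 2l are annihilated, so Sigma_ii is of order h_i^(2 nu - 2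
    l) when nu < l, of order log (1/h_i) when nu = l, and has a finite limit
    when nu > l ([local_limit_lt], [local_limit_eq], [local_limit_gt]).
    Averaging over i gives the mean, provided that the constants do not
    vanish:
    - for nu < l the constant is the quadratic form of G_nu on the grid. As
      a function of nu it is an exponential sum sum_m c_m (m^2)^nu with l
      terms, which vanishes at 1, ..., l - 1. Such a sum has at most l - 1
      zeros counted with multiplicity, so there are no others and those are
      simple; the simplicity serves for integer nu, where the logarithm
      produces the derivative ([Qlim_neq0]);
    - for nu > l the constant is beta_l. If it were 0, the l-th differences
      of step h would have variance o(h^(2l)). Differences of step 2h are
      sums of 2^l differences of step h, so that variance grows at most by
      4^l when h doubles; going down to step h / 2^k shows that it is 0. All
      higher differences then vanish as well, against the exact order h^(2
      nu) found for differences of an order above nu ([beta_neq0]).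

    Off the diagonal. When the windows i and j are disjoint, a double mean
    value theorem gives Sigma_ij = (-1)^l K^(2l)(z) with z between the
    extreme lags, so the assumed bound on K^(2l) bounds Sigma_ij^2 by a
    power of the lag; the entries near the diagonal are controlled by the
    diagonal. The sum over lags m of m^(-p), with p = 4l - 4 nu, is bounded,
    logarithmic or polynomial, which makes the three rates when sum_ij
    Sigma_ij^2 ([sum_cov2_bound]) is compared with the square of the trace.
    Almost sure convergence follows from high moments: integration by parts
    bounds E (V / EV - 1)^(2q) by a constant times the q-th power of the
    square root of the relative variance ([normV_even_moments]), which is
    summable for large q because that variance decays polynomially.

    Lower bound for nu > l. The divided difference of order 2l of K at
    points h, 2h, ..., (2l + 1) h tends to (2l)! beta_l, which is not 0, so
    K^(2l) does not vanish at some x in (0, 1). By continuity |K^(2l)| is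
    bounded below near x, and a positive proportion of the pairs (i, j) have
    their lags there. Hence sum_ij Sigma_ij^2 is at least c n^2, the order
    of the square of the trace ([sum_cov2_lower]). *)

(** * Limits of powers *)

Section PowerLimits.
Context (R : realType).

Lemma cvg_to_at_right (U : Type) (F : set_system U) (FF : Filter F) (h : U -> R) :
  h @ F --> (0 : R) -> (\forall x \near F, 0 < h x) -> h @ F --> (0 : R)^'+.
Proof. by move=> hc hp A hA; apply: filterS2 hp (hc _ hA) => x h0; apply. Qed.

Lemma cvg_natV : (fun n : nat => n%:R^-1 : R) @ \oo --> (0 : R).
Proof. by rewrite -(cvg_shiftS (fun n : nat => n%:R^-1 : R)); exact: cvg_harmonic. Qed.

Lemma cvg_natV_at_right : (fun n : nat => n%:R^-1 : R) @ \oo --> (0 : R)^'+.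
Proof.
apply: cvg_to_at_right cvg_natV _.
by exists 1%N => // n /= n0; rewrite invr_gt0 ltr0n.
Qed.

Lemma powRV (x e : R) : 0 <= x -> x^-1 `^ e = x `^ (- e).
Proof. by move=> x0; rewrite -powR_inv1// -powRrM mulN1r. Qed.

Lemma cvg_powR_nat (e : R) : 0 < e -> (fun n : nat => n%:R `^ (- e) : R) @ \oo --> (0 : R).
Proof.
move=> e0; under eq_fun do rewrite -powRV//.
exact: cvg_comp cvg_natV_at_right (powR_cvg0 e0).
Qed.

Lemma near_le0 (U : Type) (F : set_system U) (FF : Filter F) (h : U -> R) (e : R) :
  0 < e -> h @ F --> (0 : R) -> \forall x \near F, h x <= e.
Proof.
move=> e0 /cvgrPdist_le /(_ _ e0); apply: filterS => x.
by rewrite sub0r normrN; apply: le_trans; exact: ler_norm.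
Qed.

Lemma cvg_near_eq (U : Type) (F : set_system U) {FF : Filter F} (f g : U -> R) (a : R) :
  (\forall x \near F, f x = g x) -> f @ F --> a -> g @ F --> a.
Proof.
by move=> fg fa; apply: cvg_trans fa; apply: near_eq_cvg; apply: filterS fg => x ->.
Qed.

End PowerLimits.

(** * Moments of Gaussian laws *)

Lemma cvg_exprn (R : realFieldType) (U : Type) (F : set_system U) (FF : Filter F)
    (f : U -> R) (l : R) (k : nat) :
  f @ F --> l -> (fun x => f x ^+ k) @ F --> l ^+ k.
Proof.
move=> fl; elim: k => [|k IHk]; first by under eq_fun do rewrite expr0; exact: cvg_cst.
under eq_fun do rewrite exprS; rewrite exprS; exact: cvgM.
Qed.

Section NormalMoments.
Context (R : realType).
Notation leb := (@lebesgue_measure R).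

Lemma norm_exp_le_expR_sqr (a : R) (k : nat) : 0 < a ->
  exists C : R, forall x : R, `|x| ^+ k <= C * expR (a * x ^+ 2).
Proof.
move=> a0; exists (k`!%:R * expR (4^-1 * a^-1)) => x.
have h1 : `|x| ^+ k <= k`!%:R * expR `|x|.
  case: k => [|k]; first by rewrite expr0 fact0 mul1r -expR0 ler_expR.
  rewrite mulrC -ler_pdivrMr ?ltr0n ?fact_gt0//.
  apply: le_trans (expR_ge1Dxn k (normr_ge0 x)).
  by rewrite lerDr.
apply: (le_trans h1); rewrite -mulrA -expRD ler_wpM2l// ler_expR.
rewrite -(@ler_pM2l _ (4 * a)) ?mulr_gt0// mulrDr.
rewrite [X in _ <= X + _](_ : _ = 1); last by field; rewrite gt_eqF.
have : 0 <= (2 * a * `|x| - 1) ^+ 2 by exact: sqr_ge0.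
rewrite -[x ^+ 2]real_normK ?num_real//.
nra.
Qed.

(** A power of x - m is absorbed by doubling the standard deviation. *)
Lemma normal_pdf_moment_bound (m s : R) (k : nat) : s != 0 ->
  exists C : R, forall x : R,
    `|(x - m) ^+ k * normal_pdf m s x| <= C * normal_pdf m (2 * s) x.
Proof.
move=> s0.
have s20 : 0 < s ^+ 2 by rewrite exprn_even_gt0.
have a0 : 0 < (4 * s ^+ 2)^-1 :> R by rewrite invr_gt0 mulr_gt0.
have [C HC] := @norm_exp_le_expR_sqr ((4 * s ^+ 2)^-1) k a0.
have s2 : 2 * s != 0 by rewrite mulf_neq0.
have p2 := @normal_peak_gt0 R _ s2.
exists (C * normal_peak s / normal_peak (2 * s)) => x.
rewrite normrM normrX (ger0_norm (normal_pdf_ge0 _ _ _)) !normal_pdfE//.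
rewrite /normal_fun [leRHS]mulrA divfK ?gt_eqF//.
rewrite mulrCA [C * _]mulrC -[leRHS]mulrA; apply: ler_wpM2l.
  exact: normal_peak_ge0.
apply: le_trans (ler_wpM2r (expR_ge0 _) (HC (x - m))) _.
rewrite -[leLHS]mulrA mulrC -expRD.
have C0 : 0 <= C.
  have := HC 1; rewrite normr1 expr1n mulrC => h.
  have := le_trans ler01 h; by rewrite pmulr_rge0 ?expR_gt0.
rewrite [leLHS]mulrC ler_wpM2l// ler_expR.
rewrite -subr_ge0 [leRHS](_ : _ = (8 * s ^+ 2)^-1 * (x - m) ^+ 2); last by field.
by rewrite mulr_ge0 ?sqr_ge0// invr_ge0 mulr_ge0// ltW.
Qed.

Lemma normal_pdf_moment_integrable (m s : R) (k : nat) : s != 0 ->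
  leb.-integrable setT (fun x => ((x - m) ^+ k * normal_pdf m s x)%:E).
Proof.
move=> s0; have [C HC] := normal_pdf_moment_bound m k s0.
apply: (le_integrable measurableT _ _
  (integrableZl measurableT C (integrable_normal_pdf m (2 * s)))).
- apply/measurable_EFinP; apply: measurable_funM; last exact: measurable_normal_pdf.
  by apply: measurable_funX; apply: measurable_funB.
- by move=> x _; rewrite -EFinM /= lee_fin (le_trans (HC x))// ler_norm.
Qed.

Lemma normal_pdf_moment_vanish (m s : R) (k : nat) : s != 0 ->
  exists C : R, forall x, `|(x - m) ^+ k * normal_pdf m s x| * `|x - m| <= C.
Proof.
move=> s0; have [C HC] := normal_pdf_moment_bound m k.+1 s0.
have s2 : 2 * s != 0 by rewrite mulf_neq0.
exists (`|C| * normal_peak (2 * s)) => x.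
rewrite -normrM mulrC mulrA -exprS (le_trans (HC x))//.
apply: le_trans (ler_norm _) _; rewrite normrM ler_wpM2l//.
by rewrite ger0_norm ?normal_pdf_ge0// normal_pdf_ub.
Qed.

Lemma is_derive_normal_pdf (m s x : R) : s != 0 ->
  is_derive x 1 (normal_pdf m s) (- (x - m) / s ^+ 2 * normal_pdf m s x).
Proof.
move=> s0; rewrite normal_pdfE// /normal_fun.
apply: is_derive_eq.
rewrite /GRing.scale/=; field.
by rewrite s0.
Qed.

Lemma is_derive_normal_moment (m s x : R) (k : nat) : s != 0 ->
  is_derive x 1 (fun y : R => s ^+ 2 * (y - m) ^+ k * normal_pdf m s y)
    (k%:R * s ^+ 2 * ((x - m) ^+ k.-1 * normal_pdf m s x)
      - (x - m) ^+ k.+1 * normal_pdf m s x).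
Proof.
move=> s0; have := is_derive_normal_pdf m x s0 => dp.
have dl : is_derive x 1 (fun y : R => y - m) 1.
  by apply: is_derive_eq; rewrite subr0.
have dq := is_deriveX k dl.
have qE : (fun y : R => y - m) ^+ k = (fun y : R => (y - m) ^+ k).
  by rewrite exprfctE.
rewrite qE in dq.
apply: (is_derive_eq (is_deriveM (is_deriveZ (s ^+ 2) dq) dp)).
rewrite /GRing.scale /=.
by case: k {dl dq qE} => [|k] /=; rewrite ?exprS ?expr0 /GRing.scale /=; field.
Qed.

(** Integration by parts on [m - n, m + n], where the boundary terms tend to 0
    since s^2 (x - m)^k times the density is O(1 / |x - m|). *)
Lemma normal_pdf_moment_rec (m s : R) (k : nat) : s != 0 ->
  (\int[leb]_x ((x - m) ^+ k.+1 * normal_pdf m s x)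
   = k%:R * s ^+ 2 * \int[leb]_x ((x - m) ^+ k.-1 * normal_pdf m s x)).
Proof.
move=> s0.
pose F := (fun y : R => s ^+ 2 * (y - m) ^+ k * normal_pdf m s y).
pose f := (fun x : R => k%:R * s ^+ 2 * ((x - m) ^+ k.-1 * normal_pdf m s x)
      - (x - m) ^+ k.+1 * normal_pdf m s x).
have dF (x : R) : is_derive x 1 F (f x) by exact: is_derive_normal_moment.
have i1 : leb.-integrable setT (fun x => (k%:R * s ^+ 2 *
    ((x - m) ^+ k.-1 * normal_pdf m s x))%:E).
  under eq_fun do rewrite EFinM.
  by apply: integrableZl => //; exact: normal_pdf_moment_integrable.
have i2 := normal_pdf_moment_integrable m k.+1 s0.
have fi : leb.-integrable setT (EFin \o f).
  rewrite (_ : EFin \o f = (fun x => (k%:R * s ^+ 2 *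
    ((x - m) ^+ k.-1 * normal_pdf m s x))%:E -
    ((x - m) ^+ k.+1 * normal_pdf m s x)%:E)%E); first exact: integrableB.
  by apply/funext => x /=; rewrite EFinB.
suff f0 : \int[leb]_x f x = 0.
  move: f0; rewrite /f RintegralB// RintegralZl//; last first.
    exact: normal_pdf_moment_integrable.
  by move/eqP; rewrite subr_eq0 => /eqP.
have cf : continuous f.
  move=> x; rewrite /f; apply: cvgB; last first.
    by apply: cvgM; [apply: cvg_exprn; apply: cvgB; [exact: cvg_id|exact: cvg_cst]
                    |exact: continuous_normal_pdf].
  apply: cvgM; first exact: cvg_cst.
  by apply: cvgM; [apply: cvg_exprn; apply: cvgB; [exact: cvg_id|exact: cvg_cst]
                    |exact: continuous_normal_pdf].
have cF : continuous F.
  by move=> x; apply: differentiable_continuous; apply/derivable1_diffP;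
    have := dF x => -[].
pose a n : R := m - n.+1%:R.
pose b n : R := m + n.+1%:R.
have ab n : a n < b n by rewrite /a /b; have := ltr0Sn R n; lra.
have intn n : (\int[leb]_(x in `[a n, b n]) (f x)%:E = (F (b n) - F (a n))%:E)%E.
  rewrite (@continuous_FTC2 R f F)//.
  - exact: continuous_subspaceT.
  - split=> [x _||]; [by have := dF x => -[]| |].
      by apply: cvg_at_right_filter; exact: cF.
    by apply: cvg_at_left_filter; exact: cF.
  - by move=> x _; rewrite derive1E; have := dF x => -[].
have [C HC] := normal_pdf_moment_vanish m k s0.
have C0 : 0 <= C by apply: le_trans (HC 0); rewrite mulr_ge0.
have Fle n (x : R) : `|x - m| = n.+1%:R -> `|F x| <= s ^+ 2 * C * n.+1%:R^-1.
  move=> xm; rewrite /F -mulrA normrM ger0_norm ?sqr_ge0// -mulrA.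
  rewrite ler_wpM2l ?sqr_ge0// ler_pdivlMr ?ltr0n// -xm; exact: HC.
have lim1 : (fun n => \int[leb]_x ((EFin \o f) \_ `[a n, b n]) x)%E @ \oo -->
    (\int[leb]_x (EFin \o f) x)%E.
  have [//|//|||//|_ _] := @dominated_convergence _ _ _ leb setT measurableT
    (fun n => (EFin \o f) \_ `[a n, b n]) (EFin \o f) (abse \o (EFin \o f)).
  - move=> n; apply/measurable_restrict => //.
    exact: measurable_funTS (measurable_int _ fi).
  - exact: measurable_int fi.
  - apply: aeW => x _; apply: cvg_near_cst.
    exists (Num.truncn `|x - m|).+1 => // n /= hn.
    rewrite patchE mem_set//= in_itv/= /a /b.
    rewrite -ler_distl.
    apply: ltW; apply: lt_le_trans (truncnS_gt _) _; by rewrite ler_nat leqW// ltnW.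
  - exact: integrable_abse.
  - apply: aeW => x n _; rewrite patchE; case: ifP => // _.
    by rewrite abse0 /= lee_fin.
  by [].
have lim2 : (fun n => \int[leb]_x ((EFin \o f) \_ `[a n, b n]) x)%E @ \oo --> 0%E.
  rewrite (_ : (fun n => _) = EFin \o (fun n => F (b n) - F (a n))); last first.
    by apply/funext => n; rewrite /= -intn [RHS]integral_mkcond.
  apply: cvg_EFin; first exact: nearW.
  rewrite [X in X @ _](_ : _ = (fun n => F (b n) - F (a n))); last by [].
  have z : (fun n => s ^+ 2 * C * n.+1%:R^-1 : R) @ \oo --> (0 : R).
    rewrite -[X in _ --> X](mulr0 (s ^+ 2 * C)); apply: cvgM; first exact: cvg_cst.
    exact: cvg_harmonic.
  have nz : (fun n => - (s ^+ 2 * C * n.+1%:R^-1) : R) @ \oo --> (0 : R).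
    by rewrite -oppr0; apply: cvgN.
  rewrite -(subr0 0); apply: cvgB.
    apply: squeeze_cvgr nz z; apply: nearW => n.
    by rewrite -ler_norml; apply: Fle; rewrite /b addrC addKr ger0_norm.
  apply: squeeze_cvgr nz z; apply: nearW => n.
  by rewrite -ler_norml; apply: Fle; rewrite /a addrC addKr normrN ger0_norm.
have := cvg_unique _ lim1 lim2.
by rewrite /Rintegral => ->.
Qed.
End NormalMoments.

Section GaussianMoments.
Context d (T : measurableType d) (R : realType) (P : probability T R).
Notation leb := (@lebesgue_measure R).

(** The density of the normal law is recovered from its Radon-Nikodym
    derivative, first for nonnegative functions, whence integrability. *)
Lemma integral_normal_prob_integrable (m s : R) (f : R -> R) : s != 0 ->
  measurable_fun setT f ->
  leb.-integrable setT (fun x => (f x * normal_pdf m s x)%:E) ->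
  (normal_prob m s).-integrable setT (EFin \o f) /\
  (\int[normal_prob m s]_x (f x)%:E = \int[leb]_x (f x * normal_pdf m s x)%:E)%E.
Proof.
move=> s0 mf fi.
pose rn := Radon_Nikodym_SigmaFinite.f (normal_prob m s) leb.
have dom := normal_prob_dominates m s.
have mp : measurable_fun setT (EFin \o normal_pdf m s).
  by apply/measurable_EFinP; exact: measurable_normal_pdf.
have aeq : ae_eq leb setT rn (EFin \o normal_pdf m s).
  apply: integral_ae_eq => //.
    exact: Radon_Nikodym_SigmaFinite.f_integrable.
  by move=> E _ mE; rewrite -Radon_Nikodym_SigmaFinite.f_integral.
have mrn := measurable_int _ (Radon_Nikodym_SigmaFinite.f_integrable dom).
have nnE (g : R -> R) : measurable_fun setT g -> (forall x, 0 <= g x) ->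
  (\int[normal_prob m s]_x (g x)%:E = \int[leb]_x (g x * normal_pdf m s x)%:E)%E.
  move=> mg g0.
  rewrite -(@Radon_Nikodym_SigmaFinite.change_of_variables _ _ _ _ leb)//;
    last exact/measurable_EFinP.
  apply: ae_eq_integral => //.
  - by apply: emeasurable_funM => //; exact/measurable_EFinP.
  - by apply/measurable_EFinP; apply: measurable_funM => //; exact: measurable_normal_pdf.
  - under [X in ae_eq _ _ _ X]eq_fun do rewrite EFinM.
    exact: ae_eqe_mul2l.
have inorm : (normal_prob m s).-integrable setT (EFin \o f).
  apply/integrableP; split; first exact/measurable_EFinP.
  rewrite (nnE (fun x => `|f x|)) //; last exact: measurableT_comp.
  case/integrableP : fi => _; congr (_ < _)%E.
  apply: eq_integral => x _ /=.
  by rewrite normrM (ger0_norm (normal_pdf_ge0 _ _ _)).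
split => //.
rewrite -(@Radon_Nikodym_change_of_variables _ _ _ _ leb)//.
apply: ae_eq_integral => //.
- apply: emeasurable_funM; first exact/measurable_EFinP.
  exact: measurable_int (Radon_Nikodym_integrable _).
- by apply/measurable_EFinP; apply: measurable_funM => //; exact: measurable_normal_pdf.
- under [X in ae_eq _ _ _ X]eq_fun do rewrite EFinM.
  apply: ae_eqe_mul2l.
  apply: ae_eq_trans aeq; apply: ae_eq_sym.
  exact: ae_eq_Radon_Nikodym_SigmaFinite.
Qed.

(** The two canonical measurable structures on R have distinct displays, so the
   law of Y is transported along the one that carries normal_prob. *)
Lemma integral_law (Y : T -> R) (mu : {measure set (measurableTypeR R) -> \bar R})
    (h : R -> R) :
  measurable_fun setT Y ->
  (forall A : set R, measurable A -> P (Y @^-1` A) = mu A) ->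
  measurable_fun setT h -> mu.-integrable setT (EFin \o h) ->
  P.-integrable setT (fun w => (h (Y w))%:E) /\
  (\int[P]_w (h (Y w))%:E = \int[mu]_x (h x)%:E)%E.
Proof.
move=> mY0 HY mh hi.
have mY : measurable_fun setT (Y : T -> measurableTypeR R).
  by move=> mT B mB; exact: mY0.
have meh : measurable_fun setT (EFin \o h : measurableTypeR R -> \bar R).
  exact: measurable_int hi.
have pushE (f : measurableTypeR R -> \bar R) :
    (\int[pushforward P (Y : T -> measurableTypeR R)]_x f x = \int[mu]_x f x)%E.
  by apply: eq_measure_integral => A mA _; exact: HY.
have iY : P.-integrable setT (fun w => (h (Y w))%:E).
  apply/integrableP; split; first by apply/measurable_EFinP; exact: measurableT_comp.
  case/integrableP : hi => _; congr (_ < _)%E.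
  rewrite -pushE ge0_integral_pushforward// ?preimage_setT//.
  by apply: measurableT_comp.
split=> //; rewrite -pushE integral_pushforward//.
Qed.

(** This recursion is all that is used of Gaussian laws. It covers the Dirac
    masses, with v = 0, without a case distinction. *)
Lemma gaussian_rv_moment_rec (Y : T -> R) : measurable_fun setT Y ->
  gaussian_rv P Y ->
  exists m v : R, forall k,
    P.-integrable setT (fun w => ((Y w - m) ^+ k)%:E) /\
    \int[P]_w ((Y w - m) ^+ k.+1) = k%:R * v * \int[P]_w ((Y w - m) ^+ k.-1).
Proof.
move=> mY; have mpow m k : measurable_fun setT (fun x : R => (x - m) ^+ k).
  by apply: measurable_funX; apply: measurable_funB.
move=> [[m [s [s0 HY]]]|[m HY]].
- exists m, (s ^+ 2).
  have s1 : s != 0 by rewrite gt_eqF.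
  have key k : P.-integrable setT (fun w => ((Y w - m) ^+ k)%:E) /\
     \int[P]_w ((Y w - m) ^+ k) = \int[leb]_x ((x - m) ^+ k * normal_pdf m s x).
    have [i1 e1] := integral_normal_prob_integrable s1 (mpow m k)
      (normal_pdf_moment_integrable m k s1).
    have [i2 e2] := integral_law mY HY (mpow m k) i1.
    by split=> //; rewrite /Rintegral -e1 e2.
  move=> k; split; first exact: (key k).1.
  by rewrite (key k.+1).2 (key k.-1).2; exact: normal_pdf_moment_rec.
- exists m, 0.
  pose D : {measure set (measurableTypeR R) -> \bar R} := dirac (m : measurableTypeR R).
  have key k : P.-integrable setT (fun w => ((Y w - m) ^+ k)%:E) /\
     \int[P]_w ((Y w - m) ^+ k) = 0 ^+ k.
    have mk : measurable_fun setT (fun x : measurableTypeR R => ((x - m) ^+ k)%:E).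
      by apply/measurable_EFinP; exact: mpow.
    have i1 : D.-integrable setT (EFin \o (fun x => (x - m) ^+ k)).
      apply/integrableP; split => //.
      rewrite /D integral_dirac ?diracT ?mul1e ?ltry//.
      exact: (measurableT_comp (@abse_measurable _ _) mk).
    have [i2 e2] := @integral_law Y D _ mY HY (mpow m k) i1.
    by split=> //; rewrite /Rintegral e2 /D integral_dirac// diracT mul1e /= subrr.
  move=> k; split; first exact: (key k).1.
  by rewrite (key k.+1).2 (key k.-1).2 exprS mul0r mulr0 mul0r.
Qed.

End GaussianMoments.

(** * Gaussian spaces and integration by parts *)

Section AllMoments.
Context d (T : measurableType d) (R : realType) (P : probability T R).
Implicit Types f g : T -> R.

Definition has_moments (f : T -> R) : Prop :=
  measurable_fun setT f /\
  forall k, P.-integrable setT (fun w => (`|f w| ^+ k)%:E).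

Definition Ex (f : T -> R) : R := \int[P]_w f w.

Lemma has_moments_integrable f : has_moments f -> P.-integrable setT (EFin \o f).
Proof.
move=> [mf hf]; apply: (le_integrable measurableT _ _ (hf 1%N)).
  exact/measurable_EFinP.
by move=> w _ /=; rewrite expr1 lee_fin normr_id.
Qed.

(** Any pointwise bound of powers of |f| by powers of |g| and |h| will do, as
    g and h have moments of every order; sums and products are the two cases. *)
Lemma has_moments_le2 f g h (a : nat) : measurable_fun setT f ->
  (forall k, exists C : R, forall w,
     `|f w| ^+ k <= C * (`|g w| ^+ (a * k) + `|h w| ^+ (a * k))) ->
  has_moments g -> has_moments h -> has_moments f.
Proof.
move=> mf fg [mg hg] [mh hh]; split=> // k; have [C HC] := fg k.
apply: (le_integrable measurableT _ _ (integrableZl measurableT C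
  (integrableD measurableT (hg (a * k)%N) (hh (a * k)%N)))).
  apply/measurable_EFinP; apply: measurable_funX; exact: measurableT_comp.
move=> w _; rewrite -EFinD -EFinM /= lee_fin ger0_norm ?exprn_ge0//.
by rewrite (le_trans (HC w))// ler_norm.
Qed.

Lemma has_moments_cst (c : R) : has_moments (fun=> c).
Proof.
split=> // k; apply/integrableP; split; first exact/measurable_EFinP.
by rewrite integral_cst//= probability_setT mule1 ltry.
Qed.

Lemma has_momentsD f g : has_moments f -> has_moments g ->
  has_moments (fun w => f w + g w).
Proof.
move=> hf hg; apply: (@has_moments_le2 _ f g 1) => //.
  by apply: measurable_funD; [case: hf|case: hg].
move=> k; exists (2 ^+ k) => w; rewrite mul1n.
have ha : 0 <= `|f w| by []. have hb : 0 <= `|g w| by [].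
apply: (@le_trans _ _ ((`|f w| + `|g w|) ^+ k)).
  by apply: lerXn2r; rewrite ?nnegrE ?addr_ge0// ler_normD.
wlog le_ab : f g {hf hg} ha hb / `|f w| <= `|g w|.
  move=> hwlog; have [fg|/ltW gf] := leP `|f w| `|g w|; first exact: hwlog.
  by rewrite addrC [X in _ <= _ * X]addrC; exact: hwlog.
apply: (@le_trans _ _ ((2 * `|g w|) ^+ k)).
  by apply: lerXn2r; rewrite ?nnegrE ?addr_ge0 ?mulr_ge0//; lra.
by rewrite exprMn ler_wpM2l ?exprn_ge0// lerDr exprn_ge0.
Qed.

Lemma has_momentsM f g : has_moments f -> has_moments g ->
  has_moments (fun w => f w * g w).
Proof.
move=> hf hg; apply: (@has_moments_le2 _ f g 2) => //.
  by apply: measurable_funM; [case: hf|case: hg].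
move=> k; exists 1 => w; rewrite mul1r normrM exprMn mulnC !exprM.
have := sqr_ge0 (`|f w| ^+ k - `|g w| ^+ k).
have := sqr_ge0 (`|f w| ^+ k); have := sqr_ge0 (`|g w| ^+ k).
have : 0 <= `|f w| ^+ k * `|g w| ^+ k by rewrite mulr_ge0 ?exprn_ge0.
nra.
Qed.

Lemma has_momentsZ (c : R) f : has_moments f -> has_moments (fun w => c * f w).
Proof. by move=> hf; apply: has_momentsM => //; exact: has_moments_cst. Qed.

Lemma has_momentsB f g : has_moments f -> has_moments g ->
  has_moments (fun w => f w - g w).
Proof.
move=> hf hg; have -> : (fun w => f w - g w) = (fun w => f w + (-1) * g w).
  by apply/funext => w; rewrite mulN1r.
by apply: has_momentsD => //; exact: has_momentsZ.
Qed.

Lemma has_momentsX f k : has_moments f -> has_moments (fun w => f w ^+ k).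
Proof.
move=> hf; elim: k => [|k IHk].
  by under eq_fun do rewrite expr0; exact: has_moments_cst.
by under eq_fun do rewrite exprS; exact: has_momentsM.
Qed.

Lemma has_moments_sum (I : Type) (r : seq I) (F : I -> T -> R) :
  (forall i, has_moments (F i)) -> has_moments (fun w => \sum_(i <- r) F i w).
Proof.
move=> hF; elim: r => [|i r IHr].
  by under eq_fun do rewrite big_nil; exact: has_moments_cst.
by under eq_fun do rewrite big_cons; exact: has_momentsD.
Qed.

Lemma has_moments_norm f : has_moments f -> has_moments (fun w => `|f w|).
Proof.
move=> [mf hf]; split; first exact: measurableT_comp.
by move=> k; under eq_fun do rewrite normr_id.
Qed.

Lemma ExD f g : has_moments f -> has_moments g ->
  Ex (fun w => f w + g w) = Ex f + Ex g.
Proof.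
by move=> hf hg; apply: RintegralD => //; exact: has_moments_integrable.
Qed.

Lemma ExB f g : has_moments f -> has_moments g ->
  Ex (fun w => f w - g w) = Ex f - Ex g.
Proof.
by move=> hf hg; apply: RintegralB => //; exact: has_moments_integrable.
Qed.

Lemma ExZ c f : has_moments f -> Ex (fun w => c * f w) = c * Ex f.
Proof.
by move=> hf; apply: RintegralZl => //; exact: has_moments_integrable.
Qed.

Lemma Ex_cst c : Ex (fun=> c) = c.
Proof. by rewrite /Ex /Rintegral integral_cst//= probability_setT mule1. Qed.

Lemma Ex_sum (I : Type) (r : seq I) (F : I -> T -> R) :
  (forall i, has_moments (F i)) ->
  Ex (fun w => \sum_(i <- r) F i w) = \sum_(i <- r) Ex (F i).
Proof.
move=> hF; elim: r => [|i r IHr].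
  by under eq_fun do rewrite big_nil; rewrite big_nil Ex_cst.
under eq_fun do rewrite big_cons; rewrite big_cons ExD ?IHr//.
exact: has_moments_sum.
Qed.

Lemma le_Ex f g : has_moments f -> has_moments g -> (forall w, f w <= g w) ->
  Ex f <= Ex g.
Proof.
by move=> hf hg fg; apply: le_Rintegral => //; exact: has_moments_integrable.
Qed.

Lemma Ex_ge0 f : (forall w, 0 <= f w) -> 0 <= Ex f.
Proof. by move=> f0; apply: Rintegral_ge0. Qed.

End AllMoments.

Lemma poly_eq_horner (R : realType) (p q : {poly R}) :
  (forall t, p.[t] = q.[t]) -> p = q.
Proof.
move=> pq; apply/eqP; rewrite -subr_eq0; apply/eqP.
apply: (@roots_geq_poly_eq0 _ _ [seq (i%:R : R) | i <- iota 0 (size (p - q))]).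
- by apply/allP => x _; rewrite rootE hornerD hornerN pq subrr.
- rewrite map_inj_uniq ?iota_uniq// => i j /eqP.
  by rewrite eqr_nat => /eqP.
- by rewrite size_map size_iota.
Qed.

Section GaussianSpace.
Context d (T : measurableType d) (R : realType) (P : probability T R).
Notation E := (Ex P).
Notation has_moments := (has_moments P).

(** A linear space of variables, each centred Gaussian. Gaussianity enters
    only through the recursion, which determines all moments from the
    variance. *)
Definition gaussian_space (G : set (T -> R)) : Prop :=
  [/\ forall Z U (t : R), G Z -> G U -> G (fun w => Z w + t * U w),
      forall Z, G Z -> has_moments Z &
      forall Z k, G Z ->
        E (fun w => Z w ^+ k.+1) =
        k%:R * E (fun w => Z w ^+ 2) * E (fun w => Z w ^+ k.-1)].

Variables (G : set (T -> R)) (HG : gaussian_space G).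

Let GD Z U t : G Z -> G U -> G (fun w => Z w + t * U w).
Proof. by case: HG => + _ _; exact. Qed.
Let Gm Z : G Z -> has_moments Z.
Proof. by case: HG => _ + _; exact. Qed.
Let Gk Z k : G Z -> E (fun w => Z w ^+ k.+1) =
        k%:R * E (fun w => Z w ^+ 2) * E (fun w => Z w ^+ k.-1).
Proof. by case: HG => _ _; exact. Qed.

Ltac mom := repeat first
  [ exact: has_moments_cst | assumption | exact: Gm
  | apply: has_momentsX | apply: has_momentsM | apply: has_momentsB
  | apply: has_momentsD].

(** Polarisation device: moments along the line Z + t U are polynomials in t,
    whose first two coefficients are the mixed moments of interest. *)
Lemma Ex_pencil (Z U : T -> R) m A : has_moments Z -> has_moments U -> has_moments A ->
  exists p : {poly R},
  [/\ forall t, E (fun w => A w * (Z w + t * U w) ^+ m) = p.[t],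
      p`_0 = E (fun w => A w * Z w ^+ m) &
      p`_1 = m%:R * E (fun w => A w * Z w ^+ m.-1 * U w)].
Proof.
move=> hZ hU; elim: m A => [|m IHm] A hA.
  exists (E A)%:P; split.
  - by move=> t; rewrite hornerC; congr E; apply/funext => w; rewrite mulr1.
  - by rewrite coefC; congr E; apply/funext => w; rewrite mulr1.
  - by rewrite coefC mul0r.
have [p1 [h1 c10 c11]] := IHm (fun w => A w * Z w) (has_momentsM hA hZ).
have [p2 [h2 c20 c21]] := IHm (fun w => A w * U w) (has_momentsM hA hU).
exists (p1 + p2 * 'X); split.
- move=> t; rewrite !hornerE -h1 -h2 [X in _ = _ + X]mulrC -ExZ; last by mom.
  rewrite -ExD; [|by mom|by mom].
  by congr E; apply/funext => w; rewrite exprS; ring.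
- rewrite coefD coefMX/= addr0 c10; congr E; apply/funext => w.
  by rewrite exprS; ring.
- rewrite coefD coefMX/= c11 c20.
  have -> : E (fun w => A w * U w * Z w ^+ m) = E (fun w => A w * Z w ^+ m * U w).
    by congr E; apply/funext => w; ring.
  case: m {IHm h1 h2 c10 c11 c20 c21} => [|m] /=.
    by rewrite mul0r add0r mul1r.
  rewrite -[m.+2%:R]natr1 mulrDl mul1r; congr (_ * _ + _).
  by congr E; apply/funext => w; rewrite exprS; ring.
Qed.

(** Identify the coefficients of t in the moment recursion written for Z + t
    Z0. The statement for two consecutive exponents is proved at once because
    the identification for k + 2 involves the moment of order k. *)
Lemma gaussian_space_linear (Z0 Z : T -> R) m : G Z0 -> G Z ->
  E (fun w => Z0 w * Z w ^+ m) =
  m%:R * E (fun w => Z0 w * Z w) * E (fun w => Z w ^+ m.-1).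
Proof.
move=> h0 hZ; set c := E (fun w => Z0 w * Z w).
have h00 := Gm h0; have hZZ := Gm hZ.
have onem : has_moments (fun=> 1) by exact: has_moments_cst.
suff H k : (E (fun w => Z0 w * Z w ^+ k) = k%:R * c * E (fun w => Z w ^+ k.-1)) /\
    (E (fun w => Z0 w * Z w ^+ k.+1) = k.+1%:R * c * E (fun w => Z w ^+ k)).
  exact: (H m).1.
elim: k => [|k [IH1 IH2]].
  split.
    rewrite !mul0r; have := Gk 0 h0; rewrite !mul0r => <-.
    by congr E; apply/funext => w; rewrite mulr1.
  rewrite /c mul1r; under [X in _ = _ * E X]eq_fun do rewrite expr0.
  rewrite Ex_cst mulr1; congr E.
split=> //.
have [p [hp p0 p1]] := Ex_pencil k.+3 hZZ h00 onem.
have [q [hq q0 q1]] := Ex_pencil 2 hZZ h00 onem.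
have [s [hs s0 s1]] := Ex_pencil k.+1 hZZ h00 onem.
have one_l (f : T -> R) : E (fun w => 1 * f w) = E f.
  by congr E; apply/funext => w; rewrite mul1r.
have pE : p = k.+2%:R *: (q * s).
  apply: poly_eq_horner => t; rewrite hornerZ hornerM -hp -hq -hs !one_l.
  by rewrite mulrA (Gk k.+2 (GD t hZ h0)).
have := congr1 (fun r : {poly R} => r`_1) pE.
rewrite coefZ coefM !big_ord_recl big_ord0 /= !subn0 /= ?subnn p1 q0 q1 s0 s1 /bump /=.
rewrite ?subnn !addr0.
have eZ (j : nat) : E (fun w => 1 * Z w ^+ j * Z0 w) = E (fun w => Z0 w * Z w ^+ j).
  by congr E; apply/funext => w; ring.
have -> : E (fun w => 1 * Z w ^+ 1 * Z0 w) = c.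
  by rewrite /c; congr E; apply/funext => w; ring.
rewrite !one_l /= !eZ IH1 => e1.
apply: (@mulfI _ k.+3%:R); first by rewrite pnatr_eq0.
rewrite e1 [E (fun w => Z w ^+ k.+1)]Gk//.
rewrite -[k.+3%:R]natr1 -[k.+2%:R]natr1 -[k.+1%:R]natr1; ring.
Qed.

(** The formula E[Z0 F] = E[DF] for products F = Z^m f, with g standing for
    the derivative of f in the direction of the covariance with Z0.
    Quantifying over all Z and m is what lets polynomials be built up by
    products in [gaussian_ibpM]. *)
Definition gaussian_ibp (Z0 f g : T -> R) : Prop :=
  [/\ has_moments f, has_moments g & forall Z m, G Z ->
    E (fun w => Z0 w * Z w ^+ m * f w) =
    m%:R * E (fun w => Z0 w * Z w) * E (fun w => Z w ^+ m.-1 * f w)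
    + E (fun w => Z w ^+ m * g w)].

Lemma gaussian_ibp_cst Z0 c : G Z0 -> gaussian_ibp Z0 (fun=> c) (fun=> 0).
Proof.
move=> h0; split; [by mom|by mom|move=> Z m hZ].
have h00 := Gm h0; have hZZ := Gm hZ.
under [X in _ + E X]eq_fun do rewrite mulr0.
under eq_fun do rewrite mulrC; under [X in _ * E X]eq_fun do rewrite mulrC.
rewrite Ex_cst addr0 !ExZ; [|by mom|by mom].
by rewrite gaussian_space_linear// mulrCA.
Qed.

Lemma gaussian_ibpD Z0 f g f' g' : G Z0 ->
  gaussian_ibp Z0 f g -> gaussian_ibp Z0 f' g' ->
  gaussian_ibp Z0 (fun w => f w + f' w) (fun w => g w + g' w).
Proof.
move=> h0 [hf hg H] [hf' hg' H']; have h00 := Gm h0.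
split; [by mom|by mom|move=> Z m hZ]; have hZZ := Gm hZ.
under eq_fun do rewrite mulrDr.
under [X in _ * E X + _]eq_fun do rewrite mulrDr.
under [X in _ + E X]eq_fun do rewrite mulrDr.
by rewrite !ExD ?H ?H'//; [ring|mom..].
Qed.

(** Leibniz rule. Apply the hypothesis to Z + t U with exponent m + 1 and
    compare the coefficients of t. *)
Lemma gaussian_ibpM Z0 U f g : G Z0 -> G U -> gaussian_ibp Z0 f g ->
  gaussian_ibp Z0 (fun w => U w * f w)
    (fun w => E (fun w => Z0 w * U w) * f w + U w * g w).
Proof.
move=> h0 hU [hf hg H]; have h00 := Gm h0; have hUU := Gm hU.
split; [by mom|by mom|move=> Z m hZ]; have hZZ := Gm hZ.
set b := E (fun w => Z0 w * U w); set a := E (fun w => Z0 w * Z w).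
have h0f : has_moments (fun w => Z0 w * f w) by mom.
have [p [hp p0 p1]] := Ex_pencil m.+1 hZZ hUU h0f.
have [q [hq q0 q1]] := Ex_pencil m hZZ hUU hf.
have [s [hs s0 s1]] := Ex_pencil m.+1 hZZ hUU hg.
have pE : p = m.+1%:R *: ((a%:P + b *: 'X) * q) + s.
  apply: poly_eq_horner => t; rewrite hornerD hornerZ hornerM -hp -hq -hs !hornerE.
  have := H _ m.+1 (GD t hZ hU).
  have -> : E (fun w => Z0 w * (Z w + t * U w)) = a + b * t.
    rewrite /a /b mulrC -ExZ; last by mom.
    by rewrite -ExD; [congr E; apply/funext => w; ring|mom|mom].
  move=> HH.
  transitivity (E (fun w => Z0 w * (Z w + t * U w) ^+ m.+1 * f w)).
    by congr E; apply/funext => w; ring.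
  rewrite HH /=; congr (_ * _ + _); congr E;
    apply/funext => w; ring.
have := congr1 (fun r : {poly R} => r`_1) pE.
rewrite coefD coefZ mulrDl coefD coefCM -scalerAl coefZ coefXM /= p1 q0 q1 s1 /=.
have n0 : (m.+1%:R : R) != 0 by rewrite pnatr_eq0.
rewrite -mulrDr => /(mulfI n0) e1.
have -> : E (fun w => Z0 w * Z w ^+ m * (U w * f w)) =
    E (fun w => Z0 w * f w * Z w ^+ m * U w).
  by congr E; apply/funext => w; ring.
rewrite e1.
under [X in _ = _ + E X]eq_fun do rewrite mulrDr.
rewrite ExD; [|by mom|by mom].
have -> : E (fun w => Z w ^+ m * (b * f w)) = b * E (fun w => f w * Z w ^+ m).
  by rewrite -ExZ; [congr E; apply/funext => w; ring|mom].
have -> : E (fun w => Z w ^+ m.-1 * (U w * f w)) = E (fun w => f w * Z w ^+ m.-1 * U w).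
  by congr E; apply/funext => w; ring.
have -> : E (fun w => Z w ^+ m * (U w * g w)) = E (fun w => g w * Z w ^+ m * U w).
  by congr E; apply/funext => w; ring.
ring.
Qed.

End GaussianSpace.

(** * Moments of quadratic forms in Gaussian variables *)

Section QuadraticForm.
Context d (T : measurableType d) (R : realType) (P : probability T R).
Notation E := (Ex P).
Notation has_moments := (has_moments P).
Variables (G : set (T -> R)) (HG : gaussian_space P G).
Variables (r : seq nat) (Y : nat -> T -> R) (HY : forall i, G (Y i)).

Let S i j := E (fun w => Y i w * Y j w).
Let c := \sum_(i <- r) S i i.
Let W w := \sum_(i <- r) Y i w ^+ 2 - c.
Let Q i w := \sum_(j <- r) S i j * Y j w.

Let mY i : has_moments (Y i).
Proof. by case: HG => _ + _; apply. Qed.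

Ltac mom := repeat first
  [ exact: has_moments_cst | assumption | exact: mY
  | apply: has_momentsX | apply: has_moments_sum => ? | apply: has_momentsM | apply: has_momentsB
  | apply: has_momentsD].

Lemma moments_W : has_moments W. Proof. by rewrite /W; mom. Qed.
Lemma moments_Q i : has_moments (Q i). Proof. by rewrite /Q; mom. Qed.

Let mW := moments_W.
Let mQ := moments_Q.

(** The chain rule for W^p: since W is quadratic, its derivative in the
    direction of the covariance with Y_i is 2 Q_i. *)
Lemma gaussian_ibp_power i p : gaussian_ibp P G (Y i) (fun w => W w ^+ p)
  (fun w => 2 * p%:R * (Q i w * W w ^+ p.-1)).
Proof.
elim: p => [|p IHp].
  under eq_fun do rewrite expr0.
  have -> : (fun w => 2 * 0%:R * (Q i w * W w ^+ 0.-1)) = (fun=> 0).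
    by apply/funext => w; rewrite mulr0 mul0r.
  exact: gaussian_ibp_cst.
pose g := (fun w => 2 * p%:R * (Q i w * W w ^+ p.-1)); rewrite -/g in IHp.
have mul_sq j := gaussian_ibpM HG (HY i) (HY j) (gaussian_ibpM HG (HY i) (HY j) IHp).
have sum_ibp (s : seq nat) : gaussian_ibp P G (Y i)
    (fun w => \sum_(j <- s) Y j w * (Y j w * W w ^+ p))
    (fun w => \sum_(j <- s) (S i j * (Y j w * W w ^+ p) +
        Y j w * (S i j * W w ^+ p + Y j w * g w))).
  elim: s => [|j s IHs].
    under eq_fun do rewrite big_nil; under [X in gaussian_ibp _ _ _ _ X]eq_fun do rewrite big_nil.
    exact: gaussian_ibp_cst.
  under eq_fun do rewrite big_cons; under [X in gaussian_ibp _ _ _ _ X]eq_fun do rewrite big_cons.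
  exact: (gaussian_ibpD HG (HY i) (mul_sq j) IHs).
have sc_ibp : gaussian_ibp P G (Y i) (fun w => - c * W w ^+ p) (fun w => - c * g w).
  have [h1 h2 h3] := IHp; split; [by mom|by mom|move=> Z m hZ].
  have mZ : has_moments Z by case: HG => _ + _; apply.
  have -> : E (fun w => Y i w * Z w ^+ m * (- c * W w ^+ p)) =
      - c * E (fun w => Y i w * Z w ^+ m * W w ^+ p).
    by rewrite -ExZ; [congr E; apply/funext => w; ring|mom].
  rewrite h3//.
  have -> : E (fun w => Z w ^+ m.-1 * (- c * W w ^+ p)) =
      - c * E (fun w => Z w ^+ m.-1 * W w ^+ p).
    by rewrite -ExZ; [congr E; apply/funext => w; ring|mom].
  have -> : E (fun w => Z w ^+ m * (- c * g w)) = - c * E (fun w => Z w ^+ m * g w).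
    by rewrite -ExZ; [congr E; apply/funext => w; ring|mom].
  ring.
have := gaussian_ibpD HG (HY i) (sum_ibp r) sc_ibp.
congr gaussian_ibp; apply/funext => w.
  rewrite exprS {2}/W mulrBl mulr_suml mulNr; congr (_ - _).
  by apply: eq_bigr => j _; rewrite expr2 mulrA.
have -> : \sum_(j <- r) (S i j * (Y j w * W w ^+ p) +
        Y j w * (S i j * W w ^+ p + Y j w * g w)) =
    2 * Q i w * W w ^+ p + (\sum_(j <- r) Y j w ^+ 2) * g w.
  rewrite /Q mulr_sumr !mulr_suml -big_split /=; apply: eq_bigr => j _; ring.
have -> : \sum_(j <- r) Y j w ^+ 2 = W w + c by rewrite /W subrK.
rewrite /g; case: p {IHp g mul_sq sum_ibp sc_ibp} => [|p] /=; first by rewrite expr0; ring.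
rewrite exprS -[in RHS]natr1; ring.
Qed.

(** Integrate by parts in each factor Y_i of one of the p + 1 factors W; the
    terms S_ii E W^p cancel the centring constant c. *)
Lemma quadratic_form_moment_rec p :
  E (fun w => W w ^+ p.+1) =
  2 * p%:R * E (fun w => (\sum_(i <- r) \sum_(j <- r) S i j * (Y i w * Y j w)) * W w ^+ p.-1).
Proof.
have key i : E (fun w => Y i w ^+ 2 * W w ^+ p) =
    S i i * E (fun w => W w ^+ p) + 2 * p%:R * E (fun w => Y i w * Q i w * W w ^+ p.-1).
  have [_ _ H] := gaussian_ibp_power i p.
  have := H (Y i) 1%N (HY i); rewrite /= => e.
  have -> : E (fun w => Y i w ^+ 2 * W w ^+ p) = E (fun w => Y i w * Y i w ^+ 1 * W w ^+ p).
    by congr E; apply/funext => w; rewrite expr2.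
  rewrite e mul1r; congr (_ * _ + _).
    by congr E; apply/funext => w; rewrite expr0 mul1r.
  by rewrite -ExZ; [congr E; apply/funext => w; ring|mom].
have -> : E (fun w => W w ^+ p.+1) =
    \sum_(i <- r) E (fun w => Y i w ^+ 2 * W w ^+ p) - c * E (fun w => W w ^+ p).
  rewrite -Ex_sum; last by move=> i; mom.
  rewrite -ExZ; last by mom.
  rewrite -ExB; [|by mom|by mom].
  congr E; apply/funext => w; rewrite exprS {1}/W mulrBl; congr (_ - _).
  by rewrite mulr_suml.
under eq_bigr do rewrite key.
rewrite big_split /= -mulr_suml -/c addrAC subrr add0r -mulr_sumr -Ex_sum; last by move=> i; mom.
congr (_ * E _); apply/funext => w; rewrite mulr_suml; apply: eq_bigr => i _.
rewrite mulr_suml /Q mulr_sumr mulr_suml; apply: eq_bigr => j _; ring.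
Qed.

Lemma quadratic_form_variance :
  E (fun w => W w ^+ 2) = 2 * \sum_(i <- r) \sum_(j <- r) S i j ^+ 2.
Proof.
rewrite quadratic_form_moment_rec mulr1; congr (_ * _).
under eq_fun do rewrite expr0 mulr1.
rewrite Ex_sum; last by move=> i; mom.
apply: eq_bigr => i _; rewrite Ex_sum; last by move=> j; mom.
by apply: eq_bigr => j _; rewrite ExZ; [rewrite expr2|mom].
Qed.

(** The quadratic form S is bounded by its Hilbert-Schmidt norm, by
    Cauchy-Schwarz on the pairs (i, j): the discriminant of t |-> sum_ij (t
    S_ij - y_i y_j)^2 is nonpositive. *)
Lemma quadratic_form_le (F : R) (y : nat -> R) :
  0 <= F -> \sum_(i <- r) \sum_(j <- r) S i j ^+ 2 <= F ^+ 2 ->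
  \sum_(i <- r) \sum_(j <- r) S i j * (y i * y j) <= F * \sum_(i <- r) y i ^+ 2.
Proof.
move=> F0 SF.
set A := \sum_(i <- r) \sum_(j <- r) S i j ^+ 2 in SF *.
set B := \sum_(i <- r) \sum_(j <- r) S i j * (y i * y j).
set C := \sum_(i <- r) y i ^+ 2.
have C0 : 0 <= C by apply: sumr_ge0 => i _; exact: sqr_ge0.
have CE : \sum_(i <- r) \sum_(j <- r) (y i * y j) ^+ 2 = C ^+ 2.
  rewrite expr2 {1}/C mulr_suml; apply: eq_bigr => i _; rewrite mulr_sumr.
  by apply: eq_bigr => j _; rewrite exprMn.
have H t : 0 <= A * t ^+ 2 - 2 * t * B + C ^+ 2.
  rewrite -CE /A /B mulr_suml mulr_sumr -sumrB -big_split /= sumr_ge0// => i _.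
  rewrite mulr_suml mulr_sumr -sumrB -big_split /= sumr_ge0// => j _.
  apply: le_trans (sqr_ge0 (t * S i j - y i * y j)) _; rewrite le_eqVlt; apply/orP; left.
  by apply/eqP; ring.
have A0 : 0 <= A by apply: sumr_ge0 => i _; apply: sumr_ge0 => j _; exact: sqr_ge0.
have AF t : 0 <= F ^+ 2 * t ^+ 2 - 2 * t * B + C ^+ 2.
  apply: le_trans (H t) _; rewrite !lerD2r ler_wpM2r ?sqr_ge0//.
rewrite leNgt; apply/negP => lt.
have [F00|Fn0] := eqVneq F 0.
  have B0 : 0 < B by rewrite (le_lt_trans _ lt)// mulr_ge0.
  have := AF ((C ^+ 2 + 1) / B); rewrite F00 expr0n /= mul0r add0r.
  have -> : 2 * ((C ^+ 2 + 1) / B) * B = 2 * (C ^+ 2 + 1) by field; rewrite gt_eqF.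
  have := sqr_ge0 C; lra.
have Fp : 0 < F by rewrite lt0r Fn0.
have [C00|Cn0] := eqVneq C 0.
  have B0 : 0 < B by rewrite (le_lt_trans _ lt)// mulr_ge0.
  have := AF (B / F ^+ 2); rewrite C00 expr0n /= addr0.
  have -> : F ^+ 2 * (B / F ^+ 2) ^+ 2 - 2 * (B / F ^+ 2) * B = - (B ^+ 2 / F ^+ 2).
    by field; rewrite gt_eqF.
  by rewrite oppr_ge0 leNgt divr_gt0 ?exprn_gt0.
have Cp : 0 < C by rewrite lt0r Cn0.
have := AF (C / F).
have -> : F ^+ 2 * (C / F) ^+ 2 - 2 * (C / F) * B + C ^+ 2 = 2 * (C / F) * (F * C - B).
  by field; rewrite gt_eqF.
by rewrite pmulr_rge0 ?mulr_gt0 ?invr_gt0// subr_ge0 leNgt lt.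
Qed.

(** In the moment recursion with p = 2q + 1 the quadratic form is at most del
    c (W + c), so the moment of order 2q + 2 of W / c is bounded by del times
    moments of order 2q + 1 and 2q. The odd one is split between its
    neighbours, and the part of order 2q + 2 is absorbed in the left-hand
    side, which is where the smallness of del is needed. *)
Lemma quadratic_form_moment_step (del : R) q : 0 < c -> 0 <= del ->
  \sum_(i <- r) \sum_(j <- r) S i j ^+ 2 <= (del * c) ^+ 2 ->
  4 * (2 * q).+1%:R * del <= 1 ->
  E (fun w => (W w / c) ^+ (2 * q).+2) <=
  8 * (2 * q).+1%:R * del * E (fun w => (W w / c) ^+ (2 * q)).
Proof.
move=> c0 d0 SF hd.
have mw : has_moments (fun w => W w / c) by mom.
have mwa : has_moments (fun w => `|W w / c|) by exact: has_moments_norm.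
set k := (2 * q)%N; set K : R := (2 * q).+1%:R in hd *.
have ev (x : R) n : 0 <= x ^+ (2 * n) by rewrite exprM exprn_ge0// sqr_ge0.
have h1 : E (fun w => (W w / c) ^+ k.+2) <=
    2 * K * del * (E (fun w => `|W w / c| ^+ k.+1) + E (fun w => (W w / c) ^+ k)).
  have -> : E (fun w => (W w / c) ^+ k.+2) =
      2 * K * E (fun w => c ^- k.+2 * ((\sum_(i <- r) \sum_(j <- r) S i j * (Y i w * Y j w))
        * W w ^+ k)).
    rewrite ExZ; last by mom.
    rewrite mulrCA -[LHS]mul1r -{1}(@mulVf _ (c ^+ k.+2)) ?expf_neq0 ?gt_eqF// -mulrA.
    congr (_ * _).
    rewrite -(quadratic_form_moment_rec k.+1) -ExZ; last by mom.
    congr E; apply/funext => w; rewrite exprMn exprVn mulrCA mulfV ?mulr1//.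
    by rewrite expf_neq0 ?gt_eqF.
  rewrite -[leRHS]mulrA ler_wpM2l ?mulr_ge0//.
  rewrite -ExD; [|by mom|by mom].
  rewrite -ExZ; last by mom.
  apply: le_Ex; [by mom|by mom|move=> w].
  have hb := @quadratic_form_le (del * c) (Y ^~ w) (mulr_ge0 d0 (ltW c0)) SF.
  have evk : 0 <= W w ^+ k by exact: ev.
  rewrite mulrC ler_pdivrMr ?exprn_gt0//.
  apply: le_trans (ler_wpM2r evk hb) _.
  have -> : \sum_(i <- r) Y i w ^+ 2 = W w + c by rewrite /W subrK.
  rewrite -!mulrA ler_wpM2l//.
  rewrite mulrC exprMn exprVn -mulrA.
  have hW : (W w + c) * W w ^+ k <= `|W w| ^+ k.+1 + c * W w ^+ k.
    rewrite mulrDl lerD2r exprS -[`|W w| ^+ k]normrX (ger0_norm evk).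
    by rewrite ler_wpM2r// ler_norm.
  rewrite normrM normfV (gtr0_norm c0) exprMn exprVn.
  rewrite [leRHS](_ : _ = c * (`|W w| ^+ k.+1 + c * W w ^+ k)); last first.
    have ck : c ^+ k != 0 by rewrite expf_neq0// gt_eqF.
    by rewrite !exprS; field; rewrite ck gt_eqF.
  by rewrite mulrA mulrC ler_wpM2l// ltW.
have h2 : E (fun w => `|W w / c| ^+ k.+1) <=
    E (fun w => (W w / c) ^+ k) + E (fun w => (W w / c) ^+ k.+2).
  rewrite -ExD; [|by mom|by mom].
  apply: le_Ex; [by mom|by mom|move=> w].
  set x := W w / c.
  have -> : x ^+ k.+2 = `|x| ^+ 2 * x ^+ k by rewrite real_normK ?num_real// -exprD.
  have -> : `|x| ^+ k.+1 = `|x| * x ^+ k.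
    by rewrite exprS -[`|x| ^+ k]normrX (ger0_norm (ev x q)).
  have := ev x q; rewrite -/k => xk.
  rewrite -[X in _ <= X + _]mul1r -mulrDl ler_wpM2r//.
  by have := sqr_ge0 (`|x| - 1); have := normr_ge0 x; nra.
have E0 : 0 <= E (fun w => (W w / c) ^+ k) by apply: Ex_ge0 => w; exact: ev.
have E2 : 0 <= E (fun w => (W w / c) ^+ k.+2).
  by apply: Ex_ge0 => w; rewrite -[k.+2]/(2 + 2 * q)%N -mulnS; exact: ev.
have K0 : 0 <= K by [].
move: h1 h2 E0 E2; set a := E _; set b := E _; set e := E _ => h1 h2 E0 E2.
have Kd : 0 <= K * del by rewrite mulr_ge0.
nra.
Qed.

End QuadraticForm.

(** * Contrasts of a stationary Gaussian process *)

Section StationaryProcess.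
Context d (T : measurableType d) (R : realType) (P : probability T R).
Notation E := (Ex P).
Notation has_moments := (has_moments P).
Variables (X : R -> {RV P >-> R}) (mu : R) (Kt : R -> R).
Hypothesis HX : stationary_gaussian_process X mu Kt.

Definition lincomb (s : seq (R * R)) (w : T) : R := \sum_(p <- s) p.1 * X p.2 w.

(** The constraint on the coefficients makes the mean of the process
    irrelevant. *)
Definition contrasts : set (T -> R) :=
  [set Z | exists2 s : seq (R * R), \sum_(p <- s) p.1 = 0 & Z = lincomb s].

Lemma measurable_lincomb s : measurable_fun setT (lincomb s).
Proof.
rewrite /lincomb; elim: s => [|p s IHs].
  by under eq_fun do rewrite big_nil; exact: measurable_cst.
under eq_fun do rewrite big_cons.
by apply: measurable_funD => //; exact: measurable_funM.
Qed.

Lemma gaussian_lincomb s : gaussian_rv P (lincomb s).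
Proof.
have [gX _ _] := HX.
have := gX (size s) (fun k => (nth (0, 0) s k).2) (fun k => (nth (0, 0) s k).1).
congr gaussian_rv; apply/funext => w.
by rewrite /lincomb (big_nth (0, 0)) big_mkord.
Qed.

Lemma process_has_moments x : has_moments (X x).
Proof.
have mX : measurable_fun setT (X x) by [].
have gX : gaussian_rv P (X x).
  have := gaussian_lincomb [:: (1, x)]; congr gaussian_rv; apply/funext => w.
  by rewrite /lincomb big_seq1 mul1r.
have [m [v Hm]] := gaussian_rv_moment_rec mX gX.
have -> : (X x : T -> R) = (fun w => (X x w - m) + m).
  by apply/funext => w; rewrite subrK.
apply: has_momentsD; last exact: has_moments_cst.
split; first exact: measurable_funB.
move=> k; have := integrable_abse (Hm k).1.
by congr (_.-integrable _ _); apply/funext => w /=; rewrite normrX.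
Qed.

Lemma Ex_process x : E (X x) = mu.
Proof.
have [_ eX _] := HX; have := eX x; rewrite unlock => h.
by rewrite /Ex /Rintegral h.
Qed.

Lemma Ex_process_cov x y : E (fun w => (X x w - mu) * (X y w - mu)) = Kt (x - y).
Proof.
have [_ eX cX] := HX; have := cX x y; rewrite unlock !eX /= => h.
by have := congr1 fine h; rewrite unlock.
Qed.

Lemma lincomb_has_moments s : has_moments (lincomb s).
Proof.
apply: has_moments_sum => p; apply: has_momentsZ; exact: process_has_moments.
Qed.

Lemma Ex_lincomb s : \sum_(p <- s) p.1 = 0 -> E (lincomb s) = 0.
Proof.
move=> s0; rewrite /lincomb Ex_sum; last first.
  by move=> p; apply: has_momentsZ; exact: process_has_moments.
rewrite (eq_bigr (fun p => p.1 * mu)) => [|p _]; last first.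
  by rewrite ExZ ?Ex_process//; exact: process_has_moments.
by rewrite -mulr_suml s0 mul0r.
Qed.

Lemma Ex_lincombM s s' : \sum_(p <- s) p.1 = 0 -> \sum_(p <- s') p.1 = 0 ->
  E (fun w => lincomb s w * lincomb s' w) =
  \sum_(p <- s) \sum_(q <- s') p.1 * q.1 * Kt (p.2 - q.2).
Proof.
have center u w : \sum_(p <- u) p.1 = 0 ->
    lincomb u w = \sum_(p <- u) p.1 * (X p.2 w - mu).
  move=> u0; rewrite /lincomb; under [RHS]eq_bigr do rewrite mulrBr.
  by rewrite sumrB -mulr_suml u0 mul0r subr0.
move=> s0 s'0.
have mX x : has_moments (fun w => X x w - mu).
  by apply: has_momentsB; [exact: process_has_moments|exact: has_moments_cst].
transitivity (E (fun w => \sum_(p <- s) \sum_(q <- s')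
    p.1 * q.1 * ((X p.2 w - mu) * (X q.2 w - mu)))).
  congr E; apply/funext => w; rewrite (center _ _ s0) (center _ _ s'0) mulr_suml.
  by apply: eq_bigr => p _; rewrite mulr_sumr; apply: eq_bigr => q _; ring.
rewrite Ex_sum; last first.
  by move=> p; apply: has_moments_sum => q; apply: has_momentsZ; exact: has_momentsM.
apply: eq_bigr => p _; rewrite Ex_sum; last first.
  by move=> q; apply: has_momentsZ; exact: has_momentsM.
apply: eq_bigr => q _; rewrite ExZ ?Ex_process_cov//; exact: has_momentsM.
Qed.

Lemma contrasts_gaussian_space : gaussian_space P contrasts.
Proof.
split.
- move=> Z U t [s s0 ->] [s' s'0 ->].
  exists (s ++ [seq (t * p.1, p.2) | p <- s']).
    by rewrite big_cat big_map /= -mulr_sumr s0 s'0 mulr0 addr0.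
  apply/funext => w; rewrite /lincomb big_cat big_map /= mulr_sumr.
  by congr (_ + _); apply: eq_bigr => p _; rewrite mulrA.
- by move=> Z [s s0 ->]; exact: lincomb_has_moments.
- move=> Z k [s s0 ->].
  have [m [v Hm]] := gaussian_rv_moment_rec (measurable_lincomb s) (gaussian_lincomb s).
  have m0 : m = 0.
    have := (Hm 0%N).2; rewrite /= mul0r mul0r => h.
    have : E (fun w => lincomb s w - m) = 0.
      by rewrite -h /Ex; apply: eq_Rintegral => w _; rewrite expr1.
    rewrite ExB ?Ex_lincomb ?Ex_cst//; [|exact: lincomb_has_moments|exact: has_moments_cst].
    by move/eqP; rewrite sub0r oppr_eq0 => /eqP.
  have Hk j : E (fun w => lincomb s w ^+ j.+1) = j%:R * v * E (fun w => lincomb s w ^+ j.-1).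
    have := (Hm j).2; rewrite m0 /Ex => h.
    by under eq_Rintegral do rewrite -[lincomb s _]subr0;
      rewrite h; congr (_ * _); apply: eq_Rintegral => w _; rewrite subr0.
  rewrite Hk (Hk 1%N) /= mul1r; congr (_ * _ * _).
  by under [X in _ * E X]eq_fun do rewrite expr0; rewrite Ex_cst mulr1.
Qed.

End StationaryProcess.

(** * Law of the quadratic variation *)

Section QuadraticVariationLaw.
Context d (T : measurableType d) (R : realType) (P : probability T R).
Notation E := (Ex P).
Notation has_moments := (has_moments P).

Definition nabla_cov (t : nat -> R) (theta l : nat) (K : R -> R) (i j : nat) : R :=
  \sum_(0 <= k1 < l.+1) \sum_(0 <= k2 < l.+1)
    acoef t theta l i k1 * acoef t theta l j k2 *
    K (t (i + theta * k1)%N - t (j + theta * k2)%N).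

Variables (X : R -> {RV P >-> R}) (mu : R) (Kt : R -> R).
Hypothesis HX : stationary_gaussian_process X mu Kt.
Variables (t : nat -> R) (n theta l : nat).
Hypothesis annihilate1 : forall i, (1 <= i < (n - theta * l).+1)%N ->
  \sum_(0 <= k < l.+1) acoef t theta l i k = 0.

Let V w := quadvar t n theta l (fun s => X s w).
Let Y i w := if (1 <= i < (n - theta * l).+1)%N
             then nabla t theta l (fun s => X s w) i else 0.
Let r := index_iota 1 (n - theta * l).+1.
Let K := nabla_cov t theta l Kt.

Let nablaE i : (1 <= i < (n - theta * l).+1)%N ->
  exists2 s : seq (R * R), \sum_(p <- s) p.1 = 0 & Y i = lincomb X s /\
    s = [seq (acoef t theta l i k, t (i + theta * k)%N) | k <- index_iota 0 l.+1].
Proof.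
move=> hi; eexists; last split; last reflexivity.
  by rewrite big_map annihilate1.
by apply/funext => w; rewrite /Y hi /nabla /lincomb big_map.
Qed.

Let HY i : contrasts X (Y i).
Proof.
rewrite /contrasts /=; have [hi|hi] := boolP (1 <= i < (n - theta * l).+1)%N.
  by have [s s0 [-> _]] := nablaE hi; exists s.
exists [::]; first by rewrite big_nil.
by apply/funext => w; rewrite /Y (negbTE hi) /lincomb big_nil.
Qed.

Let HG := contrasts_gaussian_space HX.

Let mY i : has_moments (Y i).
Proof. by case: HG => _ + _; apply. Qed.

Let covY i j : (1 <= i < (n - theta * l).+1)%N -> (1 <= j < (n - theta * l).+1)%N ->
  E (fun w => Y i w * Y j w) = K i j.
Proof.
move=> hi hj; have [s s0 [-> es]] := nablaE hi; have [s' s'0 [-> es']] := nablaE hj.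
rewrite (Ex_lincombM HX s0 s'0) es es' big_map /K /nabla_cov.
by apply: eq_bigr => k _; rewrite big_map.
Qed.

Let VE : V = (fun w => \sum_(i <- r) Y i w ^+ 2).
Proof.
apply/funext => w; rewrite /V /quadvar; apply: eq_big_nat => i hi.
by rewrite /Y hi.
Qed.

Lemma quadvar_has_moments : has_moments V.
Proof. by rewrite VE; apply: has_moments_sum => i; apply: has_momentsX. Qed.

Let sumS : \sum_(i <- r) E (fun w => Y i w * Y i w) =
  \sum_(1 <= i < (n - theta * l).+1) K i i.
Proof. by apply: eq_big_nat => i hi; exact: covY. Qed.

Let sumS2 : \sum_(i <- r) \sum_(j <- r) E (fun w => Y i w * Y j w) ^+ 2 =
  \sum_(1 <= i < (n - theta * l).+1) \sum_(1 <= j < (n - theta * l).+1) K i j ^+ 2.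
Proof.
apply: eq_big_nat => i hi; apply: eq_big_nat => j hj.
by rewrite covY.
Qed.

Lemma nabla_covC i j : (1 <= i < (n - theta * l).+1)%N ->
  (1 <= j < (n - theta * l).+1)%N -> K i j = K j i.
Proof.
move=> hi hj; rewrite -!covY//; congr E; apply/funext => w; exact: mulrC.
Qed.

Lemma nabla_cov_diag_ge0 i : (1 <= i < (n - theta * l).+1)%N -> 0 <= K i i.
Proof. by move=> hi; rewrite -covY//; apply: Ex_ge0 => w; rewrite -expr2 sqr_ge0. Qed.

(** E (Y_i + Y_j)^2 and E (Y_i - Y_j)^2 are nonnegative. *)
Lemma nabla_cov_le i j : (1 <= i < (n - theta * l).+1)%N ->
  (1 <= j < (n - theta * l).+1)%N -> `|K i j| <= (K i i + K j j) / 2.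
Proof.
move=> hi hj; rewrite -!covY//.
have mYY a b : has_moments (fun w => Y a w * Y b w) by exact: has_momentsM.
have key (e : R) : e ^+ 2 = 1 -> 0 <= E (fun w => Y i w * Y i w) +
    E (fun w => Y j w * Y j w) + 2 * e * E (fun w => Y i w * Y j w).
  move=> e2; have : 0 <= E (fun w => (Y i w + e * Y j w) ^+ 2).
    by apply: Ex_ge0 => w; exact: sqr_ge0.
  rewrite (_ : (fun w => _) = (fun w => (Y i w * Y i w + Y j w * Y j w) +
      (2 * e) * (Y i w * Y j w))); last first.
    apply/funext => w; rewrite sqrrD exprMn e2; ring.
  rewrite ExD ?ExD ?ExZ//; [exact: has_momentsD|exact: has_momentsZ].
have h1 := key 1 (expr1n _ _).
have h2 : 0 <= E (fun w => Y i w * Y i w) + E (fun w => Y j w * Y j w) +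
    2 * (-1) * E (fun w => Y i w * Y j w) by apply: key; rewrite sqrrN expr1n.
rewrite ler_norml; apply/andP; split; lra.
Qed.

Lemma Ex_quadvar : E V = \sum_(1 <= i < (n - theta * l).+1) K i i.
Proof.
rewrite -sumS VE Ex_sum; last by move=> i; apply: has_momentsX.
by apply: eq_bigr => i _; congr E; apply/funext => w; rewrite expr2.
Qed.

Lemma Ex_quadvar_var : E (fun w => (V w - E V) ^+ 2) =
  2 * \sum_(1 <= i < (n - theta * l).+1) \sum_(1 <= j < (n - theta * l).+1) K i j ^+ 2.
Proof.
rewrite -sumS2 -(quadratic_form_variance HG r HY) Ex_quadvar -sumS; congr E.
by apply/funext => w; rewrite VE.
Qed.

Lemma quadvar_moment_step (del : R) q : 0 < E V -> 0 <= del ->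
  \sum_(1 <= i < (n - theta * l).+1) \sum_(1 <= j < (n - theta * l).+1) K i j ^+ 2
    <= (del * E V) ^+ 2 ->
  4 * (2 * q).+1%:R * del <= 1 ->
  E (fun w => (V w / E V - 1) ^+ (2 * q).+2) <=
  8 * (2 * q).+1%:R * del * E (fun w => (V w / E V - 1) ^+ (2 * q)).
Proof.
move=> V0 d0; rewrite -sumS2 => hS hd.
have eV : E V = \sum_(i <- r) E (fun w => Y i w * Y i w) by rewrite Ex_quadvar -sumS.
have wE : (fun w => V w / E V - 1) =
    (fun w => (\sum_(i <- r) Y i w ^+ 2 - \sum_(i <- r) E (fun w => Y i w * Y i w)) /
      \sum_(i <- r) E (fun w => Y i w * Y i w)).
  by apply/funext => w; rewrite -eV mulrBl mulfV ?gt_eqF// VE.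
have := @quadratic_form_moment_step _ _ _ _ _ HG r _ HY del q.
rewrite -eV => /(_ V0 d0 hS hd).
have wE' w : (\sum_(i <- r) Y i w ^+ 2 - E V) / E V = V w / E V - 1.
  by have := congr1 (fun f => f w) wE; rewrite /= -eV => ->.
by under eq_fun do rewrite wE'; under [X in _ -> _ <= _ * E X]eq_fun do rewrite -wE';
  under [X in _ * E X]eq_fun do rewrite wE'.
Qed.

End QuadraticVariationLaw.

Section AlmostSure.
Context d (T : measurableType d) (R : realType) (P : probability T R).
Notation E := (Ex P).
Notation has_moments := (has_moments P).

Lemma sum_inv_sqr_le N : \sum_(0 <= n < N) (n.+1%:R ^- 2 : R) <= 2.
Proof.
suff H : \sum_(0 <= n < N.+1) (n.+1%:R ^- 2 : R) <= 2 - N.+1%:R^-1.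
  apply: (@le_trans _ _ (\sum_(0 <= n < N.+1) (n.+1%:R ^- 2 : R))).
    by rewrite big_nat_recr//= lerDl invr_ge0 exprn_ge0.
  by apply: le_trans H _; rewrite gerBl invr_ge0.
elim: N => [|N IHN]; first by rewrite big_nat1 expr1n invr1; lra.
rewrite big_nat_recr//=; apply: le_trans (lerD IHN (lexx _)) _.
have a0 : 0 < N.+1%:R :> R by rewrite ltr0n.
rewrite -[N.+2%:R]natr1; set a : R := N.+1%:R in a0 *.
rewrite -subr_ge0 [leRHS](_ : _ = (a * (a + 1) ^+ 2)^-1); last first.
  by field; rewrite !gt_eqF// addr_gt0.
by rewrite invr_ge0 mulr_ge0 ?sqr_ge0// ltW.
Qed.

(** The sum of the Z_n has finite expectation, so it converges almost surely. *)
Lemma ae_cvg0_of_summable (Z : nat -> T -> R) :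
  (forall n, has_moments (Z n)) -> (forall n w, 0 <= Z n w) ->
  (exists C : R, forall n, E (Z n) <= C / n.+1%:R ^+ 2) ->
  {ae P, forall w, (fun n => Z n w) @ \oo --> (0 : R)}.
Proof.
move=> mZ Z0 [C HC].
have C0 : 0 <= C.
  by have := le_trans (Ex_ge0 P (Z0 0%N)) (HC 0%N); rewrite expr1n divr1.
have mEZ n : measurable_fun setT (EFin \o Z n) by apply/measurable_EFinP; case: (mZ n).
have EZ n : (\int[P]_w (Z n w)%:E = (E (Z n))%:E)%E.
  rewrite /Ex /Rintegral fineK//; apply: integrable_fin_num => //.
  exact: has_moments_integrable.
have fin : (\int[P]_w \sum_(n <oo) (Z n w)%:E < +oo)%E.
  rewrite integral_nneseries//; last by move=> n w _; rewrite lee_fin.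
  apply: (@le_lt_trans _ _ (C * 2)%:E); last by rewrite ltry.
  apply: lime_le.
    by apply: is_cvg_nneseries => n _ _; rewrite EZ lee_fin Ex_ge0.
  apply: nearW => N; rewrite (eq_bigr (fun n => (E (Z n))%:E)) => [|n _]; last exact: EZ.
  rewrite sumEFin lee_fin; apply: le_trans (ler_wpM2l C0 (sum_inv_sqr_le N)).
  by rewrite mulr_sumr; apply: ler_sum => n _; exact: HC.
have ms : measurable_fun setT (fun w => (\sum_(n <oo) (Z n w)%:E)%E).
  apply: (@ge0_emeasurable_sum _ _ _ setT (fun n w => (Z n w)%:E) xpredT).
    by move=> n w _ _; rewrite lee_fin.
  by move=> n _; exact: mEZ.
have int : P.-integrable setT (fun w => (\sum_(n <oo) (Z n w)%:E)%E).
  apply/integrableP; split => //.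
  apply: le_lt_trans fin; rewrite le_eqVlt; apply/orP; left; apply/eqP.
  apply: eq_integral => w _; rewrite gee0_abs// nneseries_ge0// => n _ _.
  by rewrite lee_fin.
apply: filterS (integrable_ae measurableT int) => w /(_ I) sfin.
apply: cvg_series_cvg_0; apply: nondecreasing_is_cvgn.
  by apply: nondecreasing_series => n _ _; exact: Z0.
exists (fine (\sum_(n <oo) (Z n w)%:E)%E) => _ [N _ <-].
rewrite -lee_fin fineK// /series /= -sumEFin.
by apply: nneseries_lim_ge => n _ _; rewrite lee_fin.
Qed.

Lemma cvg_of_even_power (z : R^nat) q : (0 < q)%N ->
  (fun n => z n ^+ (2 * q)) @ \oo --> (0 : R) -> z @ \oo --> (0 : R).
Proof.
move=> q0 hz; apply/cvgrPdist_lt => e e0.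
have e1 : 0 < e ^+ (2 * q) by rewrite exprn_gt0.
move/cvgrPdist_lt : hz => /(_ _ e1); apply: filterS => n.
rewrite !sub0r !normrN normrX => h.
rewrite ltNge; apply/negP => le_ez.
move: h; rewrite ltNge => /negP; apply.
by apply: lerXn2r => //; rewrite nnegrE// ltW.
Qed.

End AlmostSure.

Section NormalisedVariation.
Context d (T : measurableType d) (R : realType) (P : probability T R).
Notation E := (Ex P).
Notation has_moments := (has_moments P).
Variables (X : R -> {RV P >-> R}) (mu : R) (Kt : R -> R).
Hypothesis HX : stationary_gaussian_process X mu Kt.
Variables (phi : R -> R) (theta l : nat).

Definition design_cov n := nabla_cov (design phi n) theta l Kt.
Definition sum_cov2 n : R :=
  \sum_(1 <= i < (n - theta * l).+1) \sum_(1 <= j < (n - theta * l).+1)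
     design_cov n i j ^+ 2.

Let EV := EV phi theta l X.
Let Z := normV phi theta l X.
Definition kills_constants n := forall i, (1 <= i < (n - theta * l).+1)%N ->
  \sum_(0 <= k < l.+1) acoef (design phi n) theta l i k = 0.

Let EVE n : EV n = E (V phi theta l X n).
Proof. by rewrite /EV /Defs.EV unlock. Qed.

Lemma EV_sum_cov n : kills_constants n ->
  EV n = \sum_(1 <= i < (n - theta * l).+1) design_cov n i i.
Proof. by move=> Hn; rewrite EVE (Ex_quadvar HX Hn). Qed.

Let moments_V n : kills_constants n -> has_moments (V phi theta l X n).
Proof. by move=> Hn; exact: (quadvar_has_moments HX Hn). Qed.

Lemma moments_normV n : kills_constants n -> has_moments (Z n).
Proof.
by move=> Hn; apply: has_momentsM; [exact: moments_V|exact: has_moments_cst].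
Qed.

Lemma Ex_normV n : kills_constants n -> EV n != 0 -> E (Z n) = 1.
Proof.
move=> Hn V0; rewrite /Z /normV -/EV; under eq_fun do rewrite mulrC.
by rewrite ExZ -?EVE ?mulVf//; exact: moments_V.
Qed.

Lemma variance_normV n : kills_constants n -> EV n != 0 ->
  variance P (Z n) = (2 * sum_cov2 n / EV n ^+ 2)%:E.
Proof.
move=> Hn V0; have mV := moments_V Hn.
have eZ : ('E_P[Z n])%E = 1%:E.
  rewrite unlock -(Ex_normV Hn V0) /Ex /Rintegral fineK//.
  apply: integrable_fin_num => //.
  exact: has_moments_integrable (moments_normV Hn).
rewrite /variance unlock eZ /= unlock.
have h : E (fun w => (Z n w - 1) ^+ 2) = 2 * sum_cov2 n / EV n ^+ 2.
  have <- : E (fun w => (V phi theta l X n w - EV n) ^+ 2) = 2 * sum_cov2 n.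
    by rewrite EVE; exact: (Ex_quadvar_var HX Hn).
  rewrite mulrC -ExZ; last first.
    by apply: has_momentsX; apply: has_momentsB => //; exact: has_moments_cst.
  by congr E; apply/funext => w; rewrite /Z /normV -/EV; field.
rewrite -h /Ex /Rintegral fineK; last first.
  apply: integrable_fin_num => //; apply: has_moments_integrable.
  apply: has_momentsX; apply: has_momentsB; last exact: has_moments_cst.
  exact: moments_normV.
by apply: eq_integral => w _; rewrite expr2.
Qed.

(** Induction on q; each step gains a factor del, a bound for the square root
    of the relative variance. *)
Lemma normV_even_moments q : exists C del0 : R, [/\ 0 <= C, 0 < del0 &
  forall n del, kills_constants n -> 0 < EV n -> 0 <= del <= del0 ->
    sum_cov2 n <= (del * EV n) ^+ 2 ->
    E (fun w => (Z n w - 1) ^+ (2 * q)) <= C * del ^+ q].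
Proof.
elim: q => [|q [C [del0 [C0 d0 IH]]]].
  exists 1, 1; split => // n del _ _ _ _.
  by under eq_fun do rewrite expr0; rewrite Ex_cst mulr1.
exists (8 * (2 * q).+1%:R * C), (Order.min del0 (4 * (2 * q).+1%:R)^-1); split.
- by rewrite !mulr_ge0.
- by rewrite lt_min d0 invr_gt0 mulr_gt0.
move=> n del Hn V0 /andP[de0]; rewrite le_min => /andP[d1 d2] hS.
have d3 : 4 * (2 * q).+1%:R * del <= 1.
  by rewrite mulrC -ler_pdivlMr ?mulr_gt0// mul1r.
have := quadvar_moment_step HX Hn; rewrite -!EVE => /(_ del q V0 de0 hS d3).
rewrite mulnS; move/le_trans; apply.
rewrite [leRHS](_ : _ = 8 * (2 * q).+1%:R * del * (C * del ^+ q)); last first.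
  by rewrite exprS; ring.
rewrite ler_wpM2l ?mulr_ge0//.
by apply: IH => //; rewrite de0 d1.
Qed.

(** Take p with p eps >= 2: the moment of order 4p of V / EV - 1 is O(n^-2),
    hence summable. *)
Lemma normV_as_cvg (C eps : R) : 0 < eps ->
  (\forall n \near \oo, [/\ kills_constants n, 0 < EV n &
     sum_cov2 n <= C * n%:R `^ (- eps) * EV n ^+ 2]) ->
  {ae P, forall w, (fun n => Z n w) @ \oo --> (1 : R)}.
Proof.
move=> e0 Hnear.
pose D := Order.max C 1.
have D0 : 0 < D by rewrite lt_max ltr01 orbT.
pose del n : R := Num.sqrt (D * n%:R `^ (- eps)).
have arg0 n : 0 <= D * n%:R `^ (- eps) by rewrite mulr_ge0 ?powR_ge0// ltW.
pose p := (Num.truncn (2 / eps)).+1.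
have pe : 2 <= eps * p%:R.
  by rewrite mulrC -ler_pdivrMr// ltW// truncnS_gt.
have [C1 [del0 [C10 d0 H1]]] := normV_even_moments (2 * p).
have del_near : \forall n \near \oo, del n <= del0.
  have : (fun n : nat => D * n%:R `^ (- eps)) @ \oo --> (0 : R).
    by rewrite -(mulr0 D); apply: cvgM; [exact: cvg_cst|exact: cvg_powR_nat].
  have d20 : 0 < del0 ^+ 2 by rewrite exprn_gt0.
  move/(near_le0 _ d20); apply: filterS => n h.
  by rewrite /del -(gtr0_norm d0) -sqrtr_sqr ler_wsqrtr.
have [N _ HN] : \forall n \near \oo, [/\ (0 < n)%N, del n <= del0, kills_constants n, 0 < EV n &
     sum_cov2 n <= C * n%:R `^ (- eps) * EV n ^+ 2].
  near=> n; have [h1 h2 h3] : [/\ kills_constants n, 0 < EV n &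
     sum_cov2 n <= C * n%:R `^ (- eps) * EV n ^+ 2] by near: n.
  by split => //; near: n; [exists 1%N|].
(* The finitely many terms for which the bounds may fail are dropped. *)
pose W n w := if (N <= n)%N then (Z n w - 1) ^+ (2 * (2 * p)) else 0.
have mW n : has_moments (W n).
  rewrite /W; case: leqP => hn; last exact: has_moments_cst.
  have [_ _ h _ _] := HN n hn.
  by apply: has_momentsX; apply: has_momentsB; [exact: moments_normV|exact: has_moments_cst].
have W0 n w : 0 <= W n w by rewrite /W; case: ifP => // _; rewrite exprM exprn_ge0// sqr_ge0.
have EW : exists C2 : R, forall n, E (W n) <= C2 / n.+1%:R ^+ 2.
  exists (4 * C1 * D ^+ p) => n.
  have [hn|hn] := leqP N n; last first.
    rewrite /W leqNgt hn /= Ex_cst divr_ge0 ?mulr_ge0 ?exprn_ge0//; exact: ltW.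
  have [n0 h1 h2 h3 h4] := HN n hn.
  rewrite /W hn; apply: le_trans (H1 n (del n) h2 h3 _ _) _.
  - by rewrite h1 andbT sqrtr_ge0.
  - rewrite exprMn sqr_sqrtr//; apply: le_trans h4 _.
    by rewrite ler_wpM2r ?sqr_ge0// ler_wpM2r ?powR_ge0// le_max lexx.
  rewrite exprM sqr_sqrtr// exprMn -[X in _ * (_ * X)]powR_mulrn ?powR_ge0// -powRrM.
  have n1 : 1 <= n%:R :> R by rewrite ler1n.
  have hp : n%:R `^ (- eps * p%:R) <= n%:R ^- 2 :> R.
    rewrite -powR_invn//; apply: ler_powR => //; lra.
  have hq : n%:R ^- 2 <= 4 / n.+1%:R ^+ 2 :> R.
    rewrite ler_pdivlMr ?exprn_gt0// mulrC ler_pdivrMr ?exprn_gt0 ?ltr0n// -natr1.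
    by nra.
  rewrite [leRHS](_ : _ = C1 * (D ^+ p * (4 / n.+1%:R ^+ 2))); last by ring.
  rewrite ler_wpM2l// ler_wpM2l ?exprn_ge0//; first exact: ltW.
  exact: le_trans hp hq.
have := ae_cvg0_of_summable mW W0 EW; apply: filterS => w hw.
have hz : (fun n => (Z n w - 1) ^+ (2 * (2 * p))) @ \oo --> (0 : R).
  apply: cvg_trans hw; apply: near_eq_cvg.
  by exists N => // n /= hn; rewrite /W hn.
have := cvg_of_even_power (isT : (0 < 2 * p)%N) hz.
by move/cvg_sub0; apply; exact: cvg_cst.
Unshelve. all: by end_near. Qed.

End NormalisedVariation.

(** * Divided differences *)

Section DividedDifferences.
Context (R : realType).
Implicit Types (w z : nat -> R) (F : nat -> R -> R) (J : set R).

Definition ddcoef w (l k : nat) : R :=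
  l`!%:R / \prod_(0 <= j < l.+1 | j != k) (w k - w j).

Definition increasing_upto (l : nat) z := forall k, (k < l)%N -> z k < z k.+1.

Lemma increasing_upto_lt l z i j : increasing_upto l z ->
  (i < j)%N -> (j <= l)%N -> z i < z j.
Proof.
move=> hz; elim: j => // j IHj; rewrite ltnS leq_eqVlt => /orP[/eqP->|ij] jl.
  exact: hz.
by apply: lt_trans (IHj ij (ltnW jl)) (hz _ jl).
Qed.

Lemma increasing_upto_le l z i j : increasing_upto l z ->
  (i <= j)%N -> (j <= l)%N -> z i <= z j.
Proof.
move=> hz; rewrite leq_eqVlt => /orP[/eqP-> //|ij] jl.
exact/ltW/(increasing_upto_lt hz).
Qed.

Lemma increasing_upto_inj l z i j : increasing_upto l z ->
  (i <= l)%N -> (j <= l)%N -> i != j -> z i != z j.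
Proof.
move=> hz il jl; rewrite neq_ltn => /orP[ij|ji].
  by rewrite lt_eqF// (increasing_upto_lt hz ij).
by rewrite gt_eqF// (increasing_upto_lt hz ji).
Qed.

Let node_poly w l k : {poly R} := \prod_(0 <= j < l.+1 | j != k) ('X - (w j)%:P).

Let size_sum_leq (I : Type) (r : seq I) (Q : pred I) (G : I -> {poly R}) m :
  (forall i, Q i -> (size (G i) <= m)%N) -> (size (\sum_(i <- r | Q i) G i)%R <= m)%N.
Proof.
move=> h; elim/big_ind: _ => //; first by rewrite size_poly0.
by move=> p q hp hq; apply: leq_trans (size_polyD _ _) _; rewrite geq_max hp.
Qed.

Let size_node_poly w l k : (k <= l)%N -> size (node_poly w l k) = l.+1.
Proof.
move=> kl; rewrite /node_poly -big_filter size_prod_XsubC; congr _.+1.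
rewrite size_filter /index_iota subn0.
have := count_predC (pred1 k) (iota 0 l.+1).
rewrite count_uniq_mem ?iota_uniq// mem_iota leq0n add0n ltnS kl size_iota add1n.
by move=> [].
Qed.

(** Lagrange interpolation, read off on the leading coefficient. *)
Lemma ddcoef_poly w l (p : {poly R}) : increasing_upto l w -> (size p <= l.+1)%N ->
  \sum_(0 <= k < l.+1) ddcoef w l k * p.[w k] = l`!%:R * p`_l.
Proof.
move=> hw sp.
pose c k := (\prod_(0 <= j < l.+1 | j != k) (w k - w j))^-1.
pose q := \sum_(0 <= k < l.+1) (c k * p.[w k]) *: node_poly w l k.
have hnode k : (node_poly w l k).[w k] = \prod_(0 <= j < l.+1 | j != k) (w k - w j).
  rewrite /node_poly horner_prod; apply: eq_bigr => j _; by rewrite hornerXsubC.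
have node0 k m : (m <= l)%N -> m != k -> (node_poly w l k).[w m] = 0.
  move=> ml mk; rewrite /node_poly horner_prod.
  apply/eqP; rewrite prodf_seq_eq0; apply/hasP; exists m.
    by rewrite mem_index_iota.
  by rewrite mk hornerXsubC subrr eqxx.
have cn0 k : (k <= l)%N -> (node_poly w l k).[w k] != 0.
  move=> kl; rewrite hnode prodf_seq_neq0; apply/allP => j.
  rewrite mem_index_iota => /andP[_ jl]; apply/implyP => jk.
  by rewrite subr_eq0 (increasing_upto_inj hw)// eq_sym.
have qw m : (m <= l)%N -> q.[w m] = p.[w m].
  move=> ml; rewrite /q horner_sum (bigD1_seq m) ?iota_uniq ?mem_index_iota//=.
  rewrite hornerZ hnode mulrAC /c mulVf -?hnode ?cn0// mul1r big_nat_cond big1 ?addr0// => k.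
  move=> /andP[/andP[_ kl] km]; rewrite hornerZ node0 ?mulr0// eq_sym; exact: km.
have sq : (size q <= l.+1)%N.
  rewrite /q big_nat_cond; apply: size_sum_leq => k /andP[/andP[_ kl] _].
  by apply: leq_trans (size_scale_leq _ _) _; rewrite size_node_poly.
have pq : p = q.
  apply/eqP; rewrite -subr_eq0; apply/eqP.
  apply: (@roots_geq_poly_eq0 _ _ [seq w k | k <- iota 0 l.+1]).
  - apply/allP => x /mapP[k]; rewrite mem_iota add0n ltnS => /andP[_ kl] ->.
    by rewrite rootE hornerD hornerN qw// subrr.
  - rewrite map_inj_in_uniq ?iota_uniq// => i j.
    rewrite !mem_iota !add0n !ltnS /= => il jl /eqP; apply: contraTeq => ij.
    by rewrite (increasing_upto_inj hw).
  - rewrite size_map size_iota.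
    by apply: leq_trans (size_polyD _ _) _; rewrite size_polyN geq_max sp sq.
rewrite [in RHS]pq coef_sum mulr_sumr !big_nat; apply: eq_bigr => k /andP[_ kl].
rewrite coefZ /ddcoef -/(c k) -mulrA; congr (_ * _).
have /monicP : node_poly w l k \is monic.
  by rewrite /node_poly monic_prod_XsubC.
by rewrite lead_coefE size_node_poly// => ->; rewrite mulr1.
Qed.

Lemma ddcoef_sum w l : increasing_upto l w -> (0 < l)%N ->
  \sum_(0 <= k < l.+1) ddcoef w l k = 0.
Proof.
move=> hw l0; have := @ddcoef_poly w l 1 hw.
rewrite size_poly1 => /(_ isT); rewrite coefC gtn_eqF// mulr0 => h; rewrite -[RHS]h.
by apply: eq_bigr => k _; rewrite hornerC mulr1.
Qed.

(** Successive derivatives are carried as a sequence of functions, so that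
    translates and combinations need no formula for iterated derivatives. *)
Definition derive_chain (J : set R) (l : nat) F :=
  forall j x, (j < l)%N -> J x -> is_derive x 1 (F j) (F j.+1 x).

Lemma derive_chain_shift J l F : derive_chain J l.+1 F ->
  derive_chain J l (fun j => F j.+1).
Proof. by move=> h j x jl; exact: h. Qed.

Lemma rolle_zeros J (f f' : R -> R) l z : is_interval J ->
  (forall x, J x -> is_derive x 1 f (f' x)) ->
  increasing_upto l.+1 z -> (forall k, (k <= l.+1)%N -> J (z k)) ->
  (forall k, (k <= l.+1)%N -> f (z k) = 0) ->
  exists y : nat -> R, forall k, (k <= l)%N -> z k < y k < z k.+1 /\ f' (y k) = 0.
Proof.
move=> iJ df hz Jz fz.
have H k : exists y : R, (k <= l)%N -> z k < y < z k.+1 /\ f' y = 0.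
  have [kl|kl] := leqP k l; last by exists 0.
  have zk : z k < z k.+1 by apply: hz.
  have Jx x : x \in `[z k, z k.+1] -> J x.
    rewrite in_itv /= => xz; apply: (iJ (z k) (z k.+1)) => //; apply: Jz => //; exact: leqW.
  have dx x : x \in `[z k, z k.+1] -> derivable f x 1.
    by move=> /Jx /df [].
  have [||y yz y0] := Rolle zk _ _ (etrans (fz k (leqW kl)) (esym (fz k.+1 kl))).
  - by move=> x xz; apply: dx; exact: subset_itv_oo_cc xz.
  - exact: derivable_within_continuous.
  exists y => _; split; first by move: yz; rewrite in_itv.
  have /df dy := Jx y (subset_itv_oo_cc yz).
  by rewrite -(@derive_val _ _ _ _ _ _ _ dy) (@derive_val _ _ _ _ _ _ _ y0).
by have [y Hy] := choice H; exists y.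
Qed.

Lemma rolle_iter l J F z : is_interval J -> derive_chain J l F ->
  increasing_upto l z -> (forall k, (k <= l)%N -> J (z k)) ->
  (forall k, (k <= l)%N -> F 0%N (z k) = 0) ->
  exists2 x, z 0%N <= x <= z l & F l x = 0.
Proof.
elim: l F z => [|l IHl] F z iJ dF hz Jz Fz.
  by exists (z 0%N); rewrite ?lexx// Fz.
have [y Hy] := rolle_zeros iJ (fun x => dF 0%N x isT) hz Jz Fz.
have [|||x /andP[yx xy] Fx] := IHl (fun j => F j.+1) y iJ (derive_chain_shift dF).
- move=> k kl; have [/andP[_ h1] _] := Hy k (ltnW kl).
  by have [/andP[h2 _] _] := Hy k.+1 kl; exact: lt_trans h1 h2.
- move=> k kl; have [/andP[h1 h2] _] := Hy k kl.
  apply: (iJ (z k) (z k.+1)); rewrite ?(ltW h1) ?(ltW h2)//; apply: Jz => //; exact: leqW.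
- by move=> k kl; have [_] := Hy k kl.
exists x => //; apply/andP; split.
  by have [/andP[h _] _] := Hy 0%N isT; exact: le_trans (ltW h) yx.
by have [/andP[_ h] _] := Hy l (leqnn l); exact: le_trans xy (ltW h).
Qed.

Lemma is_derive_horner (p : {poly R}) (x : R) : is_derive x 1 (horner p) p^`().[x].
Proof.
by apply: DeriveDef; [exact: derivable_horner|rewrite derivE derive1E].
Qed.

(** The difference of F and its interpolation polynomial at the points w
    vanishes at l + 1 points, so its l-th derivative vanishes somewhere
    (Rolle). *)
Lemma ddcoef_mvt l J F w : is_interval J -> derive_chain J l F ->
  increasing_upto l w -> (forall k, (k <= l)%N -> J (w k)) ->
  exists2 x, w 0%N <= x <= w l &
    \sum_(0 <= k < l.+1) ddcoef w l k * F 0%N (w k) = F l x.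
Proof.
move=> iJ dF hw Jw.
pose c k := (\prod_(0 <= j < l.+1 | j != k) (w k - w j))^-1.
have [p sp pw] : exists2 p : {poly R}, (size p <= l.+1)%N &
    forall k, (k <= l)%N -> p.[w k] = F 0%N (w k).
  exists (\sum_(0 <= k < l.+1) (c k * F 0%N (w k)) *: node_poly w l k).
    rewrite big_nat_cond; apply: size_sum_leq => k /andP[/andP[_ kl] _].
    by apply: leq_trans (size_scale_leq _ _) _; rewrite size_node_poly.
  move=> m ml; rewrite horner_sum (bigD1_seq m) ?iota_uniq ?mem_index_iota//=.
  rewrite hornerZ [X in _ * X](_ : _ = (c m)^-1); last first.
    by rewrite invrK /node_poly horner_prod; apply: eq_bigr => j _; rewrite hornerXsubC.
  rewrite mulrAC mulfV ?mul1r; last first.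
    rewrite invr_eq0 prodf_seq_neq0; apply/allP => j.
    rewrite mem_index_iota => /andP[_ jl]; apply/implyP => jk.
    by rewrite subr_eq0 (increasing_upto_inj hw)// eq_sym.
  rewrite big_nat_cond big1 ?addr0// => k /andP[/andP[_ kl] km].
  rewrite hornerZ /node_poly horner_prod; apply/eqP; rewrite mulf_eq0; apply/orP; right.
  rewrite prodf_seq_eq0; apply/hasP; exists m; first by rewrite mem_index_iota.
  by rewrite eq_sym km hornerXsubC subrr eqxx.
have [||||x xw Gx] := @rolle_iter l J (fun j x => F j x - p^`(j).[x]) w iJ.
- move=> j x jl Jx; apply: is_deriveB; first exact: dF.
- by [].
- by [].
- by move=> k kl; rewrite derivn0 pw// subrr.
exists x => //; move/eqP : Gx; rewrite subr_eq0 => /eqP ->.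
have -> : p^`(l) = (l`!%:R * p`_l)%:P.
  apply/polyP => i; rewrite coef_derivn coefC; case: eqP => [->|/eqP i0].
    by rewrite addn0 ffactnn mulr_natl.
  by rewrite nth_default ?mul0rn// (leq_trans sp)// -addn1 leq_add2l lt0n.
rewrite hornerC -(ddcoef_poly hw sp) !big_nat.
by apply: eq_bigr => k /andP[_ kl]; rewrite pw.
Qed.

Lemma is_derive_sum_seq (I : Type) (r : seq I) (f : I -> R -> R) (df : I -> R) (x : R) :
  (forall i, is_derive x 1 (f i) (df i)) ->
  is_derive x 1 (fun y => \sum_(i <- r) f i y) (\sum_(i <- r) df i).
Proof.
move=> h; elim: r => [|i r IHr].
  by under eq_fun do rewrite big_nil; rewrite big_nil; exact: is_derive_cst.
by under eq_fun do rewrite big_cons; rewrite big_cons; exact: is_deriveD.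
Qed.

Definition ddcov (w z : nat -> R) l (K : R -> R) : R :=
  \sum_(0 <= k1 < l.+1) \sum_(0 <= k2 < l.+1)
    ddcoef w l k1 * ddcoef z l k2 * K (w k1 - z k2).

(** The mean value theorem is applied first to x |-> sum_k ddcoef z k K(x -
    z_k), then to y |-> K^(l)(x - y). *)
Lemma ddcov_mvt l (J : set R) K w z : is_interval J -> derive_chain J (l + l) K ->
  increasing_upto l w -> increasing_upto l z ->
  (forall x y, w 0%N <= x <= w l -> z 0%N <= y <= z l -> J (x - y)) ->
  exists2 u, w 0%N - z l <= u <= w l - z 0%N &
    ddcov w z l (K 0%N) = (-1) ^+ l * K (l + l)%N u.
Proof.
move=> iJ dK hw hz hJ.
have itv (a b : R) : is_interval [set x | a <= x <= b].
  move=> x y /= /andP[ax xb] /andP[ay yb] u /andP[xu uy].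
  by rewrite (le_trans ax xu) (le_trans uy yb).
have zk k : (k <= l)%N -> z 0%N <= z k <= z l.
  by move=> kl; rewrite !(increasing_upto_le hz).
have wk k : (k <= l)%N -> w 0%N <= w k <= w l.
  by move=> kl; rewrite !(increasing_upto_le hw).
pose F j x := \sum_(0 <= k < l.+1) ddcoef z l k * K j (x - z (minn k l)).
have [|||x xw Fx] := @ddcoef_mvt l [set x | w 0%N <= x <= w l] F w (itv _ _).
- move=> j x jl /= xw; apply: is_derive_sum_seq => k.
  have dk : is_derive x 1 (fun y => K j (y - z (minn k l))) (K j.+1 (x - z (minn k l))).
    have dKx : is_derive (x - z (minn k l)) 1 (K j) (K j.+1 (x - z (minn k l))).
      apply: dK; first by rewrite ltn_addr.
      by apply: hJ => //; apply: zk; rewrite geq_minr.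
    have dl : is_derive x 1 (fun y : R => y - z (minn k l)) 1.
      by apply: is_derive_eq; rewrite subr0.
    by apply: (is_derive_eq (@is_derive1_comp _ (K j) (fun y : R => y - z (minn k l)) x _ _ dKx dl)); rewrite mulr1.
  by apply: (is_derive_eq (is_deriveZ (ddcoef z l k) dk)).
- by [].
- exact: wk.
pose H j y := (-1) ^+ j * K (l + j)%N (x - y).
have [|||y yz Hy] := @ddcoef_mvt l [set y | z 0%N <= y <= z l] H z (itv _ _).
- move=> j y jl /= yz; rewrite /H.
  have dKx : is_derive (x - y) 1 (K (l + j)%N) (K (l + j).+1 (x - y)).
    by apply: dK; [rewrite ltn_add2l|exact: hJ].
  have dl : is_derive y 1 (fun y : R => x - y) (-1).
      by apply: is_derive_eq; ring.
  apply: (is_derive_eq (is_deriveZ ((-1) ^+ j) (@is_derive1_comp _ (K (l + j)%N) (fun y : R => x - y) y _ _ dKx dl))).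
  by rewrite /GRing.scale /= exprS addnS; ring.
- by [].
- exact: zk.
exists (x - y).
  move: xw yz => /andP[h1 h2] /andP[h3 h4]; apply/andP; split; lra.
rewrite -[RHS]/(H l y) -Hy.
transitivity (\sum_(0 <= k1 < l.+1) ddcoef w l k1 * F 0%N (w k1)).
  rewrite /ddcov; apply: eq_bigr => k1 _; rewrite /F mulr_sumr !big_nat.
  apply: eq_bigr => k2 /andP[_ k2l]; rewrite (minn_idPl _) ?mulrA//.
rewrite Fx /F !big_nat; apply: eq_bigr => k /andP[_ kl].
by rewrite (minn_idPl _)// /H expr0 mul1r addn0.
Qed.

Lemma ddcov_monomial_lt w l j : increasing_upto l w -> (j < l)%N ->
  ddcov w w l (fun x => x ^+ (2 * j)) = 0.
Proof.
move=> hw jl.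
have [|||u _] := @ddcov_mvt l setT (fun i x => ('X^(2 * j))^`(i).[x]) w w _ _ hw hw.
- by [].
- by move=> i x _ _; exact: is_derive_horner.
- by [].
have -> : ('X^(2 * j) : {poly R})^`(l + l) = 0.
  by apply: derivn_poly0; rewrite size_polyXn; lia.
rewrite hornerC mulr0 => h; rewrite -[RHS]h; apply: eq_bigr => k1 _; apply: eq_bigr => k2 _.
by rewrite derivn0 hornerXn.
Qed.

Lemma ddcov_monomial_eq w l : increasing_upto l w ->
  ddcov w w l (fun x => x ^+ (2 * l)) = (-1) ^+ l * (2 * l)`!%:R.
Proof.
move=> hw.
have [|||u _] := @ddcov_mvt l setT (fun i x => ('X^(2 * l))^`(i).[x]) w w _ _ hw hw.
- by [].
- by move=> i x _ _; exact: is_derive_horner.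
- by [].
have -> : ('X^(2 * l) : {poly R})^`(l + l) = (2 * l)`!%:R%:P.
  apply/polyP => i; rewrite coef_derivn coefC coefXn; case: eqP => [|] i0.
    have -> : i = 0%N by lia.
    by rewrite addn0 addnn -mul2n ffactnn.
  by case: eqP => [i1|_]; [lia|rewrite mul0rn].
rewrite hornerC => <-; apply: eq_bigr => k1 _; apply: eq_bigr => k2 _.
by rewrite derivn0 hornerXn.
Qed.

End DividedDifferences.

(** * Zeros of exponential sums *)

Section ExponentialSums.
Context (R : realType).
Implicit Types (lam c : nat -> R).

Definition expsum (N : nat) lam c (x : R) : R :=
  \sum_(0 <= m < N) c m * expR (lam m * x).

Lemma is_derive_expsum N lam c (x : R) :
  is_derive x 1 (expsum N lam c) (expsum N lam (fun m => c m * lam m) x).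
Proof.
apply: is_derive_sum_seq => m.
have dl : is_derive x 1 (fun y : R => lam m * y) (lam m).
  by apply: is_derive_eq; rewrite /GRing.scale/= mulr1.
apply: (is_derive_eq (is_deriveZ (c m)
  (@is_derive1_comp _ expR (fun y : R => lam m * y) x _ _ (is_derive_expR _) dl))).
by rewrite /GRing.scale /=; ring.
Qed.

Lemma expsum_shift N lam c (a x : R) :
  expsum N (fun m => lam m - a) c x = expR (- (a * x)) * expsum N lam c x.
Proof.
rewrite /expsum mulr_sumr; apply: eq_bigr => m _.
by rewrite mulrCA -expRD; congr (_ * expR _); ring.
Qed.

Let red N lam c : nat -> R := fun m => c m * (lam m - lam N).

Let lam_shift N lam : nat -> R := fun m => lam m - lam N.

Let is_derive_red N lam c (x : R) :
  is_derive x 1 (expsum N.+1 (lam_shift N lam) c)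
                (expsum N (lam_shift N lam) (red N lam c) x).
Proof.
apply: (is_derive_eq (is_derive_expsum _ _ _ _)).
by rewrite /expsum big_nat_recr//= /lam_shift subrr mulr0 mul0r addr0.
Qed.

Let distinct N lam := forall i j, (i < N)%N -> (j < N)%N -> i != j -> lam i != lam j.

Let red_eq0 N lam c : distinct N.+1 lam ->
  (forall m, (m < N)%N -> red N lam c m = 0) ->
  forall x, expsum N.+1 lam c x = 0 -> forall m, (m < N.+1)%N -> c m = 0.
Proof.
move=> hd h x; have cm m : (m < N)%N -> c m = 0.
  move=> mN; have /eqP := h m mN; rewrite mulf_eq0 => /orP[/eqP //|].
  by rewrite subr_eq0 (negbTE (hd m N _ _ _))// ?ltn_eqF// ltnW.
rewrite /expsum big_nat_recr//= big_nat big1 ?add0r => [/eqP|m /andP[_ mN]]; last first.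
  by rewrite cm// mul0r.
rewrite mulf_eq0 expR_eq0 orbF => /eqP cN m.
by rewrite ltnS leq_eqVlt => /orP[/eqP-> //|]; exact: cm.
Qed.

Let distinct_shift N lam : distinct N.+1 lam -> distinct N (lam_shift N lam).
Proof.
move=> hd i j iN jN ij; rewrite /lam_shift (inj_eq (addIr _)).
by apply: hd => //; exact: ltnW.
Qed.

Let interval_setT : is_interval [set: R]. Proof. by []. Qed.

(** An exponential sum with N + 1 distinct frequencies and N + 1 zeros is
    trivial. Multiplying by an exponential makes one frequency 0; the
    derivative loses that term and, by Rolle, one zero. *)
Lemma expsum_zeros N lam c z : distinct N.+1 lam -> increasing_upto N z ->
  (forall k, (k <= N)%N -> expsum N.+1 lam c (z k) = 0) ->
  forall m, (m < N.+1)%N -> c m = 0.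
Proof.
elim: N lam c z => [|N IHN] lam c z hd hz Fz.
  have := Fz 0%N isT; rewrite /expsum big_nat1 => /eqP.
  by rewrite mulf_eq0 expR_eq0 orbF => /eqP c0 [].
have Gz k : (k <= N.+1)%N -> expsum N.+2 (lam_shift N.+1 lam) c (z k) = 0.
  by move=> kN; rewrite expsum_shift Fz// mulr0.
have [y Hy] := rolle_zeros interval_setT
  (fun x _ => is_derive_red N.+1 lam c x) hz (fun _ _ => I) Gz.
apply: (red_eq0 hd _ (Fz 0%N isT)).
apply: (IHN _ _ y (distinct_shift hd)).
- move=> k kN; have [/andP[_ h1] _] := Hy k (ltnW kN).
  by have [/andP[h2 _] _] := Hy k.+1 kN; exact: lt_trans h1 h2.
- by move=> k kN; have [_] := Hy k kN.
Qed.

(** Same bound with multiplicity: the derivative vanishes between consecutive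
    zeros and also at the double zero z_k0. *)
Lemma expsum_double_zero N lam c z k0 : distinct N.+2 lam -> increasing_upto N z ->
  (k0 <= N)%N ->
  (forall k, (k <= N)%N -> expsum N.+2 lam c (z k) = 0) ->
  expsum N.+2 lam (fun m => c m * lam m) (z k0) = 0 ->
  forall m, (m < N.+2)%N -> c m = 0.
Proof.
move=> hd hz k0N Fz dFz.
have Gz k : (k <= N)%N -> expsum N.+2 (lam_shift N.+1 lam) c (z k) = 0.
  by move=> kN; rewrite expsum_shift Fz// mulr0.
have [y Hy] : exists y : nat -> R, forall k, (k < N)%N -> z k < y k < z k.+1 /\
    expsum N.+1 (lam_shift N.+1 lam) (red N.+1 lam c) (y k) = 0.
  case: N {k0N Fz} hd hz dFz Gz => [|N] hd hz dFz Gz; first by exists z.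
  have [y Hy] := rolle_zeros interval_setT
    (fun x _ => is_derive_red N.+2 lam c x) hz (fun _ _ => I) Gz.
  by exists y => k kN; apply: Hy.
have dGz : expsum N.+1 (lam_shift N.+1 lam) (red N.+1 lam c) (z k0) = 0.
  have d1 := is_derive_red N.+1 lam c (z k0).
  have d2 := is_derive_expsum N.+2 (lam_shift N.+1 lam) c (z k0).
  rewrite -(@derive_val _ _ _ _ _ _ _ d1) (@derive_val _ _ _ _ _ _ _ d2).
  have -> : expsum N.+2 (lam_shift N.+1 lam) (fun m => c m * lam_shift N.+1 lam m) (z k0) =
     expsum N.+2 (lam_shift N.+1 lam) (fun m => c m * lam m) (z k0)
     - lam N.+1 * expsum N.+2 (lam_shift N.+1 lam) c (z k0).
    by rewrite /expsum mulr_sumr -sumrB; apply: eq_bigr => m _; rewrite /lam_shift; ring.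
  by rewrite Gz// mulr0 subr0 expsum_shift dFz mulr0.
apply: (red_eq0 hd _ (Fz 0%N isT)).
(* the zeros between consecutive points z_k, with z_k0 inserted *)
pose u i := if (i < k0)%N then y i else if i == k0 then z k0 else y i.-1.
apply: (@expsum_zeros _ _ _ u (distinct_shift hd)).
- move=> i iN; rewrite /u.
  have [ik|ik|ik] := ltngtP i k0.
  + have [/andP[h1 h2] _] := Hy i iN.
    have [i1k|i1k|i1k] := ltngtP i.+1 k0; last by rewrite -i1k.
      have [/andP[h3 h4] _] := Hy i.+1 (leq_trans i1k k0N).
      exact: lt_trans h2 h3.
    by move: (leq_trans i1k ik); rewrite ltnn.
  + have i0 : (0 < i)%N by exact: leq_ltn_trans ik.
    rewrite ltnNge (ltnW (leqW ik)) /= gtn_eqF ?leqW//=.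
    have [/andP[h1 h2] _] := Hy i iN.
    have [/andP[_ h4] _] := Hy i.-1 (leq_ltn_trans (leq_pred i) iN).
    by move: h4; rewrite prednK// => h4; exact: lt_trans h4 h1.
  + rewrite ltnNge ik leqnSn /= gtn_eqF//.
    have k0N' : (k0 < N)%N by rewrite -ik.
    by have [/andP[h1 _] _] := Hy k0 k0N'.
- move=> i iN; rewrite /u; have [ik|ik|ik //] := ltngtP i k0.
    by have [_] := Hy i (leq_trans ik k0N).
  by apply: (Hy i.-1 _).2; rewrite prednK// (leq_ltn_trans _ ik).
Qed.

End ExponentialSums.

Section LimitingForm.
Context (R : realType).

Definition grid (k : nat) : R := k%:R.

Lemma increasing_grid l : increasing_upto l grid.
Proof. by move=> k _; rewrite /grid ltr_nat. Qed.

(** The variance of the l-th difference of step 1 for the generalised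
    covariance G_nu; for nu < l, bstar times it is the constant in front of
    h^(2 nu - 2 l). *)
Definition Qlim (nu : R) (l : nat) : R :=
  ddcov grid grid l (fun x => Gfun nu `|x|).

Let lag (k1 k2 : nat) : nat := (k1 - k2 + (k2 - k1))%N.

Let lagE k1 k2 : `|grid k1 - grid k2| = (lag k1 k2)%:R.
Proof.
rewrite /grid /lag; have [h|h] := leqP k1 k2.
  have -> : (k1 - k2 = 0)%N by lia.
  by rewrite add0n distrC -natrB// normr_nat.
have -> : (k2 - k1 = 0)%N by lia.
by rewrite addn0 -natrB ?normr_nat// ltnW.
Qed.

Let wt l (m : nat) : R := \sum_(0 <= k1 < l.+1) \sum_(0 <= k2 < l.+1)
  ddcoef grid l k1 * ddcoef grid l k2 * (lag k1 k2 == m.+1)%:R.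

Let ddcov_lag l (g : R -> R) : g 0 = 0 ->
  ddcov grid grid l (fun x => g `|x|) = \sum_(0 <= m < l) wt l m * g m.+1%:R.
Proof.
move=> g0; rewrite /wt /ddcov; under [RHS]eq_bigr do rewrite mulr_suml.
rewrite [RHS]exchange_big /= !big_nat; apply: eq_bigr => k1 /andP[_ k1l].
under [RHS]eq_bigr do rewrite mulr_suml.
rewrite [RHS]exchange_big /= !big_nat; apply: eq_bigr => k2 /andP[_ k2l].
under [RHS]eq_bigr do rewrite -mulrA.
rewrite -mulr_sumr lagE; congr (_ * _).
case E : (lag k1 k2) => [|m].
  by rewrite big1 ?g0// => m _; rewrite mul0r.
have ml : (m < l)%N by move: E; rewrite /lag; lia.
rewrite (bigD1_seq m) ?iota_uniq ?mem_index_iota//= eqxx mul1r.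
by rewrite big1 ?addr0// => j jm; rewrite eqSS eq_sym (negbTE jm) mul0r.
Qed.

Let lam (m : nat) : R := 2 * ln m.+1%:R.

Let lam_inj i j : i != j -> lam i != lam j.
Proof.
move=> ij; rewrite /lam; apply: contra_neq ij => /(mulfI _) h.
have /eqP : (i.+1%:R : R) = j.+1%:R.
  by apply: ln_inj; rewrite ?posrE ?ltr0n//; apply: h; rewrite pnatr_eq0.
by rewrite eqr_nat => /eqP [].
Qed.

Let lam_powR (x : R) m : expR (lam m * x) = m.+1%:R `^ (2 * x).
Proof.
by rewrite /powR pnatr_eq0 /=; congr expR; rewrite /lam; ring.
Qed.

Let F l := expsum l lam (wt l).

Let F_integer l j : (0 < j)%N ->
  F l j%:R = ddcov grid grid l (fun x => x ^+ (2 * j)).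
Proof.
move=> j0; rewrite /F /expsum.
have := @ddcov_lag l (fun x => x ^+ (2 * j)).
rewrite expr0n muln_eq0 /= (gtn_eqF j0) => /(_ erefl).
have -> : ddcov grid grid l (fun x => `|x| ^+ (2 * j)) = ddcov grid grid l (fun x => x ^+ (2 * j)) :> R.
  rewrite /ddcov; apply: eq_bigr => k1 _; apply: eq_bigr => k2 _.
  by rewrite !exprM real_normK ?num_real.
move=> ->; apply: eq_bigr => m _; rewrite lam_powR -natrM powR_mulrn//.
Qed.

Let F_zero l j : (0 < j < l)%N -> F l j%:R = 0.
Proof.
by move=> /andP[j0 jl]; rewrite F_integer// ddcov_monomial_lt//; exact: increasing_grid.
Qed.

Let wt_neq0 l : (0 < l)%N -> ~ (forall m, (m < l)%N -> wt l m = 0).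
Proof.
move=> l0 h; have := @F_integer l l l0.
rewrite ddcov_monomial_eq; last exact: increasing_grid.
rewrite /F /expsum big_nat big1 => [/esym/eqP|m /andP[_ ml]]; last by rewrite h// mul0r.
by rewrite mulf_eq0 signr_eq0 /= pnatr_eq0 gtn_eqF// fact_gt0.
Qed.

(** Qlim is the value at nu of an exponential sum F with frequencies 2 log 1,
    ..., 2 log l, or half its derivative when nu is an integer. Since F(j) is
    the quadratic form of the monomial x^(2j), F vanishes at 1, ..., l - 1 and
    not at l. A further zero, or a double one, would make F identically 0. *)
Lemma Qlim_neq0 (nu : R) l : 0 < nu < l%:R -> Qlim nu l != 0.
Proof.
move=> /andP[nu0 nul].
have l0 : (0 < l)%N by rewrite -(ltr_nat R) (lt_trans nu0).
apply/negP => /eqP; rewrite /Qlim.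
have G0 : Gfun nu 0 = 0 by rewrite /Gfun eqxx.
have [nuZ|nuZ] := boolP (nu \is a Num.int).
  (* G_nu has a factor log m, hence the derivative of F at the zero nu of F *)
  have [j jE] : exists j : nat, nu = j.+1%:R.
    have := nuZ; rewrite intrEge0 ?ltW// => /natrP[[|j] jE]; last by exists j.
    by move: nu0; rewrite jE ltxx.
  have jl : (j.+1 < l)%N by rewrite -(ltr_nat R) -jE.
  rewrite (ddcov_lag _ G0).
  have -> : \sum_(0 <= m < l) wt l m * Gfun nu m.+1%:R =
      2^-1 * expsum l lam (fun m => wt l m * lam m) nu.
    rewrite /expsum mulr_sumr; apply: eq_bigr => m _; rewrite lam_powR.
    by rewrite /Gfun pnatr_eq0 /= nuZ /lam; field.
  move/eqP; rewrite mulf_eq0 invr_eq0 pnatr_eq0 /= => /eqP h.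
  case: l l0 nul jl h => [//|[|N]]; first by rewrite !ltnS ltn0.
  move=> l0 nul jl h; apply: (wt_neq0 l0).
  apply: (@expsum_double_zero R N lam (wt N.+2) (fun k => k.+1%:R) j).
  - by move=> i k _ _; exact: lam_inj.
  - by move=> k _; rewrite ltr_nat.
  - by rewrite -ltnS -ltnS.
  - by move=> k kN; apply: F_zero; rewrite ltn0Sn !ltnS.
  - by rewrite -jE.
rewrite (ddcov_lag _ G0).
have -> : \sum_(0 <= m < l) wt l m * Gfun nu m.+1%:R = F l nu.
  rewrite /F /expsum; apply: eq_bigr => m _; rewrite lam_powR.
  by rewrite /Gfun pnatr_eq0 /= (negbTE nuZ).
move=> h; pose k0 := Num.truncn nu.
have [k0nu nuk0] : k0%:R < nu /\ nu < k0.+1%:R.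
  split; last exact: truncnS_gt.
  rewrite lt_neqAle truncn_le ?ltW// andbT; apply/negP => /eqP e.
  by move: nuZ; rewrite -e intr_nat.
have k0l : (k0 < l)%N by rewrite -(ltr_nat R) (lt_trans k0nu).
case: l l0 nul h k0l => [//|N] l0 nul h k0l.
(* the points 1, ..., l - 1 together with nu, in increasing order *)
pose u i : R := if (i < k0)%N then i.+1%:R else if i == k0 then nu else i%:R.
apply: (wt_neq0 l0); apply: (@expsum_zeros R N lam (wt N.+1) u).
- by move=> i k _ _; exact: lam_inj.
- move=> i iN; rewrite /u.
  have [ik|ik|ik] := ltngtP i k0.
  + have [i1|i1|i1] := ltngtP i.+1 k0; first by rewrite ltr_nat.
      by move: (leq_trans i1 ik); rewrite ltnn.
    by rewrite i1.
  + by rewrite ltnNge (ltnW (leqW ik)) /= gtn_eqF ?leqW// ltr_nat.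
  + by rewrite ltnNge ik leqnSn /= gtn_eqF.
- move=> i iN; rewrite /u; have [ik|ik|ik //] := ltngtP i k0.
  + by apply: F_zero; rewrite /= ltnS (leq_trans ik).
  + by apply: F_zero; rewrite (leq_ltn_trans _ ik).
Qed.

End LimitingForm.

(** * Local limits of covariance increments *)

Section Affine.
Context (R : realType).
Implicit Types (w : nat -> R).

Lemma ddcoef_affine (a h : R) w l k : h != 0 -> (k <= l)%N ->
  ddcoef (fun k => a + h * w k) l k = h ^- l * ddcoef w l k.
Proof.
move=> h0 kl; rewrite /ddcoef mulrCA -invfM; congr (_ / _).
have -> : h ^+ l = \prod_(0 <= j < l.+1 | j != k) h.
  rewrite -big_filter big_const_seq count_predT size_filter.
  have -> : count (fun j => j != k) (index_iota 0 l.+1) = l.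
    rewrite /index_iota subn0; have := count_predC (pred1 k) (iota 0 l.+1).
    rewrite count_uniq_mem ?iota_uniq// mem_iota leq0n add0n ltnS kl size_iota add1n.
    by move=> [].
  by rewrite -Monoid.iteropE.
by rewrite -big_split /=; apply: eq_bigr => j _; ring.
Qed.

Lemma ddcov_affine (a h : R) w l (K : R -> R) : h != 0 ->
  ddcov (fun k => a + h * w k) (fun k => a + h * w k) l K =
  h ^- (2 * l) * ddcov w w l (fun x => K (h * x)).
Proof.
move=> h0; rewrite /ddcov mulr_sumr !big_nat; apply: eq_bigr => k1 /andP[_ k1l].
rewrite mulr_sumr !big_nat; apply: eq_bigr => k2 /andP[_ k2l].
rewrite !ddcoef_affine//.
have -> : a + h * w k1 - (a + h * w k2) = h * (w k1 - w k2) by ring.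
have -> : h ^- (2 * l) = h ^- l * h ^- l by rewrite mul2n -addnn exprD invfM.
ring.
Qed.

Lemma ddcovD w z l (K1 K2 : R -> R) :
  ddcov w z l (fun x => K1 x + K2 x) = ddcov w z l K1 + ddcov w z l K2.
Proof.
rewrite /ddcov -big_split /=; apply: eq_bigr => i _.
by rewrite -big_split /=; apply: eq_bigr => j _; rewrite mulrDr.
Qed.

Lemma ddcovZ w z l (c : R) (K : R -> R) :
  ddcov w z l (fun x => c * K x) = c * ddcov w z l K.
Proof.
rewrite /ddcov mulr_sumr; apply: eq_bigr => i _.
by rewrite mulr_sumr; apply: eq_bigr => j _; rewrite mulrCA.
Qed.

Lemma eq_ddcov w z l (K1 K2 : R -> R) : K1 =1 K2 -> ddcov w z l K1 = ddcov w z l K2.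
Proof. by move=> h; apply: eq_bigr => i _; apply: eq_bigr => j _; rewrite h. Qed.

Lemma ddcov_sum w z l N (K : nat -> R -> R) :
  ddcov w z l (fun x => \sum_(0 <= j < N) K j x) = \sum_(0 <= j < N) ddcov w z l (K j).
Proof.
elim: N => [|N IHN].
  rewrite big_nil (@eq_ddcov _ _ _ _ (fun=> 0 * 0)) ?ddcovZ ?mul0r// => x.
  by rewrite big_nil ?mul0r.
rewrite big_nat_recr//= -IHN -ddcovD; apply: eq_ddcov => x.
by rewrite big_nat_recr.
Qed.

(** G_nu is homogeneous up to a logarithmic term, which is a multiple of an
    even power when nu is an integer. *)
Lemma Gfun_scale (nu h s : R) : nu != 0 -> 0 < h -> 0 <= s ->
  Gfun nu (h * s) = h `^ (2 * nu) *
    (Gfun nu s + (if nu \is a Num.int then ln h * s `^ (2 * nu) else 0)).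
Proof.
move=> nu0 h0; rewrite le_eqVlt => /orP[/eqP <-|s0].
  by rewrite mulr0 /Gfun eqxx powR0 ?mulf_neq0// mulr0; case: ifP; rewrite addr0 mulr0.
rewrite /Gfun mulf_eq0 !gt_eqF//= powRM ?ltW//; case: ifP => _; last by rewrite addr0.
by rewrite lnM ?posrE//; ring.
Qed.

End Affine.

Section LocalLimits.
Context (R : realType) (U : Type) (F : set_system U) {FF : Filter F}.

Lemma cvg_powR (f : U -> R) (a p : R) : 0 < a -> f @ F --> a ->
  (fun x => f x `^ p) @ F --> a `^ p.
Proof.
move=> a0 fa; apply: (@cvg_comp _ _ _ f (fun y => y `^ p) _ (nbhs a)) => //.
have : {for a, continuous (fun y : R => y `^ p)}; last by [].
apply: differentiable_continuous; apply/derivable1_diffP.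
by apply: derivable_powR; rewrite in_itv /= a0.
Qed.

Lemma cvg_ln (f : U -> R) (a : R) : 0 < a -> f @ F --> a ->
  (fun x => ln (f x)) @ F --> ln a.
Proof.
move=> a0 fa; apply: (@cvg_comp _ _ _ f (@ln R) _ (nbhs a)) => //.
exact: continuous_ln.
Qed.

Lemma cvg_Gfun (f : U -> R) (nu a : R) : 0 < a -> f @ F --> a ->
  (fun x => Gfun nu (f x)) @ F --> Gfun nu a.
Proof.
move=> a0 fa.
have fpos : \forall x \near F, 0 < f x by exact: cvgr_gt fa _ a0.
rewrite /Gfun gt_eqF//; case: ifP => nuZ.
  apply: cvg_trans (cvgM (@cvg_powR _ _ (2 * nu) a0 fa) (cvg_ln a0 fa)).
  by apply: near_eq_cvg; apply: filterS fpos => x fx; rewrite gt_eqF.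
apply: cvg_trans (@cvg_powR _ _ (2 * nu) a0 fa).
by apply: near_eq_cvg; apply: filterS fpos => x fx; rewrite gt_eqF.
Qed.

Lemma cvg_sum_nat (N : nat) (f : nat -> U -> R) (a : nat -> R) :
  (forall k, (k < N)%N -> f k @ F --> a k) ->
  (fun x => \sum_(0 <= k < N) f k x) @ F --> \sum_(0 <= k < N) a k.
Proof.
elim: N => [|N IHN] h.
  by under eq_fun do rewrite big_nil; rewrite big_nil; exact: cvg_cst.
under eq_fun do rewrite big_nat_recr//=; rewrite big_nat_recr//=.
by apply: cvgD; [apply: IHN => k kN; apply: h; exact: ltnW|exact: h].
Qed.

Lemma cvg_prod_nat (N : nat) (f : nat -> U -> R) (a : nat -> R) :
  (forall k, (k < N)%N -> f k @ F --> a k) ->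
  (fun x => \prod_(0 <= k < N) f k x) @ F --> \prod_(0 <= k < N) a k.
Proof.
elim: N => [|N IHN] h.
  by under eq_fun do rewrite big_nil; rewrite big_nil; exact: cvg_cst.
under eq_fun do rewrite big_nat_recr//=; rewrite big_nat_recr//=.
by apply: cvgM; [apply: IHN => k kN; apply: h; exact: ltnW|exact: h].
Qed.

Lemma cvg_prod_cond (N : nat) (Q : pred nat) (f : nat -> U -> R) (a : nat -> R) :
  (forall k, (k < N)%N -> f k @ F --> a k) ->
  (fun x => \prod_(0 <= k < N | Q k) f k x) @ F --> \prod_(0 <= k < N | Q k) a k.
Proof.
move=> h; rewrite big_mkcond /=.
have -> : (fun x => \prod_(0 <= k < N | Q k) f k x) =
    (fun x => \prod_(0 <= k < N) (if Q k then f k x else 1)).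
  by apply/funext => x; rewrite big_mkcond.
apply: (@cvg_prod_nat N (fun k x => if Q k then f k x else 1)
  (fun k => if Q k then a k else 1)) => k kN.
by case: (Q k); [exact: h|exact: cvg_cst].
Qed.

Variables (l : nat) (h : U -> R) (w : U -> nat -> R).
Hypothesis h_gt0 : \forall x \near F, 0 < h x.
Hypothesis h_cvg0 : h @ F --> (0 : R).
Hypothesis w_cvg : forall k, (k <= l)%N -> (fun x => w x k) @ F --> grid R k.

Lemma near_increasing : \forall x \near F, increasing_upto l (w x).
Proof.
have H m : (m <= l)%N -> \forall x \near F, increasing_upto m (w x).
  elim: m => [_|m IHm ml]; first by apply: nearW.
  have ap : (0 : R) < 1 by [].
  have c1 : (fun x => w x m.+1 - w x m) @ F --> (1 : R).
    have -> : (1 : R) = grid R m.+1 - grid R m by rewrite /grid -natr1 addrC addKr.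
    by apply: cvgB; apply: w_cvg => //; exact: ltnW.
  have c2 : \forall x \near F, 0 < w x m.+1 - w x m.
    exact: (cvgr_gt _ c1 _ ap).
  apply: filterS2 c2 (IHm (ltnW ml)) => x cx hx k.
  rewrite ltnS leq_eqVlt => /orP[/eqP->|]; last exact: hx.
  by rewrite -subr_gt0.
exact: H.
Qed.

Lemma cvg_ddcoef k : (k <= l)%N ->
  (fun x => ddcoef (w x) l k) @ F --> ddcoef (grid R) l k.
Proof.
move=> kl; apply: cvgM; first exact: cvg_cst.
apply: cvgV.
  rewrite prodf_seq_neq0; apply/allP => j.
  rewrite mem_index_iota => /andP[_ jl]; apply/implyP => jk.
  by rewrite subr_eq0 /grid eqr_nat eq_sym.
by apply: cvg_prod_cond => j jl; apply: cvgB; exact: w_cvg.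
Qed.

(** The kernel may depend on the parameter x and on the indices; this covers
    the remainder of the covariance model, of which only a bound is known. *)
Lemma cvg_ddcov_gen (K : U -> nat -> nat -> R) (L : nat -> nat -> R) :
  (forall k1 k2, (k1 <= l)%N -> (k2 <= l)%N -> (fun x => K x k1 k2) @ F --> L k1 k2) ->
  (fun x => \sum_(0 <= k1 < l.+1) \sum_(0 <= k2 < l.+1)
     ddcoef (w x) l k1 * ddcoef (w x) l k2 * K x k1 k2) @ F -->
  \sum_(0 <= k1 < l.+1) \sum_(0 <= k2 < l.+1)
     ddcoef (grid R) l k1 * ddcoef (grid R) l k2 * L k1 k2.
Proof.
move=> H; apply: (@cvg_sum_nat _ (fun k1 x => \sum_(0 <= k2 < l.+1)
     ddcoef (w x) l k1 * ddcoef (w x) l k2 * K x k1 k2)) => k1 k1l.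
apply: (@cvg_sum_nat _ (fun k2 x =>
     ddcoef (w x) l k1 * ddcoef (w x) l k2 * K x k1 k2)) => k2 k2l.
by apply: cvgM; [apply: cvgM; exact: cvg_ddcoef|exact: H].
Qed.

Let lag_cvg k1 k2 : (k1 <= l)%N -> (k2 <= l)%N ->
  (fun x => `|w x k1 - w x k2|) @ F --> `|grid R k1 - grid R k2|.
Proof. by move=> h1 h2; apply: cvg_norm; apply: cvgB; exact: w_cvg. Qed.

Let lag_gt0 k1 k2 : k1 != k2 -> 0 < `|grid R k1 - grid R k2|.
Proof. by move=> k12; rewrite normr_gt0 subr_eq0 /grid eqr_nat. Qed.

Lemma cvg_ddcov_Gfun nu :
  (fun x => ddcov (w x) (w x) l (fun y => Gfun nu `|y|)) @ F --> Qlim nu l.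
Proof.
apply: (@cvg_ddcov_gen (fun x k1 k2 => Gfun nu `|w x k1 - w x k2|)
  (fun k1 k2 => Gfun nu `|grid R k1 - grid R k2|)) => k1 k2 h1 h2.
have [->|k12] := eqVneq k1 k2.
  by under eq_fun do rewrite subrr; rewrite subrr; exact: cvg_cst.
by apply: cvg_Gfun; [exact: lag_gt0|exact: lag_cvg].
Qed.

Lemma cvg_ddcov_powR p : p != 0 ->
  (fun x => ddcov (w x) (w x) l (fun y => `|y| `^ p)) @ F -->
  ddcov (grid R) (grid R) l (fun y => `|y| `^ p).
Proof.
move=> p0; apply: (@cvg_ddcov_gen (fun x k1 k2 => `|w x k1 - w x k2| `^ p)
  (fun k1 k2 => `|grid R k1 - grid R k2| `^ p)) => k1 k2 h1 h2.
have [->|k12] := eqVneq k1 k2.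
  by under eq_fun do rewrite subrr; rewrite subrr; exact: cvg_cst.
by apply: cvg_powR; [exact: lag_gt0|exact: lag_cvg].
Qed.

Lemma cvg_ddcov_exprn p :
  (fun x => ddcov (w x) (w x) l (fun y => y ^+ p)) @ F -->
  ddcov (grid R) (grid R) l (fun y => y ^+ p).
Proof.
apply: (@cvg_ddcov_gen (fun x k1 k2 => (w x k1 - w x k2) ^+ p)
  (fun k1 k2 => (grid R k1 - grid R k2) ^+ p)) => k1 k2 h1 h2.
by apply: cvg_exprn; apply: cvgB; exact: w_cvg.
Qed.

Let h_right : h @ F --> (0 : R)^'+.
Proof. exact: cvg_to_at_right. Qed.

Lemma cvg_powR_h p : 0 < p -> (fun x => h x `^ p) @ F --> (0 : R).
Proof. by move=> p0; exact: cvg_comp h_right (powR_cvg0 p0). Qed.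

Lemma cvg_powR_ln_h p : 0 < p -> (fun x => h x `^ p * ln (h x)) @ F --> (0 : R).
Proof.
move=> p0.
have q0 : 0 < p / 2 by rewrite divr_gt0.
have c := cvg_powR_h q0.
have c1 : (fun x => (p / 2)^-1 * h x `^ (p / 2)) @ F --> (0 : R).
  by rewrite -(mulr0 (p / 2)^-1); apply: cvgM => //; exact: cvg_cst.
have c2 : (fun x => - ((p / 2)^-1 * h x `^ (p / 2))) @ F --> (0 : R).
  by rewrite -oppr0; exact: cvgN.
have hlt1 : \forall x \near F, h x < 1 by exact: (cvgr_lt _ h_cvg0 _ ltr01).
apply: squeeze_cvgr c2 c1; apply: filterS2 h_gt0 hlt1 => x hx h1.
rewrite -ler_norml normrM ger0_norm ?powR_ge0// ltr0_norm ?ln_lt0 ?hx//.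
have e : h x `^ p = h x `^ (p / 2) * h x `^ (p / 2).
  rewrite -powRD; last by rewrite (gt_eqF hx) implybT.
  by have -> : p / 2 + p / 2 = p by field.
have hq : 0 < h x `^ (p / 2) by exact: powR_gt0.
have := ln_sublinear (powR_gt0 (- (p / 2)) hx); rewrite ln_powR powRN => hl.
rewrite e -mulrA [leRHS]mulrC ler_wpM2l ?(ltW hq)//.
have hl2 : - ln (h x) <= (h x `^ (p / 2))^-1 * (p / 2)^-1.
  by rewrite ler_pdivlMr// mulrC mulrN -mulNr ltW.
apply: le_trans (ler_wpM2l (ltW hq) hl2) _.
by rewrite mulrA mulfV ?gt_eqF// mul1r.
Qed.

Lemma cvg_ln_h : (fun x => (ln (h x))^-1) @ F --> (0 : R).
Proof.
have hN : (fun x => ln (h x)) @ F --> -oo by exact: cvg_comp h_right (@lnNy R).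
apply/cvgrPdist_lt => e e0.
have : \forall x \near F, ln (h x) < - e^-1 by move/cvgrNyPlt : hN; exact.
apply: filterS => x lx.
have ei : 0 < e^-1 by rewrite invr_gt0.
have l0 : ln (h x) < 0 by lra.
rewrite sub0r normrN normfV ltr0_norm// invf_plt ?posrE//; lra.
Qed.

End LocalLimits.

Section CovarianceLimits.
Context (R : realType).
Variables (nu b : R) (beta : nat -> R) (Kt : R -> R).
Hypothesis nu_gt0 : 0 < nu.
Hypothesis model : covariance_model nu b beta Kt.

Let t := Num.truncn nu.

(** By stationarity the remainder may be taken as a function of the lag. *)
Lemma covariance_model_remainder : exists rho : R -> R, exists C tau delta : R,
  [/\ 0 < tau, 0 < delta, 0 <= C,
      forall u, `|u| < delta -> `|rho u| <= C * `|u| `^ (2 * nu + tau) &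
      forall u, Kt u = \sum_(0 <= j < t.+1) beta j * u ^+ (2 * j)
        + b * Gfun nu `|u| + rho u].
Proof.
have [r [tau [tau0 [C [delta [d0 Hr]]] HK]]] := model.
exists (fun u => r u 0), (Order.max C 0), tau, delta; split => //.
- by rewrite le_max lexx orbT.
- move=> u ud; have := Hr u 0; rewrite subr0 => /(_ ud) /le_trans; apply.
  by rewrite ler_wpM2r ?powR_ge0// le_max lexx.
- move=> u; have := HK u 0; rewrite subr0 => ->; congr (_ + _ + _).
  rewrite big_mkord; apply: eq_bigr => j _; congr (_ * _).
  by rewrite !exprM real_normK ?num_real.
Qed.

Context (U : Type) (F : set_system U) {FF : ProperFilter F}.
Variables (l : nat) (h : U -> R) (a : U -> R) (w : U -> nat -> R).
Hypothesis h_gt0 : \forall x \near F, 0 < h x.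
Hypothesis h_cvg0 : h @ F --> (0 : R).
Hypothesis w_cvg : forall k, (k <= l)%N -> (fun x => w x k) @ F --> grid R k.

Let pts x k := a x + h x * w x k.
Let D x := ddcov (pts x) (pts x) l Kt.
Let A x := ddcov (w x) (w x) l (fun y => Gfun nu `|y|).
Let B x := ddcov (w x) (w x) l (fun y => `|y| `^ (2 * nu)).
Let Pm j x := ddcov (w x) (w x) l (fun y => y ^+ (2 * j)).
Let lg x := if nu \is a Num.int then ln (h x) * B x else 0.

Let nu2_neq0 : 2 * nu != 0. Proof. by rewrite mulf_neq0// gt_eqF. Qed.

(** Rescaling by h separates the orders: h^(2j) for the even polynomial and
    h^(2 nu) for the irregular part, where the remainder only contributes
    o(1). The term lg comes from the logarithm in G_nu for integer nu. *)
Lemma local_decomposition : exists2 Rn : U -> R, Rn @ F --> (0 : R) &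
  \forall x \near F, D x = h x ^- (2 * l) *
    (\sum_(0 <= j < t.+1) beta j * (h x ^+ (2 * j) * Pm j x)
     + h x `^ (2 * nu) * (b * (A x + lg x) + Rn x)).
Proof.
have [rho [C [tau [delta [tau0 d0 C0 Hrho HK]]]]] := covariance_model_remainder.
pose Rn x := ddcov (w x) (w x) l (fun y => rho (h x * y) / h x `^ (2 * nu)).
exists Rn.
  have -> : (0 : R) = \sum_(0 <= k1 < l.+1) \sum_(0 <= k2 < l.+1)
     ddcoef (grid R) l k1 * ddcoef (grid R) l k2 * 0.
    by rewrite big1// => k1 _; rewrite big1// => k2 _; rewrite mulr0.
  apply: (cvg_ddcov_gen w_cvg (K := fun x k1 k2 =>
    rho (h x * (w x k1 - w x k2)) / h x `^ (2 * nu)) (L := fun _ _ => 0)).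
  move=> k1 k2 k1l k2l.
  have cw : (fun x => `|w x k1 - w x k2|) @ F --> `|grid R k1 - grid R k2|.
    by apply: cvg_norm; apply: cvgB; exact: w_cvg.
  pose M : R := `|grid R k1 - grid R k2| + 1.
  have M0 : 0 < M by rewrite ltr_wpDl.
  have wM : \forall x \near F, `|w x k1 - w x k2| < M.
    by apply: (cvgr_lt _ cw); rewrite ltrDl.
  have hd : \forall x \near F, h x < delta / M.
    by apply: (cvgr_lt _ h_cvg0); rewrite divr_gt0.
  have up : (fun x => C * M `^ (2 * nu + tau) * h x `^ tau) @ F --> (0 : R).
    rewrite -(mulr0 (C * M `^ (2 * nu + tau))); apply: cvgM; first exact: cvg_cst.
    exact: cvg_powR_h.
  have dn : (fun x => - (C * M `^ (2 * nu + tau) * h x `^ tau)) @ F --> (0 : R).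
    by rewrite -oppr0; exact: cvgN.
  apply: squeeze_cvgr dn up.
  apply: filterS3 h_gt0 wM hd => x hx wx hdx.
  have hp : 0 < h x `^ (2 * nu) by exact: powR_gt0.
  rewrite -ler_norml normrM normfV (gtr0_norm hp) ler_pdivrMr//.
  have yd : `|h x * (w x k1 - w x k2)| < delta.
    rewrite normrM (gtr0_norm hx).
    apply: (@le_lt_trans _ _ (h x * M)); first by rewrite ler_wpM2l// ltW.
    by rewrite -ltr_pdivlMr.
  apply: le_trans (Hrho _ yd) _; rewrite -!mulrA ler_wpM2l//.
  rewrite normrM (gtr0_norm hx) powRM ?(ltW hx)// mulrC.
  rewrite [h x `^ (2 * nu + tau)]powRD; last by rewrite (gt_eqF hx) implybT.
  rewrite [h x `^ tau * _]mulrC ler_wpM2r ?mulr_ge0 ?powR_ge0//.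
  rewrite ge0_ler_powR ?nnegrE// ?ltW// addr_gt0// mulr_gt0//.
apply: filterS h_gt0 => x hx; rewrite /D ddcov_affine ?gt_eqF//; congr (_ * _).
have hp : 0 < h x `^ (2 * nu) by exact: powR_gt0.
rewrite (@eq_ddcov _ _ _ _ _ (fun y => (\sum_(0 <= j < t.+1) beta j * (h x ^+ (2 * j) * y ^+ (2 * j)))
   + (h x `^ (2 * nu) * (b * (Gfun nu `|y| +
       (if nu \is a Num.int then ln (h x) * `|y| `^ (2 * nu) else 0)) +
       (rho (h x * y) / h x `^ (2 * nu)))))); last first.
  move=> y; rewrite HK -addrA; congr (_ + _).
    by apply: eq_bigr => j _; rewrite exprMn.
  rewrite normrM (gtr0_norm hx) Gfun_scale ?gt_eqF//.
  by rewrite [in RHS]mulrDr [h x `^ (2 * nu) * (rho _ / _)]mulrC divfK ?gt_eqF// mulrCA.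
rewrite ddcovD ddcovZ ddcov_sum; congr (_ + _).
  by apply: eq_bigr => j _; rewrite ddcovZ ddcovZ.
rewrite ddcovD ddcovZ ddcovD; congr (_ * (_ * (_ + _) + _)).
rewrite /lg; case: ifP => _; first by rewrite ddcovZ.
rewrite (@eq_ddcov _ _ _ _ _ (fun=> 0 * 0)) ?ddcovZ ?mul0r// => y; by rewrite mul0r.
Qed.

Let wincr : \forall x \near F, increasing_upto l (w x).
Proof. exact: near_increasing. Qed.

Let Blt j : nu = j%:R -> (j < l)%N -> \forall x \near F, B x = 0.
Proof.
move=> nuj jl; apply: filterS wincr => x hx.
rewrite /B -[RHS](ddcov_monomial_lt hx jl); apply: eq_ddcov => y.
by rewrite nuj -natrM powR_mulrn// !exprM real_normK ?num_real.
Qed.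

Let lg_lt : nu < l%:R -> \forall x \near F, lg x = 0.
Proof.
move=> nul; rewrite /lg; have [nuZ|nuZ] := boolP (nu \is a Num.int); last exact: nearW.
have := nuZ; rewrite intrEge0 ?ltW// => /natrP[j jE].
apply: filterS (Blt jE _) => [x ->|]; first by rewrite mulr0.
by rewrite -(ltr_nat R) -jE.
Qed.

Let powR_sub x : 0 < h x -> h x ^- (2 * l) * h x `^ (2 * nu) = h x `^ (2 * nu - 2 * l%:R).
Proof.
move=> hx; rewrite powRB; last by rewrite (gt_eqF hx) implybT.
by rewrite -natrM powR_mulrn ?ltW// mulrC.
Qed.

(** The even powers x^(2j) with j < l are annihilated, and so is the
    logarithmic term, whose kernel x^(2 nu) is one of them when nu is an
    integer. *)
Lemma local_limit_lt : nu < l%:R ->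
  (fun x => h x `^ (2 * l%:R - 2 * nu) * D x) @ F --> b * Qlim nu l.
Proof.
move=> nul; have [Rn Rn0 HD] := local_decomposition.
have tl : (t < l)%N.
  by rewrite -(ltr_nat R); apply: le_lt_trans nul; rewrite truncn_le// ltW.
have : (fun x => b * A x + Rn x) @ F --> b * Qlim nu l + 0.
  apply: cvgD => //; apply: cvgM; first exact: cvg_cst.
  exact: cvg_ddcov_Gfun.
rewrite addr0; apply: cvg_trans; apply: near_eq_cvg.
near=> x.
have hx : 0 < h x by near: x.
have -> : D x = h x ^- (2 * l) * (\sum_(0 <= j < t.+1) beta j * (h x ^+ (2 * j) * Pm j x)
     + h x `^ (2 * nu) * (b * (A x + lg x) + Rn x)) by near: x.
have -> : lg x = 0 by near: x; exact: lg_lt.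
rewrite big_nat big1 => [|j /andP[_ jt]]; last first.
  have jl : (j < l)%N by exact: leq_ltn_trans tl.
  have incr : increasing_upto l (w x) by near: x.
  by rewrite /Pm (ddcov_monomial_lt incr jl) !mulr0.
rewrite add0r addr0 (mulrA (h x ^- (2 * l))) powR_sub// mulrA -powRD; last first.
  by rewrite (gt_eqF hx) implybT.
have -> : 2 * l%:R - 2 * nu + (2 * nu - 2 * l%:R) = 0 by ring.
by rewrite powRr0 mul1r.
Unshelve. all: by end_near. Qed.

(** The kernel x^(2l) multiplying log h is no longer annihilated and
    dominates. *)
Lemma local_limit_eq : nu = l%:R ->
  (fun x => (ln (h x))^-1 * D x) @ F --> b * ((-1) ^+ l * (2 * l)`!%:R).
Proof.
move=> nul; have [Rn Rn0 HD] := local_decomposition.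
set c := (-1) ^+ l * _.
have tl : t = l by rewrite /t nul natrK.
have nuZ : nu \is a Num.int by rewrite nul natr_int.
have : (fun x => (ln (h x))^-1 * (beta l * c + b * A x + Rn x) + b * c) @ F -->
    0 * (beta l * c + b * Qlim nu l + 0) + b * c.
  apply: cvgD; last exact: cvg_cst.
  apply: cvgM; first exact: cvg_ln_h.
  apply: cvgD => //; apply: cvgD; first exact: cvg_cst.
  by apply: cvgM; [exact: cvg_cst|exact: cvg_ddcov_Gfun].
rewrite mul0r add0r; apply: cvg_trans; apply: near_eq_cvg.
near=> x.
have hx : 0 < h x by near: x.
have hx1 : h x < 1 by near: x; exact: (cvgr_lt _ h_cvg0 _ ltr01).
have -> : D x = h x ^- (2 * l) * (\sum_(0 <= j < t.+1) beta j * (h x ^+ (2 * j) * Pm j x)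
     + h x `^ (2 * nu) * (b * (A x + lg x) + Rn x)) by near: x.
have incr : increasing_upto l (w x) by near: x.
have Pl : Pm l x = c by rewrite /Pm ddcov_monomial_eq.
have Bl : B x = c.
  rewrite -Pl /B /Pm; apply: eq_ddcov => y.
  by rewrite nul -natrM powR_mulrn// !exprM real_normK ?num_real.
rewrite /lg nuZ Bl big_nat_recr//= big_nat big1 => [|j /andP[_ jt]]; last first.
  by rewrite /Pm ddcov_monomial_lt ?mulr0// -tl.
rewrite add0r tl Pl nul -natrM powR_mulrn ?ltW//.
have l0 : ln (h x) != 0 by rewrite lt_eqF// ln_lt0// hx.
have hk : h x ^+ (2 * l) != 0 by rewrite expf_neq0// gt_eqF.
by field; rewrite l0 hk.
Unshelve. all: by end_near. Qed.

(** The first surviving term is beta_l x^(2l), and everything else is of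
    higher order in h. *)
Lemma local_limit_gt : l%:R < nu -> D @ F --> beta l * ((-1) ^+ l * (2 * l)`!%:R).
Proof.
move=> nul; have [Rn Rn0 HD] := local_decomposition.
set c := (-1) ^+ l * _.
have p0 : 0 < 2 * nu - 2 * l%:R by lra.
have lt_ : (l <= t)%N by rewrite /t truncn_ge_nat ?ltW.
pose S x := \sum_(0 <= j < t - l) beta (l.+1 + j)%N * (h x ^+ (2 * j.+1) * Pm (l.+1 + j)%N x).
have cS : S @ F --> \sum_(0 <= j < t - l) beta (l.+1 + j)%N * (0 *
    ddcov (grid R) (grid R) l (fun y => y ^+ (2 * (l.+1 + j)))).
  apply: (@cvg_sum_nat _ _ _ _ _ (fun j x => beta (l.+1 + j)%N * (h x ^+ (2 * j.+1) * Pm (l.+1 + j)%N x))) => j _.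
  apply: cvgM; first exact: cvg_cst.
  apply: cvgM; last exact: cvg_ddcov_exprn.
  have := @cvg_exprn R U F _ h 0 (2 * j.+1) h_cvg0.
  by rewrite expr0n mulnS /= => cE; exact: cE.
have {}cS : S @ F --> (0 : R).
  by move: cS; rewrite big1// => j _; rewrite mul0r mulr0.
have cA : (fun x => h x `^ (2 * nu - 2 * l%:R) * A x) @ F --> 0 * Qlim nu l.
  by apply: cvgM; [exact: cvg_powR_h|exact: cvg_ddcov_Gfun].
have clg : (fun x => h x `^ (2 * nu - 2 * l%:R) * lg x) @ F --> (0 : R).
  rewrite /lg; case: (nu \is a Num.int);
    last by under eq_fun do rewrite mulr0; exact: cvg_cst.
  under eq_fun do rewrite mulrA.
  rewrite -(mul0r (ddcov (grid R) (grid R) l (fun y => `|y| `^ (2 * nu)))).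
  by apply: cvgM; [exact: cvg_powR_ln_h|exact: cvg_ddcov_powR].
have cR : (fun x => h x `^ (2 * nu - 2 * l%:R) * Rn x) @ F --> (0 * 0 : R).
  by apply: cvgM => //; exact: cvg_powR_h.
have : (fun x => beta l * c + S x + (b * (h x `^ (2 * nu - 2 * l%:R) * A x
    + h x `^ (2 * nu - 2 * l%:R) * lg x) + h x `^ (2 * nu - 2 * l%:R) * Rn x)) @ F -->
    beta l * c + 0 + (b * (0 * Qlim nu l + 0) + 0 * 0).
  apply: cvgD; first by apply: cvgD => //; exact: cvg_cst.
  by apply: cvgD => //; apply: cvgM; [exact: cvg_cst|exact: cvgD].
rewrite !mul0r !addr0 mulr0 addr0; apply: cvg_trans; apply: near_eq_cvg.
near=> x.
have hx : 0 < h x by near: x.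
have -> : D x = h x ^- (2 * l) * (\sum_(0 <= j < t.+1) beta j * (h x ^+ (2 * j) * Pm j x)
     + h x `^ (2 * nu) * (b * (A x + lg x) + Rn x)) by near: x.
have incr : increasing_upto l (w x) by near: x.
rewrite [RHS]mulrDr (mulrA (h x ^- (2 * l)) (h x `^ (2 * nu))) powR_sub//; congr (_ + _); last by ring.
rewrite (@big_cat_nat _ _ _ l)//= ?leqW// big_nat big1 => [|j /andP[_ jl]]; last first.
  by rewrite /Pm ddcov_monomial_lt ?mulr0.
rewrite add0r big_ltn ?ltnS// mulrDr.
have hk : h x ^+ (2 * l) != 0 by rewrite expf_neq0// gt_eqF.
have Pl : Pm l x = c by rewrite /Pm ddcov_monomial_eq.
congr (_ + _); first by rewrite Pl; field.
rewrite -[l.+1]add0n big_addn subSS mulr_sumr /S.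
apply: eq_bigr => j _; rewrite addnC.
have -> : (2 * (j + l.+1) = 2 * l + 2 * j.+1)%N by lia.
by rewrite exprD; field.
Unshelve. all: by end_near. Qed.

End CovarianceLimits.

(** * The design points *)

Section UniformFilter.
Context (R : realType) (theta l : nat).

Definition in_range n i := (1 <= i < (n - theta * l).+1)%N.

Lemma in_range_le n i k : in_range n i -> (k <= l)%N -> (1 <= i + theta * k <= n)%N.
Proof.
move=> /andP[i1 iN] kl; have := leq_mul (leqnn theta) kl; lia.
Qed.

Lemma in_range_n n i : (0 < theta)%N -> in_range n i -> (0 < l)%N -> (1 < n)%N.
Proof. by move=> theta_gt0 /andP[i1 iN] l0; have := leq_mul theta_gt0 l0; lia. Qed.

(** Convergence along this filter is convergence as n tends to infinity,
    uniformly in the index i of the window; the local limit theorems apply to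
    it without change. *)
Definition unif : set_system (nat * nat) :=
  [set A | \forall n \near \oo, forall i, in_range n i -> A (n, i)].

Global Instance unif_filter : ProperFilter unif.
Proof.
apply: Build_ProperFilter_ex.
  move=> A [N _ HN]; pose n := (maxn N (theta * l).+1).
  exists (n, 1%N); have /= := HN n (leq_maxl _ _); apply.
  rewrite /in_range leqnn /=; have := leq_maxr N (theta * l).+1; rewrite -/n; lia.
split.
- by exists 0%N.
- move=> A B [N1 _ h1] [N2 _ h2]; exists (maxn N1 N2) => // n /=.
  by rewrite geq_max => /andP[n1 n2] i hi; split; [exact: h1|exact: h2].
- by move=> A B AB [N _ h]; exists N => // n /= Nn i hi; apply: AB; exact: h.
Qed.

Lemma unif_nP (u : nat -> R) (c : R) : u @ \oo --> c -> (fun x : nat * nat => u x.1) @ unif --> c.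
Proof.
move=> uc A hA; have := uc A hA; rewrite /nbhs /= /unif /=.
by move=> [N _ h]; exists N => // n /= Nn i _; exact: h.
Qed.

End UniformFilter.
Arguments unif_nP {R theta l u c}.

Section Design.
Context (R : realType).
Variables (phi : R -> R).
Hypothesis phi_C2 : class_C 2 phi setT.
Hypothesis dphi_gt0 : 0 < inf [set derive1 phi s | s in `[0, 1]%classic].

Let dphi := derive1 phi.

Lemma design_is_derive (x : R) : is_derive x 1 phi (dphi x).
Proof.
have [H _] := phi_C2; have := H 0%N isT x I; rewrite derive1n0 => dx.
by rewrite /dphi derive1E; exact/derivableP.
Qed.

Lemma design_is_derive2 (x : R) : is_derive x 1 dphi (derive1n 2 phi x).
Proof.
have [H _] := phi_C2; have := H 1%N isT x I; rewrite derive1n1 => dx.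
by rewrite derive1nS derive1n1 derive1E; exact/derivableP.
Qed.

Lemma design_continuous : continuous phi.
Proof.
move=> x; apply: differentiable_continuous; apply/derivable1_diffP.
by have := design_is_derive x => -[].
Qed.

Lemma dphi_continuous : continuous dphi.
Proof.
move=> x; apply: differentiable_continuous; apply/derivable1_diffP.
by have := design_is_derive2 x => -[].
Qed.

Lemma dphi_lower : exists2 m0 : R, 0 < m0 & forall s, 0 <= s <= 1 -> m0 <= dphi s.
Proof.
exists (inf [set derive1 phi s | s in `[0, 1]%classic]) => // s hs.
have hi : has_inf [set derive1 phi s | s in `[0, 1]%classic].
  apply: contrapT => hn; move: dphi_gt0; rewrite inf_out ?ltxx//.
by apply: (ge_inf hi.2); exists s => //=; rewrite in_itv.
Qed.

Lemma dphi_upper : exists2 M1 : R, 0 < M1 & forall s, 0 <= s <= 1 -> dphi s <= M1.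
Proof.
have [c _ Hc] := @EVT_max R dphi 0 1 ler01 (continuous_subspaceT dphi_continuous).
exists (Order.max (dphi c) 1); first by rewrite lt_max ltr01 orbT.
by move=> s hs; rewrite le_max Hc// in_itv.
Qed.

Lemma dphi_lipschitz : exists2 M2 : R, 0 <= M2 &
  forall s u, 0 <= s <= 1 -> 0 <= u <= 1 -> `|dphi s - dphi u| <= M2 * `|s - u|.
Proof.
have [_ H2] := phi_C2.
have cn : continuous (fun x => `|derive1n 2 phi x|).
  by move=> x; apply: cvg_norm; exact: H2.
have [c _ Hc] := @EVT_max R _ 0 1 ler01 (continuous_subspaceT cn).
exists `|derive1n 2 phi c| => //.
suff H s u : s <= u -> 0 <= s <= 1 -> 0 <= u <= 1 ->
    `|dphi s - dphi u| <= `|derive1n 2 phi c| * `|s - u|.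
  move=> s u hs hu; have [su|/ltW us] := leP s u; first exact: H.
  by rewrite distrC [`|s - u|]distrC; exact: H.
move=> su /andP[s0 s1] /andP[u0 u1]; rewrite distrC [`|s - u|]distrC.
have [y yz ->] := @MVT_segment R dphi (derive1n 2 phi) s u su
  (fun x _ => design_is_derive2 x) (continuous_subspaceT dphi_continuous).

have /andP[sy yu] : s <= y <= u by move: yz; rewrite in_itv.
rewrite normrM ler_wpM2r// Hc// in_itv /=.
by rewrite (le_trans s0 sy) (le_trans yu u1).
Qed.

Lemma design_mvt (s u : R) : 0 <= s -> s <= u -> u <= 1 ->
  exists2 y, s <= y <= u & phi u - phi s = dphi y * (u - s).
Proof.
move=> s0 su u1.
have [y yz e] := @MVT_segment R phi dphi s u su
  (fun x _ => design_is_derive x) (continuous_subspaceT design_continuous).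
by exists y => //; move: yz; rewrite in_itv.
Qed.

Section Grid.
Variables (theta l : nat).
Notation in_range := (in_range theta l).
Notation unif := (unif theta l).
Hypothesis theta_gt0 : (0 < theta)%N.

Definition knot n i : R := (i%:R - 1) / (n%:R - 1).

(** The spacing of the points of the window, to first order. *)
Definition step n i : R := theta%:R * dphi (knot n i) / (n%:R - 1).

Definition window n i k := design phi n (i + theta * k)%N.

Let den_gt0 n : (1 < n)%N -> 0 < n%:R - 1 :> R.
Proof. by move=> n1; rewrite subr_gt0 ltr1n. Qed.

Lemma knot_itv n i : (1 < n)%N -> (1 <= i <= n)%N -> 0 <= knot n i <= 1.
Proof.
move=> n1 /andP[i1 iN]; rewrite /knot divr_ge0 ?subr_ge0 ?ler1n//= 1?ltnW//.
by rewrite ler_pdivrMr ?den_gt0// mul1r lerD2r ler_nat.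
Qed.

Lemma knotD n i m : knot n (i + m)%N = knot n i + m%:R / (n%:R - 1).
Proof. by rewrite /knot natrD; ring. Qed.

Lemma knot_le n i j : (1 < n)%N -> (i <= j)%N -> knot n i <= knot n j.
Proof. by move=> n1 ij; rewrite /knot ler_pM2r ?invr_gt0 ?den_gt0// lerD2r ler_nat. Qed.

Hypothesis l_gt0 : (0 < l)%N.

Lemma design_gap_lower (m0 : R) : (forall s, 0 <= s <= 1 -> m0 <= dphi s) ->
  forall n i j, (1 < n)%N -> (1 <= i)%N -> (i <= j)%N -> (j <= n)%N ->
    m0 * ((j - i)%:R / (n%:R - 1)) <= design phi n j - design phi n i.
Proof.
move=> Hm n i j n1 i1 ij jn.
have /andP[si0 si1] : 0 <= knot n i <= 1 by apply: knot_itv; rewrite ?i1 ?(leq_trans ij).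
have /andP[sj0 sj1] : 0 <= knot n j <= 1 by apply: knot_itv; rewrite ?jn ?(leq_trans i1).
have [y /andP[y1 y2] e] := design_mvt si0 (knot_le n1 ij) sj1.
rewrite /design -/(knot n j) -/(knot n i) e.
have -> : knot n j - knot n i = (j - i)%:R / (n%:R - 1).
  by rewrite natrB// /knot; ring.
rewrite ler_wpM2r ?divr_ge0 ?(ltW (den_gt0 n1))// Hm// (le_trans si0 y1)//=.
exact: le_trans y2 sj1.
Qed.

Lemma design_incr n i j : (1 < n)%N -> (1 <= i)%N -> (i < j)%N -> (j <= n)%N ->
  design phi n i < design phi n j.
Proof.
move=> n1 i1 ij jn; have [m0 m00 Hm] := dphi_lower.
rewrite -subr_gt0; apply: lt_le_trans (design_gap_lower Hm n1 i1 (ltnW ij) jn).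
by rewrite mulr_gt0// divr_gt0 ?den_gt0// ltr0n subn_gt0.
Qed.

Lemma window_incr n i : in_range n i -> increasing_upto l (window n i).
Proof.
move=> hi k kl; have n1 := in_range_n theta_gt0 hi l_gt0.
have /andP[h1 h2] := in_range_le hi (ltnW kl).
have /andP[h3 h4] := in_range_le hi kl.
by apply: design_incr => //; rewrite ltn_add2l ltn_pmul2l.
Qed.

Lemma step_bounds (m0 M1 : R) : (forall s, 0 <= s <= 1 -> m0 <= dphi s) ->
  (forall s, 0 <= s <= 1 -> dphi s <= M1) ->
  forall n i, in_range n i ->
    theta%:R * m0 / (n%:R - 1) <= step n i <= theta%:R * M1 / (n%:R - 1).
Proof.
move=> Hm HM n i hi; have n1 := in_range_n theta_gt0 hi l_gt0.
have := in_range_le hi (leq0n l); rewrite muln0 addn0 => h1.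
have hk := knot_itv n1 h1.
by rewrite /step !ler_pM2r ?invr_gt0 ?den_gt0// !ler_wpM2l ?Hm ?HM.
Qed.

Lemma step_gt0 n i : in_range n i -> 0 < step n i.
Proof.
move=> hi; have n1 := in_range_n theta_gt0 hi l_gt0.
have [m0 m00 Hm] := dphi_lower.
have := in_range_le hi (leq0n l); rewrite muln0 addn0 => h1.
rewrite /step divr_gt0 ?den_gt0// mulr_gt0 ?ltr0n//.
by apply: lt_le_trans m00 _; apply: Hm; exact: knot_itv.
Qed.

Definition scaled n i k : R := (window n i k - window n i 0) / step n i.

Lemma window_affine n i : in_range n i ->
  window n i = (fun k => window n i 0 + step n i * scaled n i k).
Proof.
move=> hi; apply/funext => k; rewrite /scaled mulrC divfK ?gt_eqF ?step_gt0//.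
by rewrite addrC subrK.
Qed.

(** By the mean value theorem the rescaled k-th point of the window is k
    phi'(y) / phi'(s_i) for some y within O(1/n) of s_i, and phi' is Lipschitz
    and bounded below. *)
Lemma scaled_near_grid : exists C : R, forall n i k, in_range n i -> (k <= l)%N ->
  `|scaled n i k - grid R k| <= C / (n%:R - 1).
Proof.
have [m0 m00 Hm] := dphi_lower; have [M2 M20 HM] := dphi_lipschitz.
exists (l%:R * (M2 * (theta * l)%:R / m0)) => n i k hi kl.
have n1 := in_range_n theta_gt0 hi l_gt0; have d0 := den_gt0 n1.
have h1 := in_range_le hi (leq0n l); rewrite muln0 addn0 in h1.
have h2 := in_range_le hi kl.
have /andP[s0 s1] := knot_itv n1 h1; have /andP[u0 u1] := knot_itv n1 h2.
have [y /andP[y1 y2] e] := design_mvt s0 (knot_le n1 (leq_addr (theta * k) i)) u1.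
have p0 : 0 < dphi (knot n i) by apply: lt_le_trans m00 (Hm _ _); rewrite s0.
have t0 : 0 < theta%:R :> R by rewrite ltr0n.
have -> : scaled n i k - grid R k =
    k%:R * ((dphi y - dphi (knot n i)) / dphi (knot n i)).
  rewrite /scaled /window muln0 addn0 /design -/(knot n (i + theta * k)) -/(knot n i) e.
  rewrite /step /grid knotD natrM; field.
  by rewrite !gt_eqF.
rewrite normrM ger0_norm// -!mulrA.
apply: ler_pM => //; first by rewrite ler_nat.
rewrite normrM normfV (gtr0_norm p0).
have ys : `|y - knot n i| <= (theta * l)%:R / (n%:R - 1).
  rewrite ger0_norm ?subr_ge0//; apply: (@le_trans _ _ (knot n (i + theta * k) - knot n i)).
    by rewrite lerD2r.
  rewrite knotD addrC addKr ler_pM2r ?invr_gt0// ler_nat leq_mul2l kl orbT//.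
have yk : 0 <= y <= 1 by rewrite (le_trans s0 y1) (le_trans y2 u1).
have hL := HM y (knot n i) yk; rewrite s0 s1 in hL; have {}hL := hL isT.
rewrite ler_pdivrMr//; apply: le_trans hL _.
apply: le_trans (ler_wpM2l M20 ys) _.
have q1 : 1 <= dphi (knot n i) / m0 by rewrite ler_pdivlMr// mul1r Hm// s0.
apply: (@le_trans _ _ (M2 * ((theta * l)%:R / (n%:R - 1)) * (dphi (knot n i) / m0))).
  by rewrite ler_peMr// mulr_ge0// divr_ge0// ltW.
by rewrite le_eqVlt; apply/orP; left; apply/eqP; ring.
Qed.

Lemma cvg_den : (fun n => (n%:R - 1)^-1 : R) @ \oo --> (0 : R).
Proof.
rewrite -(cvg_shiftS (fun n : nat => (n%:R - 1)^-1 : R)).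
under eq_fun do rewrite -natr1 addrK.
exact: cvg_natV.
Qed.

Lemma step_near : \forall x \near unif, 0 < step x.1 x.2.
Proof. by exists 0%N => // n _ i; exact: step_gt0. Qed.

Lemma step_cvg0 : (fun x => step x.1 x.2) @ unif --> (0 : R).
Proof.
have [m0 m00 Hm] := dphi_lower; have [M1 M10 HM] := dphi_upper.
have up : (fun n => theta%:R * M1 * (n%:R - 1)^-1 : R) @ \oo --> (0 : R).
  by rewrite -(mulr0 (theta%:R * M1)); apply: cvgM; [exact: cvg_cst|exact: cvg_den].
apply: squeeze_cvgr (cvg_cst 0) (unif_nP up).
exists 0%N => // n _ i hi /=.
by rewrite ltW ?step_gt0//=; have /andP[] := step_bounds Hm HM hi.
Qed.

Lemma scaled_cvg k : (k <= l)%N ->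
  (fun x => scaled x.1 x.2 k) @ unif --> grid R k.
Proof.
move=> kl; have [C HC] := scaled_near_grid.
have up : (fun n => C * (n%:R - 1)^-1 : R) @ \oo --> (0 : R).
  by rewrite -(mulr0 C); apply: cvgM; [exact: cvg_cst|exact: cvg_den].
have dn : (fun n => - (C * (n%:R - 1)^-1) : R) @ \oo --> (0 : R).
  by rewrite -oppr0; exact: cvgN.
suff c0 : (fun x => scaled x.1 x.2 k - grid R k) @ unif --> (0 : R).
  have : (fun x => (scaled x.1 x.2 k - grid R k) + grid R k) @ unif --> 0 + grid R k.
    by apply: cvgD => //; exact: cvg_cst.
  by rewrite add0r; under eq_fun do rewrite subrK.
apply: squeeze_cvgr (unif_nP dn) (unif_nP up).
by exists 0%N => // n _ i hi /=; rewrite -ler_norml; exact: HC.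
Qed.

End Grid.
End Design.

(** * Asymptotics of the mean *)

Lemma sum_triangle (R : realType) (f : nat -> nat -> R) N :
  (forall i j, f i j = f j i) -> (forall i, f i i = 0) ->
  \sum_(0 <= i < N) \sum_(0 <= j < N) f i j =
  2 * \sum_(0 <= j < N) \sum_(0 <= i < j) f i j.
Proof.
move=> fs f0; elim: N => [|N IHN]; first by rewrite !big_nil mulr0.
rewrite big_nat_recr//= [in RHS]big_nat_recr//= mulrDr -IHN.
under eq_bigr do rewrite big_nat_recr//=.
rewrite big_split /= [X in _ + X]big_nat_recr//= f0 addr0 -addrA; congr (_ + _).
by rewrite [X in _ + X](eq_bigr (fun i => f i N)) => [|i _]; [ring|exact: fs].
Qed.

Lemma limn_einf_gt0 (R : realType) (u : nat -> \bar R) (c : R) : 0 < c ->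
  (\forall n \near \oo, (c%:E <= u n)%E) -> (0 < limn_einf u)%E.
Proof.
move=> c0 [N _ HN]; apply: (@lt_le_trans _ _ c%:E); first by rewrite lte_fin.
rewrite limn_einf_lim; apply: lime_ge; first exact: is_cvg_einfs.
exists N => // m /= Nm; apply: le_ereal_inf_tmp => _ [p /= mp] <-.
by apply: HN; exact: leq_trans mp.
Qed.

Lemma limn_esup_ltpinfty (R : realType) (u : nat -> \bar R) (c : R) :
  (\forall n \near \oo, (u n <= c%:E)%E) -> (limn_esup u < +oo)%E.
Proof.
move=> [N _ HN]; apply: (@le_lt_trans _ _ c%:E); last by rewrite ltry.
rewrite limn_esup_lim; apply: lime_le; first exact: is_cvg_esups.
exists N => // m /= Nm; apply: ge_ereal_sup => _ [p /= mp] <-.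
by apply: HN; exact: leq_trans mp.
Qed.

Section FirstOrder.
Context (R : realType).
Variables (phi : R -> R).
Hypothesis phi_C2 : class_C 2 phi setT.
Hypothesis dphi_gt0 : 0 < inf [set derive1 phi s | s in `[0, 1]%classic].
Variables (theta l : nat).
Hypothesis theta_gt0 : (0 < theta)%N.
Hypothesis l_gt0 : (0 < l)%N.

Notation unif := (unif theta l).
Notation step := (step phi theta).
Notation idx := (in_range theta l).
Notation window := (window phi theta).

Lemma nabla_covE n i j K :
  nabla_cov (design phi n) theta l K i j = ddcov (window n i) (window n j) l K.
Proof. by []. Qed.

Definition trace_cov K n : R :=
  \sum_(1 <= i < (n - theta * l).+1) nabla_cov (design phi n) theta l K i i.

Lemma design_kills_constants n i : idx n i ->
  \sum_(0 <= k < l.+1) acoef (design phi n) theta l i k = 0.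
Proof.
by move=> hi; apply: (@ddcoef_sum R (window n i) l) => //; exact: window_incr.
Qed.

(** Uniform convergence in i passes to averages with arbitrary positive
    weights. *)
Lemma cvg_weighted_average (c q : nat * nat -> R) (L : R) :
  (forall n i, idx n i -> 0 < c (n, i)) -> q @ unif --> L ->
  (fun n => (\sum_(1 <= i < (n - theta * l).+1) c (n, i) * q (n, i)) /
            \sum_(1 <= i < (n - theta * l).+1) c (n, i)) @ \oo --> L.
Proof.
move=> c0 qL; apply/cvgrPdist_le => e e0.
have qe : unif [set x | `|L - q x| <= e] by move/cvgrPdist_le : qL => /(_ _ e0).
have [N _ HN] := qe; exists (maxn N (theta * l).+1) => // n /=.
rewrite geq_max => /andP[Nn nl].
set S := \sum_(1 <= i < _) c (n, i).
have S0 : 0 < S.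
  rewrite /S big_ltn; last by rewrite ltnS subn_gt0.
  rewrite ltr_pwDl//; first by apply: c0; rewrite /in_range leqnn ltnS subn_gt0.
  rewrite big_nat sumr_ge0// => i /andP[i1 i2]; apply/ltW/c0.
  by rewrite /in_range (ltnW i1).
set A := \sum_(1 <= i < _) c (n, i) * q (n, i).
have -> : L - A / S = (L * S - A) / S by rewrite mulrBl mulfK ?gt_eqF.
rewrite normrM normfV (gtr0_norm S0) ler_pdivrMr// /A.
rewrite /S mulr_sumr -sumrB mulr_sumr; apply: le_trans (ler_norm_sum _ _ _) _.
rewrite !big_nat; apply: ler_sum => i hi.
have ci := c0 n i hi.
have -> : L * c (n, i) - c (n, i) * q (n, i) = (L - q (n, i)) * c (n, i) by ring.
rewrite normrM (gtr0_norm ci) ler_wpM2r ?(ltW ci)//.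
exact: HN.
Qed.

Lemma range_card n : \sum_(1 <= i < (n - theta * l).+1) (1 : R) = (n - theta * l)%:R.
Proof. by rewrite big_const_nat subn1 /= iter_addr addr0. Qed.

Lemma range_card_cvg : (fun n => (n - theta * l)%:R / n%:R : R) @ \oo --> (1 : R).
Proof.
have : (fun n => 1 - (theta * l)%:R * n%:R^-1 : R) @ \oo --> (1 - (theta * l)%:R * 0 : R).
  by apply: cvgB; [exact: cvg_cst|apply: cvgM; [exact: cvg_cst|exact: cvg_natV]].
rewrite mulr0 subr0; apply: cvg_near_eq.
exists (theta * l).+1 => // n /= hn.
rewrite natrB ?(ltnW hn)// mulrBl mulfV// pnatr_eq0 -lt0n; exact: leq_ltn_trans hn.
Qed.

Lemma cvg_lnV : (fun n => (ln n%:R)^-1 : R) @ \oo --> (0 : R).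
Proof.
have hp : \forall n \near \oo, 0 < n%:R^-1 :> R.
  by exists 1%N => // n /= n0; rewrite invr_gt0 ltr0n.
have c : (fun n => - (ln (n%:R^-1 : R))^-1) @ \oo --> (- 0 : R).
  by apply: cvgN; exact: cvg_ln_h hp (@cvg_natV R).
rewrite oppr0 in c; apply: cvg_near_eq c.
by exists 1%N => // n /= n0; rewrite lnV ?posrE ?ltr0n// invrN opprK.
Qed.

Lemma ln_natB1_cvg : (fun n => ln (n%:R - 1) / ln n%:R : R) @ \oo --> (1 : R).
Proof.
have lnV0 := cvg_lnV.
have lo : (fun n => 1 - ln 2 * (ln n%:R)^-1 : R) @ \oo --> (1 : R).
  have : (fun n => 1 - ln 2 * (ln n%:R)^-1 : R) @ \oo --> (1 - ln 2 * 0 : R).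
    by apply: cvgB; [exact: cvg_cst|apply: cvgM; [exact: cvg_cst|]].
  by rewrite mulr0 subr0.
have one : (fun _ : nat => 1 : R) @ \oo --> (1 : R) by exact: cvg_cst.
apply: squeeze_cvgr lo one.
exists 2%N => // n /= n2.
have n0 : 0 < n%:R :> R by rewrite ltr0n ltnW.
have n1 : 0 < n%:R - 1 :> R by rewrite subr_gt0 ltr1n.
have l0 : 0 < ln n%:R :> R by rewrite ln_gt0// ltr1n.
apply/andP; split; last first.
  by rewrite ler_pdivrMr// mul1r ler_ln ?posrE// gerBl.
rewrite ler_pdivlMr// mulrBl mul1r -mulrA mulVf ?gt_eqF// mulr1 lerBlDr.
rewrite -lnM ?posrE// ler_ln ?posrE ?mulr_gt0//.
have : 2 <= n%:R :> R by rewrite ler_nat.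
lra.
Qed.

Section Model.
Variables (nu b : R) (beta : nat -> R) (Kt : R -> R).
Hypothesis nu_gt0 : 0 < nu.
Hypothesis model : covariance_model nu b beta Kt.

Let trD (x : nat * nat) := ddcov
   (fun k => window x.1 x.2 0 + step x.1 x.2 * scaled phi theta x.1 x.2 k)
   (fun k => window x.1 x.2 0 + step x.1 x.2 * scaled phi theta x.1 x.2 k) l Kt.

Let trDE n i : idx n i ->
  nabla_cov (design phi n) theta l Kt i i = trD (n, i).
Proof. by move=> hi; rewrite nabla_covE /trD /= -(window_affine dphi_gt0 theta_gt0 l_gt0 hi). Qed.

Let sN := step_near dphi_gt0 theta_gt0 l_gt0.
Let s0 := step_cvg0 phi_C2 dphi_gt0 theta_gt0 l_gt0.
Let wc := fun k => @scaled_cvg R phi phi_C2 dphi_gt0 theta l theta_gt0 l_gt0 k.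

(** For nu < l the diagonal entries are of different sizes; their common
    profile is factored out, and only the order of this sum matters. *)
Definition weight n : R :=
  \sum_(1 <= i < (n - theta * l).+1) step n i `^ (2 * nu - 2 * l%:R).

Lemma weight_gt0 n : (theta * l < n)%N -> 0 < weight n.
Proof.
move=> nl; rewrite /weight big_ltn; last by rewrite ltnS subn_gt0.
rewrite ltr_pwDl//.
  apply: powR_gt0; apply: (step_gt0 dphi_gt0 theta_gt0 l_gt0).
  by rewrite /in_range leqnn ltnS subn_gt0.
by apply: sumr_ge0 => i _; exact: powR_ge0.
Qed.

Lemma trace_cov_lt : nu < l%:R ->
  (fun n => trace_cov Kt n / weight n) @ \oo --> b * Qlim nu l.
Proof.
move=> nul.
have H := local_limit_lt (FF := unif_filter theta l) nu_gt0 model (fun x => window x.1 x.2 0) sN s0 wc nul.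
have := cvg_weighted_average (c := fun x => step x.1 x.2 `^ (2 * nu - 2 * l%:R)) _ H.
have -> : (fun n => trace_cov Kt n / weight n) = (fun n =>
   (\sum_(1 <= i < (n - theta * l).+1) step n i `^ (2 * nu - 2 * l%:R) *
      (step n i `^ (2 * l%:R - 2 * nu) * trD (n, i))) /
   \sum_(1 <= i < (n - theta * l).+1) step n i `^ (2 * nu - 2 * l%:R)).
  apply/funext => n; congr (_ / _); apply: eq_big_nat => i hi.
  have si := step_gt0 dphi_gt0 theta_gt0 l_gt0 hi.
  rewrite mulrA -powRD; last by rewrite (gt_eqF si) implybT.
  have -> : 2 * nu - 2 * l%:R + (2 * l%:R - 2 * nu) = 0 by ring.
  by rewrite powRr0 mul1r trDE.
apply=> n i hi /=; apply: powR_gt0.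
exact: (step_gt0 dphi_gt0 theta_gt0 l_gt0 hi).
Qed.

Let cvg_average (q : nat * nat -> R) (L : R) : q @ unif --> L ->
  (fun n => (\sum_(1 <= i < (n - theta * l).+1) q (n, i)) / n%:R) @ \oo --> L.
Proof.
move=> qL; have := cvg_weighted_average (c := fun=> 1) (fun _ _ _ => ltr01) qL.
move=> h; have h2 : (fun n => (\sum_(1 <= i < (n - theta * l).+1) 1 * q (n, i)) /
    (\sum_(1 <= i < (n - theta * l).+1) 1) * ((n - theta * l)%:R / n%:R)) @ \oo --> L.
  by rewrite -[X in _ --> X]mulr1; apply: cvgM => //; exact: range_card_cvg.
apply: cvg_near_eq h2; exists (theta * l).+1 => // n /= hn.
rewrite range_card; under eq_bigr do rewrite mul1r.
rewrite mulrA divfK// pnatr_eq0 -lt0n subn_gt0//.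
Qed.

(** The step enters through log h_i, which is equivalent to - log n uniformly
    in i. *)
Lemma trace_cov_eq : nu = l%:R ->
  (fun n => trace_cov Kt n / (n%:R * ln n%:R)) @ \oo -->
  b * ((-1) ^+ l.+1 * (2 * l)`!%:R).
Proof.
move=> nul.
have H := local_limit_eq (FF := unif_filter theta l) nu_gt0 model (fun x => window x.1 x.2 0) sN s0 wc nul.
have lnV0 := cvg_lnV.
have [m0 m00 Hm] := dphi_lower dphi_gt0; have [M1 M10 HM] := dphi_upper phi_C2.
have t0 : 0 < theta%:R :> R by rewrite ltr0n.
have lnstep : (fun x => ln (step x.1 x.2) / ln x.1%:R) @ unif --> (-1 : R).
  have bnd (c : R) : (fun n => ln c * (ln n%:R)^-1 - ln (n%:R - 1) / ln n%:R) @ \oo --> (-1 : R).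
    have : (fun n => ln c * (ln n%:R)^-1 - ln (n%:R - 1) / ln n%:R) @ \oo --> (ln c * 0 - 1 : R).
      apply: cvgB; last exact: ln_natB1_cvg.
      by apply: cvgM; [exact: cvg_cst|].
    by rewrite mulr0 sub0r.
  apply: squeeze_cvgr (unif_nP (bnd (theta%:R * m0))) (unif_nP (bnd (theta%:R * M1))).
  exists 2%N => // n /= n2 i hi.
  have n1 : 0 < n%:R - 1 :> R by rewrite subr_gt0 ltr1n.
  have lp : 0 < ln n%:R :> R by rewrite ln_gt0// ltr1n.
  have /andP[h1 h2] := step_bounds theta_gt0 l_gt0 Hm HM hi.
  have si := step_gt0 dphi_gt0 theta_gt0 l_gt0 hi.
  rewrite -!mulrBl !ler_pM2r ?invr_gt0// -!ln_div ?posrE ?mulr_gt0//.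
  have p1 : 0 < theta%:R * m0 / (n%:R - 1) by rewrite divr_gt0 ?mulr_gt0.
  have p2 : 0 < theta%:R * M1 / (n%:R - 1) by rewrite divr_gt0 ?mulr_gt0.
  by rewrite !ler_ln ?posrE ?si ?p1 ?p2// h1 h2.
have hm : (fun x => (ln (step x.1 x.2))^-1 * trD x * (ln (step x.1 x.2) / ln x.1%:R))
    @ unif --> b * ((-1) ^+ l.+1 * (2 * l)`!%:R).
  have -> : b * ((-1) ^+ l.+1 * (2 * l)`!%:R) = b * ((-1) ^+ l * (2 * l)`!%:R) * -1.
    by rewrite exprS; ring.
  exact: cvgM.
have h2 := cvg_average hm.
apply: cvg_near_eq h2.
have [N _ HN] : \forall n \near \oo, forall i, idx n i -> step n i < 1.
  have : unif [set x | step x.1 x.2 < 1] by exact: (cvgr_lt _ s0 _ ltr01).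
  by [].
exists (maxn N 2) => // n /=; rewrite geq_max => /andP[Nn n2].
rewrite invfM mulrA mulrAC; congr (_ / _).
rewrite /trace_cov mulr_suml; apply: eq_big_nat => i hi.
have si := step_gt0 dphi_gt0 theta_gt0 l_gt0 hi.
rewrite trDE//; have ln0 : ln (step n i) != 0 by rewrite lt_eqF// ln_lt0// si HN.
have lp : ln n%:R != 0 :> R by rewrite gt_eqF// ln_gt0// ltr1n.
rewrite /trD /=; field; by rewrite ?lp ?ln0.
Qed.

Lemma trace_cov_gt : l%:R < nu ->
  (fun n => trace_cov Kt n / n%:R) @ \oo --> beta l * ((-1) ^+ l * (2 * l)`!%:R).
Proof.
move=> nul.
have H := local_limit_gt (FF := unif_filter theta l) nu_gt0 model (fun x => window x.1 x.2 0) sN s0 wc nul.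
apply: cvg_near_eq (cvg_average H); exists 0%N => // n _.
by congr (_ / _); apply: eq_big_nat => i hi; rewrite trDE.
Qed.

End Model.

Lemma weight_bounds nu : nu < l%:R -> exists c1 c2 : R, [/\ 0 < c1, 0 < c2 &
  \forall n \near \oo, c1 * n%:R `^ (2 * l%:R + 1 - 2 * nu) <= weight nu n
     <= c2 * n%:R `^ (2 * l%:R + 1 - 2 * nu)].
Proof.
move=> nul.
have [m0 m00 Hm] := dphi_lower dphi_gt0; have [M1 M10 HM] := dphi_upper phi_C2.
have t0 : 0 < theta%:R :> R by rewrite ltr0n.
set e := 2 * l%:R - 2 * nu; have e0 : 0 < e by rewrite /e; lra.
pose c1 := (theta%:R * M1) `^ (- e) * 2^-1 `^ e * 2^-1.
pose c2 := (theta%:R * m0) `^ (- e).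
have c10 : 0 < c1 by rewrite !mulr_gt0// powR_gt0// ?mulr_gt0// invr_gt0.
have c20 : 0 < c2 by rewrite powR_gt0// mulr_gt0.
exists c1, c2; split => //; exists (2 * (theta * l) + 2)%N => // n /= hn.
have n1 : 0 < n%:R - 1 :> R by rewrite subr_gt0 ltr1n; lia.
have n0 : 0 < n%:R :> R by rewrite ltr0n; lia.
have pE : n%:R `^ (2 * l%:R + 1 - 2 * nu) = n%:R `^ e * n%:R :> R.
  have -> : 2 * l%:R + 1 - 2 * nu = e + 1 by rewrite /e; ring.
  rewrite powRD ?powRr1 ?ler0n//; by rewrite (gt_eqF n0) implybT.
have eE : 2 * nu - 2 * l%:R = - e by rewrite /e; ring.
have inv (x : R) : 0 < x -> (x / (n%:R - 1)) `^ (- e) = x `^ (- e) * (n%:R - 1) `^ e.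
  by move=> x0; rewrite powRM ?invr_ge0 ?(ltW x0) ?(ltW n1)// powRV ?(ltW n1)// opprK.
have sb i : idx n i ->
    (theta%:R * M1) `^ (- e) * (n%:R - 1) `^ e <= step n i `^ (- e) <=
    (theta%:R * m0) `^ (- e) * (n%:R - 1) `^ e.
  move=> hi; have /andP[h1 h2] := step_bounds theta_gt0 l_gt0 Hm HM hi.
  have si := step_gt0 dphi_gt0 theta_gt0 l_gt0 hi.
  have p1 : 0 < theta%:R * m0 / (n%:R - 1) by rewrite divr_gt0 ?mulr_gt0.
  have p2 : 0 < theta%:R * M1 / (n%:R - 1) by rewrite divr_gt0 ?mulr_gt0.
  rewrite -!inv ?(mulr_gt0 t0)// !powRN !lef_pV2 ?posrE ?(powR_gt0 _ p1) ?(powR_gt0 _ p2) ?(powR_gt0 _ si)//.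
  by rewrite !ge0_ler_powR ?nnegrE ?(ltW e0) ?(ltW si) ?(ltW p1) ?(ltW p2).
rewrite pE /weight eE; apply/andP; split.
- apply: (@le_trans _ _ (\sum_(1 <= i < (n - theta * l).+1)
    (theta%:R * M1) `^ (- e) * (n%:R - 1) `^ e)); last first.
    by rewrite !big_nat; apply: ler_sum => i hi; have /andP[] := sb i hi.
  rewrite -(mulr1 ((theta%:R * M1) `^ (- e) * _)) -mulr_sumr range_card /c1.
  rewrite -!mulrA ler_wpM2l ?powR_ge0//.
  rewrite mulrCA [leLHS](_ : _ = (2^-1 * n%:R) `^ e * (2^-1 * n%:R)); last first.
    by rewrite powRM ?invr_ge0 ?ler0n//; ring.
  apply: ler_pM; rewrite ?powR_ge0 ?mulr_ge0 ?invr_ge0 ?ler0n//.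
    rewrite ge0_ler_powR ?nnegrE ?mulr_ge0 ?invr_ge0 ?ler0n ?(ltW e0) ?(ltW n1)//.
    have : 2 <= n%:R :> R by rewrite ler_nat; lia.
    lra.
  rewrite mulrC ler_pdivrMr// -natrM ler_nat; lia.
- apply: (@le_trans _ _ (\sum_(1 <= i < (n - theta * l).+1)
    (theta%:R * m0) `^ (- e) * (n%:R - 1) `^ e)).
    by rewrite !big_nat; apply: ler_sum => i hi; have /andP[] := sb i hi.
  rewrite -(mulr1 ((theta%:R * m0) `^ (- e) * _)) -mulr_sumr range_card /c2.
  rewrite -!mulrA ler_wpM2l ?powR_ge0//; apply: ler_pM; rewrite ?powR_ge0//.
    by rewrite ge0_ler_powR ?nnegrE ?(ltW e0) ?(ltW n1) ?(ltW n0)// gerBl.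
  by rewrite ler_nat leq_subr.
Qed.

(** Thus f is the mean for the covariance model with beta = 0 and no
    remainder, so that [trace_cov_lt] applies to it as well. *)
Lemma fvarE nu b n : 
  fvar (design phi n) n theta l b nu = trace_cov (fun u => b * Gfun nu `|u|) n.
Proof.
rewrite /fvar /trace_cov mulr_sumr; apply: eq_big_nat => i hi.
have inc := window_incr phi_C2 dphi_gt0 theta_gt0 l_gt0 hi.
rewrite nabla_covE ddcovZ -mulrA mulrCA; congr (_ * _).
rewrite /ddcov (@sum_triangle _ (fun k1 k2 => ddcoef (window n i) l k1 *
  ddcoef (window n i) l k2 * Gfun nu `|window n i k1 - window n i k2|)).
- congr (_ * _); rewrite !big_nat; apply: eq_bigr => k2 /andP[_ k2l].
  rewrite !big_nat; apply: eq_bigr => k1 /andP[_ k12].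
  rewrite distrC ger0_norm ?subr_ge0//.
  by apply/ltW/(increasing_upto_lt inc k12).
- by move=> i1 j1; rewrite distrC; ring.
- by move=> i1; rewrite subrr normr0 /Gfun eqxx mulr0.
Qed.

Lemma trivial_model (nu b : R) :
  covariance_model nu b (fun=> 0) (fun u => b * Gfun nu `|u|).
Proof.
exists (fun _ _ => 0), 1; split => //.
  by exists 0, 1; split => // x y _; rewrite normr0 mul0r.
by move=> x y; rewrite big1 ?add0r ?addr0// => j _; rewrite mul0r.
Qed.

End FirstOrder.

(** * Nondegeneracy of the smooth case *)

Section NewtonRecursion.
Context (R : realType).
Implicit Types (f : R -> R) (w : nat -> R).

(** The usual recursion of divided differences, which links them with iterated
    finite differences. *)
Lemma ddcoef_newton w l f : increasing_upto l.+1 w ->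
  (w l.+1 - w 0%N) * \sum_(0 <= k < l.+2) ddcoef w l.+1 k * f (w k) =
  l.+1%:R * (\sum_(0 <= k < l.+1) ddcoef (fun k => w k.+1) l k * f (w k.+1)
             - \sum_(0 <= k < l.+1) ddcoef w l k * f (w k)).
Proof.
move=> hw.
have prod_neq0 k : (k <= l.+1)%N ->
    \prod_(0 <= j < l.+2 | j != k) (w k - w j) != 0.
  move=> kl; rewrite prodf_seq_neq0; apply/allP => j.
  rewrite mem_index_iota => /andP[_ jN]; apply/implyP => jk.
  by rewrite subr_eq0 (increasing_upto_inj hw)// 1?eq_sym// -ltnS.
have lo k : (k <= l)%N -> ddcoef w l.+1 k * (w k - w l.+1) = l.+1%:R * ddcoef w l k.
  move=> kl; have := prod_neq0 k (leqW kl); rewrite /ddcoef.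
  rewrite big_mkcond big_nat_recr//= -big_mkcond /= gtn_eqF ?ltnS//=.
  by rewrite mulf_eq0 negb_or => /andP[h1 h2]; rewrite factS natrM; field; rewrite h1 h2.
have hi k : (k <= l)%N ->
    ddcoef w l.+1 k.+1 * (w k.+1 - w 0%N) = l.+1%:R * ddcoef (fun k => w k.+1) l k.
  move=> kl; have := prod_neq0 k.+1 kl; rewrite /ddcoef.
  rewrite big_mkcond big_nat_recl//= -big_mkcond /=.
  by rewrite mulf_eq0 negb_or => /andP[h1 h2]; rewrite factS natrM; field; rewrite h1 h2.
transitivity (\sum_(0 <= k < l.+2) ddcoef w l.+1 k * (w k - w 0%N) * f (w k)
   - \sum_(0 <= k < l.+2) ddcoef w l.+1 k * (w k - w l.+1) * f (w k)).
  by rewrite -sumrB mulr_sumr; apply: eq_bigr => k _; ring.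
rewrite mulrBr !mulr_sumr; congr (_ - _).
  rewrite big_nat_recl//= subrr mulr0 mul0r add0r !big_nat.
  by apply: eq_bigr => k /andP[_ kl]; rewrite hi ?mulrA.
rewrite big_nat_recr//= subrr mulr0 mul0r addr0 !big_nat.
by apply: eq_bigr => k /andP[_ kl]; rewrite lo ?mulrA.
Qed.

Definition fdiff (h : R) f : R -> R := fun x => f (x + h) - f x.

Lemma iter_fdiff h l f x : 0 < h ->
  iter l (fdiff h) f x =
  h ^+ l * \sum_(0 <= k < l.+1) ddcoef (fun k => x + h * grid R k) l k * f (x + h * grid R k).
Proof.
move=> h0.
have inc N y : increasing_upto N (fun k => y + h * grid R k).
  by move=> k _; rewrite ltrD2l ltr_pM2l// /grid ltr_nat.
elim: l x => [|l IHl] x.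
  rewrite /= expr0 mul1r big_nat1 /ddcoef big_mkcond big_nat1 eqxx /= fact0 divr1 mul1r.
  by rewrite /grid mulr0 addr0.
rewrite iterS /fdiff -/(fdiff h) !IHl -mulrBr.
have := ddcoef_newton f (inc l.+1 x).
have -> : x + h * grid R l.+1 - (x + h * grid R 0%N) = l.+1%:R * h by rewrite /grid; ring.
rewrite -mulrA => /(mulfI _); rewrite pnatr_eq0 => /(_ isT) e.
rewrite exprSr -[in RHS]mulrA e; congr (_ * _).
have sh k : x + h + h * grid R k = x + h * grid R k.+1 by rewrite /grid -natr1; ring.
congr (_ - _).
have -> : (fun k => x + h + h * grid R k) = (fun k => x + h * grid R k.+1).
  by apply/funext => k; exact: sh.
by apply: eq_bigr => k _; rewrite sh.
Qed.

Definition fsum (h : R) f : R -> R := fun x => f (x + h) + f x.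

Lemma iter_fdiff_double h l f :
  iter l (fdiff (2 * h)) f = iter l (fsum h) (iter l (fdiff h) f).
Proof.
have comm g : fdiff h (fsum h g) = fsum h (fdiff h g).
  by apply/funext => x; rewrite /fdiff /fsum; ring.
have commi j g : iter j (fdiff h) (fsum h g) = fsum h (iter j (fdiff h) g).
  by elim: j => // j IHj; rewrite !iterS IHj comm.
elim: l f => // l IHl f.
rewrite iterSr IHl iterS.
have -> : fdiff (2 * h) f = fsum h (fdiff h f).
  apply/funext => x; rewrite /fdiff /fsum.
  have -> : x + 2 * h = x + h + h by ring.
  ring.
by rewrite commi -!iterSr.
Qed.

End NewtonRecursion.

Section Nondegenerate.
Context d (T : measurableType d) (R : realType) (P : probability T R).
Notation E := (Ex P).
Variables (X : R -> {RV P >-> R}) (mu : R) (Kt : R -> R).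
Hypothesis HX : stationary_gaussian_process X mu Kt.
Variables (nu b : R) (beta : nat -> R).
Hypothesis nu_gt0 : 0 < nu.
Hypothesis b_neq0 : b != 0.
Hypothesis model : covariance_model nu b beta Kt.

Let Z l h x w := iter l (fdiff h) (fun y => X y w) x.

Let Zm l h x : has_moments P (Z l h x).
Proof.
rewrite /Z; elim: l x => [|l IHl] x; first exact: (process_has_moments HX).
by apply: has_momentsB; exact: IHl.
Qed.

Let Z_cov l h x : 0 < h -> (0 < l)%N -> E (fun w => Z l h x w ^+ 2) =
  h ^+ (2 * l) * ddcov (fun k => 0 + h * grid R k) (fun k => 0 + h * grid R k) l Kt.
Proof.
move=> h0 l0.
pose s := [seq (h ^+ l * ddcoef (fun k => x + h * grid R k) l k, x + h * grid R k)
  | k <- index_iota 0 l.+1].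
have inc y : increasing_upto l (fun k => y + h * grid R k).
  by move=> k _; rewrite ltrD2l ltr_pM2l// /grid ltr_nat.
have s0 : \sum_(p <- s) p.1 = 0.
  by rewrite /s big_map /= -mulr_sumr ddcoef_sum ?mulr0.
have ZE : Z l h x = lincomb X s.
  apply/funext => w; rewrite /Z iter_fdiff// /lincomb /s big_map /= mulr_sumr.
  by apply: eq_bigr => k _; rewrite mulrA.
have -> : (fun w => Z l h x w ^+ 2) = (fun w => lincomb X s w * lincomb X s w).
  by apply/funext => w; rewrite ZE expr2.
have hne : h != 0 by rewrite gt_eqF.
rewrite (Ex_lincombM HX s0 s0) /s big_map /ddcov mulr_sumr !big_nat.
apply: eq_bigr => k1 /andP[_ k1l]; rewrite big_map mulr_sumr !big_nat.
apply: eq_bigr => k2 /andP[_ k2l] /=; rewrite !ddcoef_affine//.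
have -> : x + h * grid R k1 - (x + h * grid R k2) = 0 + h * grid R k1 - (0 + h * grid R k2) by ring.
by rewrite mul2n -addnn exprD; ring.
Qed.

(** The operator f |-> f(x + h) + f(x) at most multiplies second moments by 4,
    and it is iterated l times. *)
Let Z_double l h v : (forall x, E (fun w => Z l h x w ^+ 2) <= v) ->
  forall x, E (fun w => Z l (2 * h) x w ^+ 2) <= 4 ^+ l * v.
Proof.
move=> Hv.
pose A j x w := iter j (fsum h) (fun y => Z l h y w) x.
have Am j x : has_moments P (A j x).
  rewrite /A; elim: j x => [|j IHj] x; first exact: Zm.
  by apply: has_momentsD; exact: IHj.
have H j : forall x, E (fun w => A j x w ^+ 2) <= 4 ^+ j * v.
  elim: j => [|j IHj] x; first by rewrite expr0 mul1r; exact: Hv.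
  have m1 := has_momentsX 2 (Am j (x + h)); have m2 := has_momentsX 2 (Am j x).
  apply: (@le_trans _ _ (2 * E (fun w => A j (x + h) w ^+ 2) + 2 * E (fun w => A j x w ^+ 2))).
    rewrite -!ExZ// -ExD; [|exact: has_momentsZ|exact: has_momentsZ].
    apply: le_Ex; [exact: has_momentsX|by apply: has_momentsD; exact: has_momentsZ|].
    move=> w; rewrite {1}/A iterS /fsum -/(fsum h) -/(A j (x + h) w) -/(A j x w).
    by have := sqr_ge0 (A j (x + h) w - A j x w); nra.
  have := IHj (x + h); have := IHj x; rewrite exprS; lra.
move=> x; apply: le_trans (H l x); apply: le_Ex; try exact: has_momentsX.
by move=> w; rewrite /Z iter_fdiff_double.
Qed.

Let Z_next l h v : (forall x, E (fun w => Z l h x w ^+ 2) <= v) ->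
  forall x, E (fun w => Z l.+1 h x w ^+ 2) <= 4 * v.
Proof.
move=> Hv x.
have m1 := has_momentsX 2 (Zm l h (x + h)); have m2 := has_momentsX 2 (Zm l h x).
apply: (@le_trans _ _ (2 * E (fun w => Z l h (x + h) w ^+ 2) + 2 * E (fun w => Z l h x w ^+ 2))).
  rewrite -!ExZ// -ExD; [|exact: has_momentsZ|exact: has_momentsZ].
  apply: le_Ex; [exact: has_momentsX|by apply: has_momentsD; exact: has_momentsZ|].
  move=> w; rewrite {1}/Z iterS /fdiff -/(fdiff h) -/(Z l h (x + h) w) -/(Z l h x w).
  by have := sqr_ge0 (Z l h (x + h) w + Z l h x w); nra.
have := Hv (x + h); have := Hv x; lra.
Qed.

Let FF := at_right_proper_filter (0 : R).
Let idpos : \forall x \near (0 : R)^'+, 0 < x. Proof. exact: nbhs_right_gt. Qed.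
Let id0 : (fun x : R => x) @ (0 : R)^'+ --> (0 : R).
Proof. by apply: cvg_at_right_filter; exact: cvg_id. Qed.
Let wg l : forall k, (k <= l)%N -> (fun x : R => grid R k) @ (0 : R)^'+ --> grid R k.
Proof. by move=> k _; exact: cvg_cst. Qed.

(** If beta_l vanished, the variance of l-th differences would be o(h^(2l));
    the doubling inequality then makes all l-th differences vanish, against
    the exact order h^(2 nu) of differences of order above nu. *)
Lemma beta_neq0 l : (0 < l)%N -> l%:R < nu -> beta l != 0.
Proof.
move=> l0 lnu; apply/negP => /eqP bl.
pose D L h := ddcov (fun k => 0 + h * grid R k) (fun k => 0 + h * grid R k) L Kt.
have D0 : D l @ (0 : R)^'+ --> (0 : R).
  have := local_limit_gt (FF := FF) nu_gt0 model (fun=> 0) idpos id0 (@wg l) lnu.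
  by rewrite bl mul0r.
have Zl0 h : 0 < h -> forall x, E (fun w => Z l h x w ^+ 2) <= 0.
  move=> h0.
  pose hk k : R := h / 2 ^+ k.
  have hk0 k : 0 < hk k by rewrite divr_gt0// exprn_gt0.
  have bound k x : E (fun w => Z l h x w ^+ 2) <= h ^+ (2 * l) * D l (hk k).
    have dbl j : (j <= k)%N -> forall x, E (fun w => Z l (2 ^+ j * hk k) x w ^+ 2) <=
        4 ^+ (l * j) * (hk k ^+ (2 * l) * D l (hk k)).
      elim: j => [|j IHj] jk y.
        by rewrite muln0 !expr0 !mul1r Z_cov.
      rewrite exprS -mulrA mulnS exprD -[4 ^+ l * _ * _]mulrA.
      by apply: Z_double => //; exact: IHj (ltnW jk).
    have := dbl k (leqnn k) x.
    have -> : 2 ^+ k * hk k = h by rewrite /hk mulrC divfK// expf_neq0.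
    move/le_trans; apply; rewrite mulrA ler_wpM2r//; last first.
      rewrite le_eqVlt; apply/orP; left; apply/eqP.
      rewrite /hk expr_div_n -exprM mulrCA.
      have -> : 4 = 2 ^+ 2 :> R by rewrite -natrX.
      rewrite -exprM mulnA [(k * _)%N]mulnC mulfV ?mulr1// expf_neq0//.
    have := Z_cov 0 (hk0 k) l0 => e.
    have : 0 <= hk k ^+ (2 * l) * D l (hk k).
      by rewrite -/(D l (hk k)) in e; rewrite -e; apply: Ex_ge0 => w; exact: sqr_ge0.
    by rewrite pmulr_rge0// exprn_gt0.
  move=> x.
  have hk_cvg : hk @ \oo --> (0 : R)^'+.
    apply: cvg_to_at_right; last exact: nearW.
    have c : (fun k => h * (2^-1 : R) ^+ k) @ \oo --> (h * 0 : R).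
      by apply: cvgM; [exact: cvg_cst|apply: cvg_expr; rewrite ger0_norm// invf_lt1// ltr1n].
    rewrite mulr0 in c; apply: cvg_near_eq c; apply: nearW => k.
    by rewrite /hk exprVn.
  have lim : (fun k => h ^+ (2 * l) * D l (hk k)) @ \oo --> (h ^+ (2 * l) * 0 : R).
    by apply: cvgM; [exact: cvg_cst|exact: cvg_comp hk_cvg D0].
  rewrite mulr0 in lim.
  by apply: (cvgr_to_ge lim); apply: nearW => k; exact: bound.
pose L := (Num.truncn nu).+1.
have nuL : nu < L%:R by exact: truncnS_gt.
have lL : (l <= L)%N by rewrite -(ler_nat R) ltW// (lt_trans lnu).
have ZL0 h : 0 < h -> D L h = 0.
  move=> h0.
  have H j : forall x, E (fun w => Z (l + j) h x w ^+ 2) <= 0.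
    elim: j => [|j IHj] x; first by rewrite addn0; exact: Zl0.
    by rewrite addnS -(mulr0 4); exact: Z_next.
  have : E (fun w => Z L h 0 w ^+ 2) = 0.
    apply/eqP; rewrite eq_le Ex_ge0 ?andbT => [|w]; last exact: sqr_ge0.
    by have := H (L - l)%N 0; rewrite subnKC.
  rewrite Z_cov// => /eqP; rewrite mulf_eq0 expf_eq0 (gt_eqF h0) andbF /=.
  by move/eqP.
have limL := local_limit_lt (FF := FF) nu_gt0 model (fun=> 0) idpos id0 (@wg L) nuL.
have lim0 : (fun h : R => h `^ (2 * L%:R - 2 * nu) * D L h) @ (0 : R)^'+ --> (0 : R).
  apply: cvg_near_cst; apply: filterS idpos => h h0.
  by rewrite ZL0 ?mulr0.
have : b * Qlim nu L = 0 by apply: norm_cvg_unique limL lim0; exact: fmap_proper_filter.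
move/eqP.
by rewrite mulf_eq0 (negbTE b_neq0) /= (negbTE (Qlim_neq0 _))// nu_gt0.
Qed.

End Nondegenerate.

(** * Upper bound on the sum of squared covariances *)

Section LagSums.
Context (R : realType).

(** Every row meets each lag at most twice. *)
Lemma sum_by_lag (f : nat -> nat -> R) (B : nat -> R) (n N : nat) : (N <= n)%N ->
  (forall m, 0 <= B m) ->
  (forall i j, (1 <= i <= N)%N -> (1 <= j <= N)%N -> f i j <= B (i - j + (j - i))%N) ->
  \sum_(1 <= i < N.+1) \sum_(1 <= j < N.+1) f i j <=
  2 * n%:R * \sum_(0 <= m < n) B m.
Proof.
move=> Nn B0 Hf.
have row i : (1 <= i <= N)%N -> \sum_(1 <= j < N.+1) f i j <= 2 * \sum_(0 <= m < n) B m.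
  move=> hi; have /andP[i1 iN] := hi.
  apply: (@le_trans _ _ (\sum_(1 <= j < N.+1) B (i - j + (j - i))%N)).
    rewrite !big_nat; apply: ler_sum => j /andP[j1 jN]; apply: Hf => //.
    by rewrite j1 -ltnS.
  have mono k : (k <= n)%N -> \sum_(0 <= m < k) B m <= \sum_(0 <= m < n) B m.
    move=> kn; rewrite [leRHS](@big_cat_nat _ _ _ k)//= lerDl.
    by apply: sumr_ge0 => m _; exact: B0.
  rewrite (@big_cat_nat _ _ _ i)//=; last by rewrite leqW.
  rewrite mulrDl mul1r; apply: lerD.
    apply: le_trans (mono i (leq_trans iN Nn)).
    rewrite [leRHS]big_ltn// big_nat_rev /=.
    rewrite -[leLHS]add0r; apply: lerD; first exact: B0.
    rewrite !big_nat; apply: ler_sum => j /andP[j1 ji].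
    have -> : (i - (1 + i - j.+1) + (1 + i - j.+1 - i) = j)%N by lia.
    by [].
  apply: le_trans (mono (N.+1 - i)%N _); last by lia.
  rewrite -{1}[i]add0n big_addn !big_nat; apply: ler_sum => j /andP[_ jN].
  by have -> : (i - (j + i) + (j + i - i) = j)%N by lia.
apply: (@le_trans _ _ (\sum_(1 <= i < N.+1) 2 * \sum_(0 <= m < n) B m)).
  by rewrite big_nat [leRHS]big_nat; apply: ler_sum => i; rewrite ltnS; exact: row.
have S0 : 0 <= \sum_(0 <= m < n) B m by apply: sumr_ge0 => m _; exact: B0.
rewrite big_const_nat subn1 /= iter_addr addr0 -[leLHS]mulr_natl mulrA [_ * 2]mulrC.
by rewrite ler_wpM2r// ler_wpM2l// ler_nat.
Qed.

Definition psum (p : R) n : R := \sum_(1 <= m < n.+1) m%:R `^ (- p).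

Lemma psum_ge1 p n : (0 < n)%N -> 1 <= psum p n.
Proof.
move=> n0; rewrite /psum big_ltn// powR1 lerDl.
by apply: sumr_ge0 => m _; exact: powR_ge0.
Qed.

(** Mean value theorem for x^(1 - p) on [m, m + 1]. *)
Lemma powR_telescope (p : R) m : 0 < p -> p != 1 -> (0 < m)%N ->
  m.+1%:R `^ (- p) <= (m.+1%:R `^ (1 - p) - m%:R `^ (1 - p)) / (1 - p).
Proof.
move=> p0 p1 m0.
have q0 : 1 - p != 0 by rewrite subr_eq0 eq_sym.
have mlt : (m%:R : R) < m.+1%:R by rewrite ltr_nat.
have mp : 0 < m%:R :> R by rewrite ltr0n.
have dpow (x : R) : 0 < x -> is_derive x 1 (fun y : R => y `^ (1 - p)) ((1 - p) * x `^ (- p)).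
  move=> x0; apply: DeriveDef; first by apply: derivable_powR; rewrite in_itv /= x0.
  rewrite -derive1E powR_derive1 ?in_itv /= ?x0//.
  by congr (_ * _ `^ _); ring.
have din (x : R) : x \in `]m%:R, m.+1%:R[%R ->
    is_derive x 1 (fun y : R => y `^ (1 - p)) ((1 - p) * x `^ (- p)).
  by rewrite in_itv /= => /andP[mx _]; apply: dpow; exact: lt_trans mx.
have cont : {within `[m%:R, m.+1%:R], continuous (fun y : R => y `^ (1 - p))}.
  apply: derivable_within_continuous => x; rewrite in_itv /= => /andP[mx _].
  by have := dpow x (lt_le_trans mp mx) => -[].
have [x xm ->] := MVT mlt din cont.
have /andP[mx xm1] : m%:R < x < m.+1%:R by move: xm; rewrite in_itv.
have -> : (m.+1%:R : R) - m%:R = 1 by rewrite -natr1 addrC addKr.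
rewrite mulr1 mulrAC mulfV// mul1r !powRN lef_pV2 ?posrE ?powR_gt0//; last exact: lt_trans mx.
by rewrite ge0_ler_powR ?nnegrE ?ltW// (lt_trans mp).
Qed.

Lemma psum_telescope (p : R) n : 0 < p -> p != 1 -> (0 < n)%N ->
  psum p n <= 1 + (n%:R `^ (1 - p) - 1) / (1 - p).
Proof.
move=> p0 p1; case: n => // n _.
elim: n => [|n IHn].
  by rewrite /psum big_nat1 !powR1 subrr mul0r addr0.
rewrite /psum big_nat_recr//= -/(psum p n.+1).
apply: le_trans (lerD IHn (powR_telescope p0 p1 (ltn0Sn n))) _.
rewrite le_eqVlt; apply/orP; left; apply/eqP; field.
by rewrite subr_eq0 eq_sym.
Qed.

Lemma psum_gt1 (p : R) : 1 < p -> exists2 C : R, 0 < C & forall n, (0 < n)%N -> psum p n <= C.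
Proof.
move=> p1; exists (1 + (p - 1)^-1); first by rewrite addr_gt0// invr_gt0 subr_gt0.
move=> n n0; have p0 : 0 < p by lra.
apply: le_trans (psum_telescope p0 _ n0) _; first by rewrite gt_eqF.
rewrite lerD2l -[1 - p]opprB invrN mulrN -mulNr opprB -[leRHS]mul1r.
rewrite ler_pM2r ?invr_gt0 ?subr_gt0// lerBlDr lerDl.
Qed.

Lemma psum_lt1 (p : R) : 0 < p < 1 ->
  exists2 C : R, 0 < C & forall n, (0 < n)%N -> psum p n <= C * n%:R `^ (1 - p).
Proof.
move=> /andP[p0 p1]; have q0 : 0 < 1 - p by lra.
exists (1 + (1 - p)^-1); first by rewrite addr_gt0// invr_gt0.
move=> n n0; apply: le_trans (psum_telescope p0 _ n0) _; first by rewrite lt_eqF.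
have n1 : 1 <= n%:R `^ (1 - p) :> R.
  rewrite -[leLHS](powRr0 n%:R); apply: ler_powR; [by rewrite ler1n|exact: ltW].
rewrite [leRHS]mulrDl mul1r; apply: lerD => //.
by rewrite mulrC ler_pM2l ?invr_gt0// gerBl.
Qed.

Lemma psum_eq1 n : (0 < n)%N -> psum 1 n <= 1 + ln n%:R.
Proof.
case: n => // n _; elim: n => [|n IHn].
  by rewrite /psum big_nat1 !powR1 ln1 addr0.
rewrite /psum big_nat_recr//= -/(psum 1 n.+1).
have m0 : 0 < n.+1%:R :> R by [].
have m1 : 0 < n.+2%:R :> R by [].
apply: le_trans (lerD IHn (lexx _)) _; rewrite -addrA lerD2l.
rewrite powR_inv1// -lerBrDl.
have h : -1 < - n.+2%:R^-1 :> R by rewrite ltrN2 invf_lt1// ltr1n.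
have := le_ln1Dx h.
have -> : 1 - n.+2%:R^-1 = n.+1%:R / n.+2%:R :> R.
  by rewrite -[n.+1%:R](addrK 1) natr1 mulrBl mulfV ?mul1r// gt_eqF.
rewrite ln_div ?posrE// => hln.
by rewrite -[leRHS]opprB lerNr.
Qed.

Lemma psum_mono (p q : R) n : q <= p -> psum p n <= psum q n.
Proof.
move=> qp; rewrite /psum !big_nat; apply: ler_sum => m /andP[m1 _].
by apply: ler_powR; [rewrite ler1n|rewrite lerN2].
Qed.

End LagSums.

Section CovarianceBound.
Context (R : realType).
Variables (phi : R -> R).
Hypothesis phi_C2 : class_C 2 phi setT.
Hypothesis phi0 : phi 0 = 0.
Hypothesis phi1 : phi 1 = 1.
Hypothesis dphi_gt0 : 0 < inf [set derive1 phi s | s in `[0, 1]%classic].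
Variables (theta l : nat).
Hypothesis theta_gt0 : (0 < theta)%N.
Hypothesis l_gt0 : (0 < l)%N.

Notation unif := (unif theta l).
Notation step := (step phi theta).
Notation idx := (in_range theta l).
Notation win := (window phi theta).

Lemma class_C_chain (f : R -> R) I m : class_C m f I -> derive_chain I m (fun j => derive1n j f).
Proof.
move=> [H _] j x jm Ix; have dx := H j jm x Ix.
by rewrite derive1nS derive1E; exact/derivableP.
Qed.

Lemma design_first n : design phi n 1 = 0.
Proof. by rewrite /design subrr mul0r. Qed.

Lemma design_last n : (1 < n)%N -> design phi n n = 1.
Proof. by move=> n1; rewrite /design divff// subr_eq0 pnatr_eq1 gtn_eqF. Qed.

Lemma design_mono n i j : (1 < n)%N -> (1 <= i)%N -> (i <= j)%N -> (j <= n)%N ->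
  design phi n i <= design phi n j.
Proof.
move=> n1 i1; rewrite leq_eqVlt => /orP[/eqP -> //|ij jn].
exact/ltW/(design_incr phi_C2 dphi_gt0 n1 i1 ij jn).
Qed.

Lemma nabla_cov_separated (Kt : R -> R) (I : set R) n i j :
  open_interval_over01 I -> class_C (2 * l) Kt I ->
  idx n i -> idx n j -> (j + theta * l < i)%N ->
  exists2 z, design phi n i - design phi n (j + theta * l) <= z <=
             design phi n (i + theta * l) - design phi n j &
    nabla_cov (design phi n) theta l Kt i j = (-1) ^+ l * derive1n (2 * l) Kt z.
Proof.
move=> [_ iI I01] KC hi hj ji; have n1 := in_range_n theta_gt0 hi l_gt0.
have /andP[hi1 hi2] := in_range_le hi (leqnn l).
have /andP[hj1 hj2] := in_range_le hj (leqnn l).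
have /andP[i1 _] := hi; have /andP[j1 _] := hj.
have inn : (i <= n)%N by exact: leq_trans (leq_addr _ _) hi2.
have chain : derive_chain I (l + l) (fun m => derive1n m Kt).
  by rewrite addnn -mul2n; exact: class_C_chain.
have inc k := window_incr phi_C2 dphi_gt0 theta_gt0 l_gt0 (n := n) (i := k).
have hJ x y : win n i 0 <= x <= win n i l ->
    win n j 0 <= y <= win n j l -> I (x - y).
  rewrite /window !muln0 !addn0 => /andP[x1 x2] /andP[y1 y2].
  apply: I01; rewrite /= in_itv /= subr_gt0; apply/andP; split.
    apply: le_lt_trans y2 _; apply: lt_le_trans x1.
    exact: (design_incr phi_C2 dphi_gt0 n1 hj1 ji inn).
  have := design_mono n1 hi1 hi2 (leqnn n); rewrite design_last// => h1.
  have := design_mono n1 (leqnn 1) j1 (leq_trans (leq_addr _ _) hj2).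
  by rewrite design_first => h2; lra.
have [u hu e] := ddcov_mvt iI chain (inc _ hi) (inc _ hj) hJ.
exists u; first by move: hu; rewrite /window !muln0 !addn0.
by rewrite nabla_covE e addnn -mul2n.
Qed.

(** The step is at least of order 1/n, uniformly in the window. *)
Lemma diag_bound (Kt : R -> R) (e L : R) : 0 < e ->
  (fun x => step x.1 x.2 `^ e * nabla_cov (design phi x.1) theta l Kt x.2 x.2) @ unif --> L ->
  exists2 C : R, 0 < C & \forall n \near \oo, forall i, idx n i ->
    `|nabla_cov (design phi n) theta l Kt i i| <= C * n%:R `^ e.
Proof.
move=> e0 cv; have [m0 m00 Hm] := dphi_lower dphi_gt0.
have [M1 M10 HM] := dphi_upper phi_C2.
have t0 : 0 < theta%:R :> R by rewrite ltr0n.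
pose c := theta%:R * m0; have c0 : 0 < c by rewrite mulr_gt0.
have L1 : 0 < `|L| + 1 by rewrite ltr_wpDl.
exists ((`|L| + 1) * c `^ (- e)); first by rewrite mulr_gt0// powR_gt0.
have [N _ HN] : unif [set x |
   `|step x.1 x.2 `^ e * nabla_cov (design phi x.1) theta l Kt x.2 x.2| < `|L| + 1].
  have cn : (fun x => `|step x.1 x.2 `^ e * nabla_cov (design phi x.1) theta l Kt x.2 x.2|)
      @ unif --> (`|L| : R) by exact: cvg_norm.
  have Llt : `|L| < `|L| + 1 by rewrite ltrDl.
  exact: (cvgr_lt _ cn _ Llt).
exists (maxn N 2) => // n /=; rewrite geq_max => /andP[Nn n2] i hi.
have := HN n Nn i hi; rewrite /= normrM (ger0_norm (powR_ge0 _ _)) => hb.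
have n1 : 0 < n%:R - 1 :> R by rewrite subr_gt0 ltr1n.
have n0 : 0 < n%:R :> R by rewrite ltr0n ltnW.
have si := step_gt0 dphi_gt0 theta_gt0 l_gt0 hi.
have /andP[h1 _] := step_bounds theta_gt0 l_gt0 Hm HM hi.
have cn0 : 0 < c / n%:R by rewrite divr_gt0.
have h2 : (c / n%:R) `^ e <= step n i `^ e.
  rewrite ge0_ler_powR ?nnegrE ?(ltW e0) ?(ltW si) ?(ltW cn0)//.
  apply: le_trans h1; rewrite ler_pM2l// lef_pV2 ?posrE// gerBl//.
have h3 : (c / n%:R) `^ e * `|nabla_cov (design phi n) theta l Kt i i| <= `|L| + 1.
  by apply: le_trans (ltW hb); rewrite ler_wpM2r.
move: h3; rewrite mulrC -ler_pdivlMr ?powR_gt0// => /le_trans; apply.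
rewrite -powRN powRM ?(ltW c0) ?invr_ge0 ?(ltW n0)// powRV ?(ltW n0)// opprK mulrA.
exact: lexx.
Qed.

Context d (T : measurableType d) (P : probability T R).
Variables (X : R -> {RV P >-> R}) (mu : R) (Kt : R -> R).
Hypothesis HX : stationary_gaussian_process X mu Kt.

Notation cov n i j := (nabla_cov (design phi n) theta l Kt i j).

Let nice n : forall i, idx n i ->
  \sum_(0 <= k < l.+1) acoef (design phi n) theta l i k = 0.
Proof. by move=> i hi; exact: (design_kills_constants phi_C2 dphi_gt0 theta_gt0 l_gt0). Qed.

(** Beyond lag theta l the covariance is K^(2l) at a lag of order at least (i
    - j - theta l) / n, so its square is O(n^(2e) (i - j - theta l)^(-2e)). At
    smaller lags it is O(n^e) by [nabla_cov_le] and the diagonal bound. *)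
Lemma sum_cov2_bound (I : set R) (e L C : R) : 0 < e ->
  open_interval_over01 I -> class_C (2 * l) Kt I ->
  (forall t, 0 < t <= 1 -> `|derive1n (2 * l) Kt t| <= C * t `^ (- e)) ->
  (fun x => step x.1 x.2 `^ e * cov x.1 x.2 x.2) @ unif --> L ->
  exists2 D : R, 0 < D & \forall n \near \oo,
    sum_cov2 Kt phi theta l n <= D * n%:R `^ (2 * e + 1) * psum (2 * e) n.
Proof.
move=> e0 hI KC hK cv; have [m0 m00 Hm] := dphi_lower dphi_gt0.
have [C2 C20 [N _ HN]] := diag_bound e0 cv.
have C0 : 0 <= C.
  have := hK 1; rewrite ltr01 lexx powR1 mulr1 => /(_ isT).
  by apply: le_trans.
pose p := 2 * e; pose B n m : R := if (m <= theta * l)%N then (C2 * n%:R `^ e) ^+ 2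
   else (C * m0 `^ (- e)) ^+ 2 * n%:R `^ p * (m - theta * l)%:R `^ (- p).
have sqr_pow (x : R) (a : R) : 0 <= x -> (x `^ a) ^+ 2 = x `^ (2 * a).
  by move=> x0; rewrite -powR_mulrn ?powR_ge0// -powRrM mulrC.
exists (2 * ((theta * l).+1%:R * C2 ^+ 2 + (C * m0 `^ (- e)) ^+ 2)).
  rewrite mulr_gt0// ltr_wpDr ?sqr_ge0// mulr_gt0// exprn_gt0//.
exists (maxn N 2) => // n /=; rewrite geq_max => /andP[Nn n2].
have n1 : 0 < n%:R - 1 :> R by rewrite subr_gt0 ltr1n.
have n0 : 0 < n%:R :> R by rewrite ltr0n ltnW.
have B0 m : 0 <= B n m.
  by rewrite /B; case: ifP => _; rewrite ?sqr_ge0// !mulr_ge0 ?sqr_ge0 ?powR_ge0.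
have far i j : idx n i -> idx n j -> (j + theta * l < i)%N ->
    cov n i j ^+ 2 <= B n (i - j)%N.
  move=> hi hj ji; rewrite /B leqNgt ltn_subRL ji /=.
  have [z /andP[z1 z2] ->] := nabla_cov_separated hI KC hi hj ji.
  have /andP[hi1 hi2] := in_range_le hi (leqnn l).
  have /andP[hj1 hj2] := in_range_le hj (leqnn l).
  have /andP[i1 _] := hi; have /andP[j1 _] := hj.
  have inn : (i <= n)%N by exact: leq_trans (leq_addr _ _) hi2.
  set q : R := (i - j - theta * l)%:R.
  have q0 : 0 < q by rewrite ltr0n; lia.
  have zlo : m0 * (q / n%:R) <= z.
    apply: le_trans z1; have := design_gap_lower phi_C2 Hm n2 hj1 (ltnW ji) inn.
    rewrite subnDA; apply: le_trans; rewrite ler_pM2l// ler_pM2l//.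
    by rewrite lef_pV2 ?posrE// gerBl.
  have zl0 : 0 < m0 * (q / n%:R) by rewrite mulr_gt0// divr_gt0.
  have z0 : 0 < z by exact: lt_le_trans zlo.
  have zle1 : z <= 1.
    apply: le_trans z2 _.
    have := design_mono n2 hi1 hi2 (leqnn n); rewrite design_last// => h1.
    have := design_mono n2 (leqnn 1) j1 (leq_trans (leq_addr _ _) hj2).
    by rewrite design_first => h2; lra.
  rewrite exprMn sqrr_sign mul1r -real_normK ?num_real//.
  have hz : `|derive1n (2 * l) Kt z| <= C * (m0 * (q / n%:R)) `^ (- e).
    apply: le_trans (hK z _) _; first by rewrite z0 zle1.
    rewrite ler_wpM2l// !powRN lef_pV2 ?posrE ?(powR_gt0 _ zl0) ?(powR_gt0 _ z0)//.
    by rewrite ge0_ler_powR ?nnegrE ?(ltW e0) ?(ltW zl0) ?(ltW z0).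
  apply: (@le_trans _ _ ((C * (m0 * (q / n%:R)) `^ (- e)) ^+ 2)).
    by apply: lerXn2r => //; rewrite nnegrE// mulr_ge0// powR_ge0.
  have qn0 : 0 <= q / n%:R by exact/ltW/divr_gt0.
  rewrite (powRM _ (ltW m00) qn0) (powRM _ (ltW q0)) ?invr_ge0 ?(ltW n0)//.
  rewrite powRV ?(ltW n0)// opprK !exprMn !sqr_pow ?(ltW m00) ?(ltW q0) ?(ltW n0)//.
  rewrite mulrN -/p le_eqVlt; apply/orP; left; apply/eqP; ring.
have bnd i j : (1 <= i <= n - theta * l)%N -> (1 <= j <= n - theta * l)%N ->
    cov n i j ^+ 2 <= B n (i - j + (j - i))%N.
  move=> hi hj; have ri : idx n i by [].
  have rj : idx n j by [].
  have [lij|] := leqP (i - j + (j - i))%N (theta * l)%N; last first.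
    have [ij|ij] := leqP i j => h.
      have e1 : (i - j = 0)%N by apply/eqP.
      rewrite (nabla_covC HX (@nice n) ri rj) e1 add0n.
      by apply: far => //; lia.
    have e1 : (j - i = 0)%N by apply/eqP; exact: ltnW.
    by rewrite e1 addn0; apply: far => //; lia.
  rewrite /B lij -real_normK ?num_real//.
  apply: lerXn2r; rewrite ?nnegrE ?mulr_ge0 ?(ltW C20) ?powR_ge0//.
  apply: le_trans (nabla_cov_le HX (@nice n) ri rj) _.
  have h1 := le_trans (ler_norm _) (HN n Nn i ri).
  have h2 := le_trans (ler_norm _) (HN n Nn j rj).
  rewrite ler_pdivrMr//; lra.
have S := sum_by_lag (f := fun i j => cov n i j ^+ 2) (leq_subr (theta * l) n) B0 bnd.
apply: le_trans S _.
have np : n%:R `^ (p + 1) = n%:R `^ p * n%:R :> R.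
  by rewrite powRD ?powRr1 ?ler0n//; rewrite (gt_eqF n0) implybT.
rewrite -/p np; set H := psum p n.
have H1 : 1 <= H by apply: psum_ge1; exact: ltnW.
have np0 : 0 <= n%:R `^ p :> R by exact: powR_ge0.
have SB : \sum_(0 <= m < n) B n m <=
    ((theta * l).+1%:R * C2 ^+ 2 + (C * m0 `^ (- e)) ^+ 2) * n%:R `^ p * H.
  apply: (@le_trans _ _ (\sum_(0 <= m < (theta * l).+1 + n) B n m)).
    rewrite [leRHS](@big_cat_nat _ _ _ n)//=; last by lia.
    by rewrite lerDl; apply: sumr_ge0 => m _; exact: B0.
  rewrite (@big_cat_nat _ _ _ (theta * l).+1)//=; last by lia.
  rewrite !mulrDl; apply: lerD.
    rewrite big_nat (eq_bigr (fun _ => C2 ^+ 2 * n%:R `^ p)); last first.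
      by move=> m; rewrite ltnS => /= hm; rewrite /B hm exprMn sqr_pow// ltW.
    rewrite -big_nat big_const_nat subn0 iter_addr addr0 -[leLHS]mulr_natl.
    rewrite mulrA -[leLHS]mulr1 ler_wpM2l//.
    by apply: mulr_ge0 np0; apply: mulr_ge0; [exact: ler0n|exact: sqr_ge0].
  rewrite -{1}[(theta * l).+1]add0n big_addn addKn.
  rewrite /H /psum mulr_sumr big_add1 /=.
  rewrite !big_nat; apply: ler_sum => m _.
  rewrite /B addnS ltnNge leq_addl /=.
  by have -> : ((m + theta * l).+1 - theta * l = m.+1)%N by lia.
apply: le_trans (ler_wpM2l _ SB) _; first by rewrite mulr_ge0 ?ler0n.
rewrite le_eqVlt; apply/orP; left; apply/eqP; ring.
Qed.

End CovarianceBound.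

(** * Lower bound on the sum of squared covariances *)

Section DerivativeNearZero.
Context (R : realType).
Variables (nu b : R) (beta : nat -> R) (Kt : R -> R).
Hypothesis nu_gt0 : 0 < nu.
Hypothesis model : covariance_model nu b beta Kt.
Variable l : nat.
Hypothesis lnu : l%:R < nu.

Let FF := at_right_proper_filter (0 : R).
Let idpos : \forall x \near (0 : R)^'+, 0 < x. Proof. exact: nbhs_right_gt. Qed.
Let id0 : (fun x : R => x) @ (0 : R)^'+ --> (0 : R).
Proof. by apply: cvg_at_right_filter; exact: cvg_id. Qed.

(** Both b G_nu(u), with 2 nu > 2l, and the remainder are o(u^(2l)). *)
Lemma even_expansion_cvg :
  (fun u => (Kt u - \sum_(0 <= j < l.+1) beta j * u ^+ (2 * j)) / u ^+ (2 * l))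
    @ (0 : R)^'+ --> (0 : R).
Proof.
have [rho [C [tau [delta [tau0 d0 C0 Hrho HK]]]]] := covariance_model_remainder model.
set t := Num.truncn nu in HK.
have lt_ : (l <= t)%N by rewrite /t truncn_ge_nat ?ltW.
have p0 : 0 < 2 * nu - 2 * l%:R by have := lnu; lra.
have q0 : 0 < 2 * nu + tau - 2 * l%:R by lra.
pose S (u : R) := \sum_(0 <= j < t - l) beta (l.+1 + j)%N * u ^+ (2 * j.+1).
have cS : S @ (0 : R)^'+ --> (0 : R).
  have : S @ (0 : R)^'+ --> \sum_(0 <= j < t - l) beta (l.+1 + j)%N * (0 : R).
    apply: (@cvg_sum_nat _ _ _ _ _ (fun j (u : R) => beta (l.+1 + j)%N * u ^+ (2 * j.+1))) => j _.
    apply: cvgM; first exact: cvg_cst.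
    have := @cvg_exprn R _ _ _ (fun x : R => x) 0 (2 * j.+1) id0.
    by rewrite expr0n mulnS /= => cE; exact: cE.
  by rewrite big1// => j _; rewrite mulr0.
have cG : (fun u : R => b * (Gfun nu u / u ^+ (2 * l))) @ (0 : R)^'+ --> (0 : R).
  rewrite -[X in _ --> X](mulr0 b); apply: cvgM; first exact: cvg_cst.
  have c1 := cvg_powR_h (FF := FF) idpos id0 p0.
  have c2 := cvg_powR_ln_h (FF := FF) idpos id0 p0.
  have pE (u : R) : 0 < u -> u `^ (2 * nu - 2 * l%:R) = u `^ (2 * nu) / u ^+ (2 * l).
    move=> u0; rewrite powRD; last by rewrite (gt_eqF u0) implybT.
    by rewrite powRN -natrM powR_mulrn// ltW.
  case nuZ : (nu \is a Num.int).
    apply: cvg_near_eq c2; apply: filterS idpos => u u0.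
    by rewrite /Gfun gt_eqF// nuZ pE//; ring.
  apply: cvg_near_eq c1; apply: filterS idpos => u u0.
  by rewrite /Gfun gt_eqF// nuZ pE.
have cR : (fun u : R => rho u / u ^+ (2 * l)) @ (0 : R)^'+ --> (0 : R).
  have c1 := cvg_powR_h (FF := FF) idpos id0 q0.
  have c2 : (fun u : R => C * u `^ (2 * nu + tau - 2 * l%:R)) @ (0 : R)^'+ --> (0 : R).
    by rewrite -[X in _ --> X](mulr0 C); apply: cvgM; [exact: cvg_cst|].
  have c3 : (fun u : R => - (C * u `^ (2 * nu + tau - 2 * l%:R))) @ (0 : R)^'+ --> (0 : R).
    by rewrite -[X in _ --> X]oppr0; apply: cvgN.
  apply: squeeze_cvgr c3 c2.
  near=> u; have u0 : 0 < u by near: u.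
  have ud : `|u| < delta.
    rewrite gtr0_norm//; near: u; exact: nbhs_right_lt.
  rewrite -ler_norml normrM normfV [X in _ / X]gtr0_norm ?exprn_gt0//.
  rewrite ler_pdivrMr ?exprn_gt0//; apply: le_trans (Hrho u ud) _.
  rewrite gtr0_norm// -mulrA ler_wpM2l// -powR_mulrn ?(ltW u0)// -powRD; last first.
    by rewrite (gt_eqF u0) implybT.
  by rewrite natrM subrK.
have cT : (fun u => S u + b * (Gfun nu u / u ^+ (2 * l)) + rho u / u ^+ (2 * l))
    @ (0 : R)^'+ --> (0 + 0 + 0 : R).
  by apply: cvgD => //; exact: cvgD.
rewrite !addr0 in cT; apply: cvg_near_eq cT; apply: filterS idpos => u u0.
rewrite HK gtr0_norm// (@big_cat_nat _ _ _ l.+1 0 t.+1)//=.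
rewrite -{2}[l.+1]add0n big_addn subSS.
have -> : \sum_(0 <= i < t - l) beta (i + l.+1)%N * u ^+ (2 * (i + l.+1)) = S u * u ^+ (2 * l).
  rewrite /S mulr_suml; apply: eq_bigr => j _; rewrite [(j + _)%N]addnC -mulrA -exprD.
  by congr (_ * _ ^+ _); lia.
by field; rewrite expf_neq0// gt_eqF.
Unshelve. all: by end_near. Qed.

(** The divided difference of order 2l of K at h, 2h, ..., (2l + 1) h is a
    value of K^(2l) and tends to (2l)! beta_l as h tends to 0. The points stay
    away from 0, where K need not be smooth. *)
Lemma derivative_nonzero (I : set R) : beta l != 0 ->
  open_interval_over01 I -> class_C (2 * l) Kt I ->
  exists2 x : R, 0 < x < 1 & derive1n (2 * l) Kt x != 0.
Proof.
move=> bl [_ iI I01] KC; apply: contrapT => hn.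
have K0 x : 0 < x < 1 -> derive1n (2 * l) Kt x = 0.
  by move=> hx; apply/eqP/negP => /negP h; apply: hn; exists x.
set m := (2 * l)%N in KC K0 *.
pose rem u := Kt u - \sum_(0 <= j < l.+1) beta j * u ^+ (2 * j).
pose pt (h : R) k := h + h * grid R k.
have ptE h k : pt h k = h * k.+1%:R by rewrite /pt /grid -natr1; ring.
have inc h : 0 < h -> increasing_upto m (pt h).
  by move=> h0 k _; rewrite !ptE ltr_pM2l// ltr_nat.
have polyE h : 0 < h -> \sum_(0 <= k < m.+1) ddcoef (pt h) m k *
    (\sum_(0 <= j < l.+1) beta j * pt h k ^+ (2 * j)) = m`!%:R * beta l.
  move=> h0; pose p : {poly R} := \sum_(0 <= j < l.+1) beta j *: 'X^(2 * j).
  have pE x : p.[x] = \sum_(0 <= j < l.+1) beta j * x ^+ (2 * j).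
    by rewrite horner_sum; apply: eq_bigr => j _; rewrite hornerZ hornerXn.
  have sp : (size p <= m.+1)%N.
    rewrite /p big_nat; apply: leq_trans (size_sum _ _ _) _.
    apply/bigmax_leqP_seq => j _ /andP[_ jl].
    by apply: leq_trans (size_scale_leq _ _) _; rewrite size_polyXn /m; lia.
  have := ddcoef_poly (inc h h0) sp.
  under eq_bigr do rewrite pE; move=> ->; congr (_ * _).
  rewrite /p coef_sum (eq_bigr (fun j => if j == l then beta l else 0)); last first.
    move=> j _; rewrite coefZ coefXn /m eqn_pmul2l// eq_sym.
    by case: eqVneq => [->|_]; rewrite ?mulr1 ?mulr0.
  rewrite -big_mkcond big_mkord (big_pred1 ord_max)//.
have lim : (fun h => \sum_(0 <= k < m.+1) ddcoef (pt h) m k * rem (pt h k))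
    @ (0 : R)^'+ --> (0 : R).
  have c : (fun h => \sum_(0 <= k < m.+1) ddcoef (grid R) m k * k.+1%:R ^+ m *
      (rem (h * k.+1%:R) / (h * k.+1%:R) ^+ m)) @ (0 : R)^'+ -->
      \sum_(0 <= k < m.+1) ddcoef (grid R) m k * k.+1%:R ^+ m * 0.
    apply: (@cvg_sum_nat _ _ _ _ _ (fun k h => ddcoef (grid R) m k * k.+1%:R ^+ m *
      (rem (h * k.+1%:R) / (h * k.+1%:R) ^+ m))) => k _.
    apply: cvgM; first exact: cvg_cst.
    have hk : (fun h : R => h * k.+1%:R) @ (0 : R)^'+ --> (0 : R)^'+.
      apply: cvg_to_at_right.
        rewrite -[X in _ --> X](mul0r (k.+1%:R : R)); apply: cvgM => //; exact: cvg_cst.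
      by apply: filterS idpos => h h0; rewrite mulr_gt0.
    have ev : (fun u => rem u / u ^+ m) @ (0 : R)^'+ --> (0 : R) := even_expansion_cvg.
    exact: (@cvg_comp _ _ _ (fun h : R => h * k.+1%:R) (fun u => rem u / u ^+ m) _ _ _ hk ev).
  rewrite big1 in c; last by move=> k _; rewrite mulr0.
  apply: cvg_near_eq c; apply: filterS idpos => h h0.
  have hne : h != 0 by rewrite gt_eqF.
  rewrite !big_nat; apply: eq_bigr => k /andP[_ km].
  rewrite ddcoef_affine ?gt_eqF// -/(pt h k) ptE exprMn.
  by field; rewrite !expf_neq0 ?gt_eqF//= ltr0n.
have lim2 : (fun h => \sum_(0 <= k < m.+1) ddcoef (pt h) m k * rem (pt h k))
    @ (0 : R)^'+ --> - (m`!%:R * beta l).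
  apply: cvg_near_cst; near=> h.
  have h0 : 0 < h by near: h.
  have h1 : h < m.+2%:R^-1 by near: h; apply: nbhs_right_lt; rewrite invr_gt0.
  have small k : (k <= m)%N -> 0 < pt h k < 1.
    move=> km; rewrite ptE mulr_gt0//=.
    apply: (@lt_trans _ _ (h * m.+2%:R)); first by rewrite ltr_pM2l// ltr_nat !ltnS.
    by rewrite -ltr_pdivlMr// div1r.
  have ptI k : (k <= m)%N -> I (pt h k).
    by move=> /small /andP[a1 a2]; apply: I01; rewrite /= in_itv /= a1 ltW.
  have [x /andP[x1 x2] e] := ddcoef_mvt iI (class_C_chain KC) (inc h h0) ptI.
  have Kx : derive1n m Kt x = 0.
    apply: K0; have /andP[a1 _] := small 0%N (leq0n _); have /andP[_ a2] := small m (leqnn _).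
    by rewrite (lt_le_trans a1 x1) (le_lt_trans x2 a2).
  rewrite Kx derive1n0 in e.
  rewrite -(polyE h h0) -[RHS]sub0r -[X in X - _]e -sumrB.
  by apply: eq_bigr => k _; rewrite /rem mulrBr.
have : - (m`!%:R * beta l) = 0.
  by apply: norm_cvg_unique lim2 lim; exact: fmap_proper_filter.
move/eqP; rewrite oppr_eq0 mulf_eq0 (negbTE bl) orbF pnatr_eq0.
by rewrite gtn_eqF// fact_gt0.
Unshelve. all: by end_near. Qed.

End DerivativeNearZero.

Section LowerBound.
Context (R : realType).
Variables (phi : R -> R).
Hypothesis phi_C2 : class_C 2 phi setT.
Hypothesis phi0 : phi 0 = 0.
Hypothesis phi1 : phi 1 = 1.
Hypothesis dphi_gt0 : 0 < inf [set derive1 phi s | s in `[0, 1]%classic].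
Variables (theta l : nat).
Hypothesis theta_gt0 : (0 < theta)%N.
Hypothesis l_gt0 : (0 < l)%N.
Notation idx := (in_range theta l).

Lemma sum_ge_block (F : nat -> R) (c : R) a q N : (forall i, 0 <= F i) ->
  (1 <= a)%N -> (a + q <= N.+1)%N -> (forall p, (p < q)%N -> c <= F (a + p)%N) ->
  q%:R * c <= \sum_(1 <= i < N.+1) F i.
Proof.
move=> F0 a1 aq Hc.
rewrite (@big_cat_nat _ _ _ a)//=; last exact: leq_trans (leq_addr _ _) aq.
rewrite (@big_cat_nat _ _ _ (a + q)%N a)//= ?leq_addr//.
apply: (@le_trans _ _ (\sum_(a <= i < a + q) F i)).
  rewrite -{1}[a]add0n big_addn addKn.
  have -> : q%:R * c = \sum_(0 <= i < q) c.
    by rewrite big_const_nat subn0 iter_addr addr0 mulr_natl.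
  by rewrite !big_nat; apply: ler_sum => p /andP[_ pq]; rewrite addnC Hc.
have s0 (u v : nat) : 0 <= \sum_(u <= i < v) F i by apply: sumr_ge0.
by rewrite addrCA lerDl addr_ge0.
Qed.

(** With s the preimage of x under phi, take i with knots just to the right of
    s and j with knots just to the right of 0; each range contains at least (r
    / 4) n indices, and the lags stay close to x. *)
Lemma sum_cov2_lower (Kt : R -> R) (I : set R) (x : R) :
  open_interval_over01 I -> class_C (2 * l) Kt I ->
  0 < x < 1 -> derive1n (2 * l) Kt x != 0 ->
  exists2 c : R, 0 < c & \forall n \near \oo, c * n%:R ^+ 2 <= sum_cov2 Kt phi theta l n.
Proof.
move=> hI KC /andP[x0 x1] gx; set g := derive1n (2 * l) Kt in gx.
have cphi := design_continuous phi_C2.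
have [s] : exists2 s, s \in `[0, 1] & phi s = x.
  apply: IVT => //; first exact: continuous_subspaceT.
  by rewrite phi0 phi1 min_l// max_r// !ltW.
rewrite in_itv /= => /andP[s0 s1] sx.
have {}s0 : 0 < s.
  by rewrite lt_neqAle s0 andbT; apply/eqP => e; move: x0; rewrite -sx -e phi0 ltxx.
have {}s1 : s < 1.
  by rewrite lt_neqAle s1 andbT; apply/eqP => e; move: x1; rewrite -sx e phi1 ltxx.
pose eps := `|g x| / 2.
have eps0 : 0 < eps by rewrite divr_gt0// normr_gt0.
have [del /= del0 hdel] : exists2 del, 0 < del & forall u, `|x - u| < del -> eps <= `|g u|.
  have [_ _ I01] := hI; have [_ KCc] := KC.
  have Ix : I x by apply: I01; rewrite /= in_itv /= x0 ltW.
  have cg : (fun u => `|g u|) @ x --> (`|g x| : R) by apply: cvg_norm; exact: KCc.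
  have lt_eps : eps < `|g x| by rewrite /eps ltr_pdivrMr// ltr_pMr ?normr_gt0// ltr1n.
  have : nbhs x [set u | eps < `|g u|] by exact: (cvgr_gt _ cg _ lt_eps).
  move=> /nbhs_ballP[del d0 hd].
  by exists del => // u hu; apply/ltW/hd.
have del2 : 0 < del / 2 by rewrite divr_gt0.
have near_phi y : exists2 r, 0 < r & forall u, `|y - u| < r -> `|phi y - phi u| < del / 2.
  have /cvgrPdist_lt /(_ _ del2) := cphi y.
  by move=> /nbhs_ballP[r r0 hr]; exists r => // u hu; exact: hr.
have [r1 r10 hr1] := near_phi s; have [r2 r20 hr2] := near_phi 0.
(* r <= s and r <= 1 - s keep the two blocks of indices disjoint and in range *)
pose r := Order.min (Order.min r1 r2) (Order.min s (1 - s)).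
have r0 : 0 < r by rewrite !lt_min r10 r20 s0 subr_gt0 s1.
have [rr1 rr2 rs rs1] : [/\ r <= r1, r <= r2, r <= s & r <= 1 - s].
  by rewrite /r !ge_min !lexx !orbT.
pose c := (r / 4) ^+ 2 * eps ^+ 2.
exists c; first by rewrite mulr_gt0// exprn_gt0// divr_gt0.
have [M ME] : exists M, M = (theta * l + 2)%N by exists (theta * l + 2)%N.
have [n0 hn0] : exists n0 : nat, (1 + M%:R) / (r / 4) <= n0%:R.
  by exists (Num.truncn ((1 + M%:R) / (r / 4))).+1; apply/ltW/truncnS_gt.
exists (maxn n0 2) => // n /=; rewrite geq_max => /andP[nn0 n2].
have n1 : 0 < n%:R - 1 :> R by rewrite subr_gt0 ltr1n.
have n22 : 2 <= n%:R :> R by rewrite ler_nat.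
have nbig : 1 + M%:R <= r / 4 * n%:R.
  rewrite mulrC -ler_pdivrMr ?divr_gt0//; apply: le_trans hn0 _; by rewrite ler_nat.
have [k kE] : exists k, k = Num.truncn (r * (n%:R - 1)) by eexists.
have [q qE] : exists q, q = (k - (theta * l).+1)%N by eexists.
have [a aE] : exists a, a = (Num.truncn (s * (n%:R - 1))).+1 by eexists.
have rn0 : 0 <= r * (n%:R - 1) by rewrite mulr_ge0// ltW.
have sn0 : 0 <= s * (n%:R - 1) by rewrite mulr_ge0// ltW.
have a_lo : s * (n%:R - 1) < a%:R by rewrite aE; exact: truncnS_gt.
have a_hi : a%:R <= s * (n%:R - 1) + 1 by rewrite aE -natr1 lerD2r truncn_le.
have q_lo : r / 4 * n%:R <= q%:R.
  have h1 : r * (n%:R - 1) < k.+1%:R by rewrite kE; exact: truncnS_gt.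
  have kq : (k.+1 <= q + M)%N by rewrite qE ME; clear; lia.
  have h2 : k.+1%:R <= q%:R + M%:R :> R by rewrite -natrD ler_nat.
  have : r * 2 <= r * n%:R by rewrite ler_pM2l.
  nra.
have q_hi p : (p < q)%N -> (p + theta * l)%:R + 1 < r * (n%:R - 1).
  move=> pq; apply: (@lt_le_trans _ _ k%:R).
    by rewrite natr1 ltr_nat; move: pq; rewrite qE; clear; lia.
  by rewrite kE truncn_le.
have div_lt (u v : R) : (u / (n%:R - 1) < v) = (u < v * (n%:R - 1)) by rewrite ltr_pdivrMr.
(* The index a + 1 is the first one whose knot exceeds s; all knots of both
   windows stay within r of s and of 0 because p + theta l + 1 < r (n - 1). *)
have sep p p' : (p < q)%N -> (p' < q)%N ->
    [/\ idx n (a.+1 + p)%N, idx n (1 + p')%N,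
        (1 + p' + theta * l < a.+1 + p)%N &
        eps ^+ 2 <= nabla_cov (design phi n) theta l Kt (a.+1 + p) (1 + p') ^+ 2].
  move=> pq p'q; have hp := q_hi p pq; have hp' := q_hi p' p'q.
  rewrite !natrD in hp hp'.
  have pos m : 0 <= m%:R :> R by exact: ler0n.
  have i_n : (a + p + theta * l < n)%N.
    rewrite -(ltr_nat R) !natrD.
    have : r * (n%:R - 1) <= (1 - s) * (n%:R - 1) by rewrite ler_pM2r.
    lra.
  have ji : (1 + p' + theta * l < a.+1 + p)%N.
    rewrite -(ltr_nat R) -natr1 !natrD -natr1.
    have : r * (n%:R - 1) <= s * (n%:R - 1) by rewrite ler_pM2r.
    have := pos p; lra.
  have ir : idx n (a.+1 + p)%N by rewrite /in_range; move: i_n; clear; lia.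
  have jr : idx n (1 + p')%N by rewrite /in_range; move: i_n ji; clear; lia.
  split => //.
  have [z /andP[z1 z2] ->] := nabla_cov_separated phi_C2 phi0 phi1 dphi_gt0 theta_gt0 l_gt0
    hI KC ir jr ji.
  rewrite [leRHS]exprMn sqrr_sign mul1r -[leRHS]real_normK ?num_real//.
  apply: lerXn2r; rewrite ?nnegrE ?(ltW eps0)//; apply: hdel.
  have inear m : (m <= theta * l)%N -> `|x - design phi n (a.+1 + p + m)| < del / 2.
    move=> ml; rewrite -sx; apply: hr1; apply: lt_le_trans rr1.
    have m1 : m%:R <= (theta * l)%:R :> R by rewrite ler_nat.
    have e : s - ((a.+1 + p + m)%:R - 1) / (n%:R - 1) =
        (s * (n%:R - 1) - (a%:R + p%:R + m%:R)) / (n%:R - 1).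
      by rewrite !natrD -natr1; field; rewrite gt_eqF.
    rewrite e normrM normfV (gtr0_norm n1) div_lt ltr_norml.
    have := pos p; have := pos m; rewrite !natrM in m1 hp *; lra.
  have jnear m : (m <= theta * l)%N -> `|design phi n (1 + p' + m)| < del / 2.
    move=> ml; rewrite -normrN -sub0r -{1}phi0; apply: hr2; apply: lt_le_trans rr2.
    have m1 : m%:R <= (theta * l)%:R :> R by rewrite ler_nat.
    have e : 0 - ((1 + p' + m)%:R - 1) / (n%:R - 1) = - ((p'%:R + m%:R) / (n%:R - 1)) :> R.
      by rewrite !natrD; field; rewrite gt_eqF.
    rewrite e normrN normrM normfV (gtr0_norm n1) div_lt ger0_norm; last first.
      by have := pos p'; have := pos m; lra.
    rewrite !natrM in m1 hp' *; lra.
  have := inear 0%N isT; have := inear _ (leqnn _).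
  have := jnear 0%N isT; have := jnear _ (leqnn _).
  rewrite !addn0 !ltr_norml => /andP[b1 b2] /andP[b3 b4] /andP[b5 b6] /andP[b7 b8].
  apply/andP; split; lra.
have q0 : (0 < q)%N.
  rewrite -(ltr_nat R); apply: lt_le_trans q_lo; rewrite mulr_gt0 ?divr_gt0//; lra.
have [ir _ ji _] := sep q.-1 q.-1 ltac:(by rewrite prednK) ltac:(by rewrite prednK).
have aq : (a.+1 + q <= (n - theta * l).+1)%N.
  by move: ir; rewrite /in_range => /andP[_]; move: q0; clear; lia.
have jq : (1 + q <= (n - theta * l).+1)%N by move: ir ji q0; rewrite /in_range; clear; lia.
have low : q%:R * (q%:R * eps ^+ 2) <= sum_cov2 Kt phi theta l n.
  apply: (@sum_ge_block _ _ a.+1) => //.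
    by move=> i; apply: sumr_ge0 => j _; exact: sqr_ge0.
  move=> p pq; apply: (@sum_ge_block _ _ 1) => // [j|p' p'q]; first exact: sqr_ge0.
  by have [] := sep p p' pq p'q.
apply: le_trans low; rewrite mulrA /c -expr2 mulrAC -exprMn ler_wpM2r ?sqr_ge0//.
apply: lerXn2r => //; rewrite nnegrE ?ler0n//.
by apply: mulr_ge0 => //; exact/ltW/divr_gt0.
Qed.

End LowerBound.

(** * Rates and conclusion *)

Section Rates.
Context d (T : measurableType d) (R : realType) (P : probability T R).
Variables (X : R -> {RV P >-> R}) (mu nu b : R) (beta : nat -> R) (Kt : R -> R).
Variables (theta l : nat) (phi : R -> R).
Hypothesis nu_gt0 : 0 < nu.
Hypothesis b_neq0 : b != 0.
Hypothesis HX : stationary_gaussian_process X mu Kt.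
Hypothesis model : covariance_model nu b beta Kt.
Hypothesis theta_gt0 : (0 < theta)%N.
Hypothesis l_gt0 : (0 < l)%N.
Hypothesis phi_C2 : class_C 2 phi setT.
Hypothesis phi0 : phi 0 = 0.
Hypothesis phi1 : phi 1 = 1.
Hypothesis dphi_gt0 : 0 < inf [set derive1 phi s | s in `[0, 1]%classic].

Notation unif := (unif theta l).
Notation step := (step phi theta).
Notation idx := (in_range theta l).
Notation EV := (EV phi theta l X).
Notation S2 := (sum_cov2 Kt phi theta l).
Notation tr := (trace_cov phi theta l).
Notation weight := (weight phi theta l).
Notation cov n i j := (nabla_cov (design phi n) theta l Kt i j).

Let nice n : kills_constants phi theta l n.
Proof. by move=> i hi; exact: (design_kills_constants phi_C2 dphi_gt0 theta_gt0 l_gt0). Qed.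

Lemma EV_trace n : EV n = tr Kt n.
Proof. by rewrite (EV_sum_cov HX (@nice n)). Qed.

Lemma EV_ge0 n : 0 <= EV n.
Proof.
rewrite EV_trace /trace_cov big_nat; apply: sumr_ge0 => i hi.
exact: (nabla_cov_diag_ge0 HX (@nice n) hi).
Qed.

(** Both sequences are compared with a common scale w. *)
Lemma ratio_cvg1 (u v w : nat -> R) (L : R) : L != 0 ->
  (\forall n \near \oo, w n != 0) ->
  (fun n => u n / w n) @ \oo --> L -> (fun n => v n / w n) @ \oo --> L ->
  asymp_equiv u v.
Proof.
move=> L0 w0 uL vL.
have h : (fun n => (u n / w n) * (v n / w n)^-1) @ \oo --> (L * L^-1 : R).
  by apply: cvgM => //; exact: cvgV.
rewrite mulfV// in h; apply: cvg_near_eq h; apply: filterS w0 => n wn.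
by rewrite invfM invrK mulrACA mulVf// mulr1.
Qed.

Lemma ebigO_variance (rate : nat -> R) :
  (exists2 D : R, 0 < D & \forall n \near \oo, EV n != 0 /\
     S2 n <= D * rate n * EV n ^+ 2) ->
  ebigO (fun n => variance P (normV phi theta l X n)) rate.
Proof.
move=> [D D0 H]; exists (2 * D); apply: filterS H => n [E0 hS].
rewrite (variance_normV HX (@nice n) E0) lee_fin.
have S0 : 0 <= S2 n.
  by apply: sumr_ge0 => i _; apply: sumr_ge0 => j _; exact: sqr_ge0.
have E2 : 0 < EV n ^+ 2 by rewrite exprn_even_gt0.
rewrite ger0_norm; last by apply: divr_ge0; [exact: mulr_ge0|exact: ltW].
rewrite ler_pdivrMr// -!mulrA ler_wpM2l//; apply: le_trans hS _.
by rewrite -mulrA ler_wpM2l ?(ltW D0)// ler_wpM2r ?(ltW E2)// ler_norm.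
Qed.

Section Rough.
Hypothesis nu_lt : nu < l%:R.
Let L := b * Qlim nu l.

Let L_neq0 : L != 0.
Proof. by rewrite mulf_neq0// Qlim_neq0// nu_gt0. Qed.

Let weight_near : \forall n \near \oo, 0 < weight nu n.
Proof. by exists (theta * l).+1 => // n /= hn; exact: (weight_gt0 dphi_gt0 theta_gt0 l_gt0). Qed.

Let EV_cvg : (fun n => EV n / weight nu n) @ \oo --> L.
Proof.
have c := trace_cov_lt phi_C2 dphi_gt0 theta_gt0 l_gt0 nu_gt0 model nu_lt.
by apply: cvg_near_eq c; apply: nearW => n; rewrite EV_trace.
Qed.

Let fvar_cvg : (fun n => fvar (design phi n) n theta l b nu / weight nu n) @ \oo --> L.
Proof.
have c := trace_cov_lt phi_C2 dphi_gt0 theta_gt0 l_gt0 nu_gt0 (trivial_model nu b) nu_lt.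
apply: cvg_near_eq c; apply: nearW => n.
by rewrite (fvarE phi_C2 dphi_gt0 theta_gt0 l_gt0).
Qed.

Let L_gt0 : 0 < L.
Proof.
rewrite lt_neqAle eq_sym L_neq0 /=; apply: (cvgr_to_ge EV_cvg).
by apply: filterS weight_near => n w0; rewrite divr_ge0 ?EV_ge0// ltW.
Qed.

Lemma mean_asymp_rough : asymp_equiv EV (fun n => fvar (design phi n) n theta l b nu).
Proof.
apply: (ratio_cvg1 L_neq0 _ EV_cvg fvar_cvg).
by apply: filterS weight_near => n; exact: lt0r_neq0.
Qed.

Lemma fvar_same_order : same_order (fun n => fvar (design phi n) n theta l b nu)
  (fun n => n%:R `^ (2 * l%:R + 1 - 2 * nu)).
Proof.
have [c1 [c2 [c10 c20 Hw]]] := weight_bounds phi_C2 dphi_gt0 theta_gt0 l_gt0 nu_lt.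
have L2 : L / 2 < L by rewrite ltr_pdivrMr// ltr_pMr// ltr1n.
have L3 : L < 2 * L by rewrite ltr_pMl// ltr1n.
have lo : \forall n \near \oo, L / 2 < fvar (design phi n) n theta l b nu / weight nu n.
  exact: (cvgr_gt _ fvar_cvg _ L2).
have hi : \forall n \near \oo, fvar (design phi n) n theta l b nu / weight nu n < 2 * L.
  exact: (cvgr_lt _ fvar_cvg _ L3).
have bnd : \forall n \near \oo,
    L / 2 * c1 <= fvar (design phi n) n theta l b nu / n%:R `^ (2 * l%:R + 1 - 2 * nu)
      <= 2 * L * c2.
  near=> n.
  have n0 : 0 < n%:R :> R by near: n; exists 1%N => // n /= n0; rewrite ltr0n.
  have p0 : 0 < n%:R `^ (2 * l%:R + 1 - 2 * nu) :> R by exact: powR_gt0.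
  have w0 : 0 < weight nu n by near: n.
  have /andP[w1 w2] : c1 * n%:R `^ (2 * l%:R + 1 - 2 * nu) <= weight nu n
     <= c2 * n%:R `^ (2 * l%:R + 1 - 2 * nu) by near: n.
  have f1 : L / 2 < fvar (design phi n) n theta l b nu / weight nu n by near: n.
  have f2 : fvar (design phi n) n theta l b nu / weight nu n < 2 * L by near: n.
  rewrite ler_pdivlMr// ler_pdivrMr//.
  rewrite ltr_pdivlMr// in f1; rewrite ltr_pdivrMr// in f2.
  apply/andP; split.
    by apply: le_trans (ltW f1); rewrite -[leLHS]mulrA ler_wpM2l//; exact/ltW/divr_gt0.
  by apply: le_trans (ltW f2) _; rewrite -[leRHS]mulrA ler_wpM2l//; exact/ltW/mulr_gt0.
split.
  apply: (@limn_einf_gt0 _ _ (L / 2 * c1)); first by rewrite mulr_gt0// divr_gt0.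
  by apply: filterS bnd => n /andP[h _]; rewrite lee_fin.
apply: (@limn_esup_ltpinfty _ _ (2 * L * c2)).
by apply: filterS bnd => n /andP[_ h]; rewrite lee_fin.
Unshelve. all: by end_near. Qed.

Let EV_lower : exists2 c : R, 0 < c & \forall n \near \oo,
  c * n%:R `^ (2 * l%:R + 1 - 2 * nu) <= EV n.
Proof.
have [c1 [c2 [c10 c20 Hw]]] := weight_bounds phi_C2 dphi_gt0 theta_gt0 l_gt0 nu_lt.
have L2 : L / 2 < L by rewrite ltr_pdivrMr// ltr_pMr// ltr1n.
have lo : \forall n \near \oo, L / 2 < EV n / weight nu n by exact: (cvgr_gt _ EV_cvg _ L2).
exists (L / 2 * c1); first by rewrite mulr_gt0// divr_gt0.
near=> n.
have w0 : 0 < weight nu n by near: n.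
have /andP[w1 w2] : c1 * n%:R `^ (2 * l%:R + 1 - 2 * nu) <= weight nu n
     <= c2 * n%:R `^ (2 * l%:R + 1 - 2 * nu) by near: n.
have f1 : L / 2 < EV n / weight nu n by near: n.
rewrite ltr_pdivlMr// in f1; apply: le_trans (ltW f1).
by rewrite -[leLHS]mulrA ler_wpM2l//; exact/ltW/divr_gt0.
Unshelve. all: by end_near. Qed.

Let diag_cvg : (fun x => step x.1 x.2 `^ (2 * l%:R - 2 * nu) * cov x.1 x.2 x.2) @ unif --> L.
Proof.
have H := local_limit_lt (FF := unif_filter theta l) nu_gt0 model
  (fun x => window phi theta x.1 x.2 0)
  (step_near dphi_gt0 theta_gt0 l_gt0) (step_cvg0 phi_C2 dphi_gt0 theta_gt0 l_gt0)
  (fun k => @scaled_cvg R phi phi_C2 dphi_gt0 theta l theta_gt0 l_gt0 k) nu_lt.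
apply: cvg_near_eq H; exists 0%N => // n _ i hi /=.
by rewrite nabla_covE -(window_affine dphi_gt0 theta_gt0 l_gt0 hi).
Qed.

Section RoughVariance.
Variables (I : set R) (C : R).
Hypothesis hI : open_interval_over01 I.
Hypothesis KC : class_C (2 * l) Kt I.
Hypothesis hK : forall t, 0 < t <= 1 ->
  `|derive1n (2 * l) Kt t| <= C * t `^ (2 * nu - 2 * l%:R).

Let p := 4 * l%:R - 4 * nu.
Let p_gt0 : 0 < p. Proof. by rewrite /p; have := nu_lt; lra. Qed.

(** The squared mean is at least of order n^(2(2l + 1 - 2 nu)). *)
Lemma relative_sum_cov2 : exists2 D : R, 0 < D & \forall n \near \oo,
  [/\ (1 < n)%N, 0 < EV n & S2 n <= D * (n%:R^-1 * psum p n) * EV n ^+ 2].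
Proof.
pose e := 2 * l%:R - 2 * nu.
have e0 : 0 < e by rewrite /e; have := nu_lt; lra.
have hK' t : 0 < t <= 1 -> `|derive1n (2 * l) Kt t| <= C * t `^ (- e).
  by rewrite /e opprB; exact: hK.
have [D D0 HD] := sum_cov2_bound phi_C2 phi0 phi1 dphi_gt0 theta_gt0 l_gt0 HX e0 hI KC hK' diag_cvg.
have [c c0 Hc] := EV_lower.
exists (D / c ^+ 2); first by rewrite divr_gt0// exprn_gt0.
near=> n.
have n1 : (1 < n)%N by near: n; exists 2%N.
have n0 : 0 < n%:R :> R by rewrite ltr0n ltnW.
have h1 : c * n%:R `^ (2 * l%:R + 1 - 2 * nu) <= EV n by near: n.
have h2 : S2 n <= D * n%:R `^ (2 * e + 1) * psum (2 * e) n by near: n.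
have E0 : 0 < EV n by apply: lt_le_trans h1; rewrite mulr_gt0// powR_gt0.
split => //; apply: le_trans h2 _.
have pe : p = 2 * e by rewrite /p /e; ring.
have H0 : 0 <= psum p n by apply: le_trans ler01 (psum_ge1 _ (ltnW n1)).
have E2 : (c * n%:R `^ (2 * l%:R + 1 - 2 * nu)) ^+ 2 <= EV n ^+ 2.
  by apply: lerXn2r => //; rewrite nnegrE ?(ltW E0)// mulr_ge0 ?powR_ge0// ltW.
apply: le_trans (ler_wpM2l _ E2); last first.
  by rewrite !mulr_ge0 ?invr_ge0 ?sqr_ge0 ?(ltW D0) ?(ltW n0)// exprn_ge0// ltW.
have -> : n%:R `^ (2 * e + 1) = n%:R^-1 * (n%:R `^ (2 * l%:R + 1 - 2 * nu)) ^+ 2 :> R.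
  rewrite -powR_mulrn ?powR_ge0// -powRrM -powR_inv1 ?(ltW n0)// -powRD; last first.
    by rewrite (gt_eqF n0) implybT.
  by congr (_ `^ _); rewrite /e; ring.
rewrite -pe le_eqVlt; apply/orP; left; apply/eqP; field.
by rewrite !gt_eqF.
Unshelve. all: by end_near. Qed.

Let rate_of (rate : nat -> R) (c : R) : 0 < c ->
  (\forall n \near \oo, n%:R^-1 * psum p n <= c * rate n) ->
  exists2 D : R, 0 < D & \forall n \near \oo,
    [/\ (1 < n)%N, 0 < EV n & S2 n <= D * rate n * EV n ^+ 2].
Proof.
move=> c0 Hr; have [D D0 HD] := relative_sum_cov2.
exists (D * c); first exact: mulr_gt0.
apply: filterS2 Hr HD => n hr [n1 E0 hS]; split => //.
apply: le_trans hS _; rewrite ler_wpM2r ?sqr_ge0// -mulrA ler_wpM2l//.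
exact: ltW.
Qed.

(** Lowering the exponent to some q < 1 only increases the sum, so that one
    polynomial rate is available for every value of p. *)
Let psum_rate (q : R) : 0 < q < 1 -> q <= p -> exists2 c : R, 0 < c &
  \forall n \near \oo, n%:R^-1 * psum p n <= c * n%:R `^ (- q).
Proof.
move=> q01 qp; have [c c0 Hc] := psum_lt1 q01.
exists c => //; exists 1%N => // n /= n1.
have n0 : 0 < n%:R :> R by rewrite ltr0n.
have -> : n%:R `^ (- q) = n%:R^-1 * n%:R `^ (1 - q) :> R.
  rewrite -powR_inv1 ?(ltW n0)// -powRD; last by rewrite (gt_eqF n0) implybT.
  by congr (_ `^ _); ring.
rewrite mulrCA ler_wpM2l ?invr_ge0 ?(ltW n0)//.
exact: le_trans (psum_mono n qp) (Hc n n1).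
Qed.

Let weaken (rate : nat -> R) : (exists2 D : R, 0 < D & \forall n \near \oo,
    [/\ (1 < n)%N, 0 < EV n & S2 n <= D * rate n * EV n ^+ 2]) ->
  ebigO (fun n => variance P (normV phi theta l X n)) rate.
Proof.
move=> [D D0 HD]; apply: ebigO_variance; exists D => //.
by apply: filterS HD => n [_ E0 h]; split => //; exact: lt0r_neq0.
Qed.

Lemma variance_rough_lt : nu < (4 * l%:R - 1) / 4 ->
  ebigO (fun n => variance P (normV phi theta l X n)) (fun n => n%:R^-1).
Proof.
move=> h; have p1 : 1 < p by rewrite /p; lra.
have [c c0 Hc] := psum_gt1 p1.
apply/weaken/(rate_of c0); exists 1%N => // n /= n1.
by rewrite mulrC ler_wpM2r ?invr_ge0 ?ler0n// Hc.
Qed.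

Lemma variance_rough_eq : nu = (4 * l%:R - 1) / 4 ->
  ebigO (fun n => variance P (normV phi theta l X n)) (fun n => n%:R^-1 * ln n%:R).
Proof.
move=> h; have p1 : p = 1 by rewrite /p h; field.
have l2 : 0 < ln 2 :> R by rewrite ln_gt0// ltr1n.
have c0 : 0 < (ln 2)^-1 + 1 :> R by rewrite addr_gt0// invr_gt0.
apply/weaken/(rate_of c0); exists 2%N => // n /= n1.
rewrite [leRHS]mulrCA ler_wpM2l ?invr_ge0 ?ler0n// p1.
apply: le_trans (psum_eq1 _ (ltnW n1)) _; rewrite mulrDl mul1r lerD2r.
by rewrite mulrC ler_pdivlMr// mul1r ler_ln ?posrE ?ltr0n ?ler_nat// ltnW.
Qed.

Lemma variance_rough_gt : (4 * l%:R - 1) / 4 < nu ->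
  ebigO (fun n => variance P (normV phi theta l X n))
    (fun n => n%:R `^ (- (4 * l%:R) + 4 * nu)).
Proof.
move=> h; have p01 : 0 < p < 1 by rewrite p_gt0 /p /=; lra.
have [c c0 Hc] := psum_rate p01 (lexx p).
have -> : - (4 * l%:R) + 4 * nu = - p by rewrite /p; ring.
exact/weaken/(rate_of c0).
Qed.

Lemma almost_sure_rough : {ae P, forall w,
  (fun n => normV phi theta l X n w) @ \oo --> (1 : R)}.
Proof.
pose q := Order.min p (1 / 2).
have q01 : 0 < q < 1.
  rewrite lt_min p_gt0 divr_gt0//= gt_min; apply/orP; right; lra.
have qp : q <= p by rewrite ge_min lexx.
have [c c0 Hc] := psum_rate q01 qp.
have [D D0 HD] := rate_of c0 Hc.
have /andP[q0 _] := q01.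
apply: (normV_as_cvg HX (C := D) q0).
by apply: filterS HD => n [_ E0 h]; split => //; exact: nice.
Qed.

End RoughVariance.
End Rough.

Section Critical.
Hypothesis nu_eq : nu = l%:R.
Let L := b * ((-1) ^+ l.+1 * (2 * l)`!%:R).

Let L_neq0 : L != 0.
Proof. by rewrite mulf_neq0// mulf_neq0 ?signr_eq0// pnatr_eq0 gtn_eqF// fact_gt0. Qed.

Let EV_cvg : (fun n => EV n / (n%:R * ln n%:R)) @ \oo --> L.
Proof.
have c := trace_cov_eq phi_C2 dphi_gt0 theta_gt0 l_gt0 nu_gt0 model nu_eq.
by apply: cvg_near_eq c; apply: nearW => n; rewrite EV_trace.
Qed.

Let nln_gt0 n : (1 < n)%N -> 0 < n%:R * ln n%:R :> R.
Proof. by move=> n1; rewrite mulr_gt0 ?ln_gt0 ?ltr1n// ltr0n ltnW. Qed.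

Lemma mean_asymp_critical : asymp_equiv EV
  (fun n => (-1) ^+ l.+1 * b * (2 * l)`!%:R * n%:R * ln n%:R).
Proof.
have ne : \forall n \near \oo, n%:R * ln n%:R != 0 :> R.
  by exists 2%N => // n /= n1; rewrite gt_eqF// nln_gt0.
apply: (ratio_cvg1 L_neq0 ne EV_cvg); apply: cvg_near_cst.
by apply: filterS ne => n h; rewrite -[X in X / _]mulrA mulfK// /L; ring.
Qed.

(** The diagonal only grows like log n; the exponent 1/4 is any one below 1/2,
    so that the lags sum to O(n^(1 - 2/4)) and sum_cov2 stays O(n^2). *)
Let diag_cvg : (fun x => step x.1 x.2 `^ 4^-1 * cov x.1 x.2 x.2) @ unif --> (0 : R).
Proof.
have sN := step_near dphi_gt0 theta_gt0 l_gt0.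
have s0 := step_cvg0 phi_C2 dphi_gt0 theta_gt0 l_gt0.
have H := local_limit_eq (FF := unif_filter theta l) nu_gt0 model
  (fun x => window phi theta x.1 x.2 0) sN s0
  (fun k => @scaled_cvg R phi phi_C2 dphi_gt0 theta l theta_gt0 l_gt0 k) nu_eq.
have q0 : 0 < 4^-1 :> R by rewrite invr_gt0.
have H1 := cvg_powR_ln_h (FF := unif_filter theta l) sN s0 q0.
have H3 : (fun x => (ln (step x.1 x.2))^-1 * cov x.1 x.2 x.2) @ unif -->
    b * ((-1) ^+ l * (2 * l)`!%:R).
  apply: cvg_near_eq H; exists 0%N => // n _ i hi /=.
  by rewrite nabla_covE -(window_affine dphi_gt0 theta_gt0 l_gt0 hi).
have H2 : (fun x => (step x.1 x.2 `^ 4^-1 * ln (step x.1 x.2)) *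
    ((ln (step x.1 x.2))^-1 * cov x.1 x.2 x.2)) @ unif -->
    (0 * (b * ((-1) ^+ l * (2 * l)`!%:R)) : R) by apply: cvgM.
rewrite mul0r in H2; apply: cvg_near_eq H2.
have : unif [set x | step x.1 x.2 < 1] by exact: (cvgr_lt _ s0 _ ltr01).
move=> [N _ HN]; exists N => // n /= hn i hi /=.
have si := step_gt0 dphi_gt0 theta_gt0 l_gt0 hi.
have ln0 : ln (step n i) != 0 by rewrite lt_eqF// ln_lt0// si HN.
by rewrite mulrA mulfK.
Qed.

Lemma variance_critical (I : set R) (C : R) :
  open_interval_over01 I -> class_C (2 * l) Kt I ->
  (forall t, 0 < t <= 1 -> `|derive1n (2 * l) Kt t| <= C * ln (2 / t)) ->
  ebigO (fun n => variance P (normV phi theta l X n)) (fun n => ln n%:R ^- 2).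
Proof.
move=> hI KC hK.
have q0 : 0 < 4^-1 :> R by rewrite invr_gt0.
have C0 : 0 <= C.
  have := hK 1; rewrite ltr01 lexx divr1 => /(_ isT) h.
  have l2 : 0 < ln 2 :> R by rewrite ln_gt0// ltr1n.
  by rewrite -(pmulr_lge0 _ l2); exact: le_trans h.
(* log u = 4 log (u^(1/4)) <= 4 u^(1/4) with u = 2 / t *)
have hK' t : 0 < t <= 1 ->
    `|derive1n (2 * l) Kt t| <= C * (4 * 2 `^ 4^-1) * t `^ (- 4^-1).
  move=> ht; have /andP[t0 t1] := ht.
  apply: le_trans (hK t ht) _; rewrite -mulrA ler_wpM2l//.
  have u0 : 0 < 2 / t by rewrite divr_gt0.
  have := ltW (ln_sublinear (powR_gt0 4^-1 u0)); rewrite ln_powR.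
  rewrite powRM ?invr_ge0 ?(ltW t0)// powRV ?(ltW t0)//.
  by rewrite -mulrA ler_pdivrMl.
have [D D0 HD] := sum_cov2_bound phi_C2 phi0 phi1 dphi_gt0 theta_gt0 l_gt0 HX q0 hI KC hK' diag_cvg.
have h01 : 0 < (2 * 4^-1 : R) < 1 by apply/andP; split; lra.
have [c c0 Hc] := psum_lt1 h01.
have L0 : 0 < `|L| / 2 by rewrite divr_gt0// normr_gt0.
have nL : \forall n \near \oo, `|L| / 2 < `|EV n / (n%:R * ln n%:R)|.
  have cn : (fun n => `|EV n / (n%:R * ln n%:R)|) @ \oo --> (`|L| : R) by exact: cvg_norm.
  have L2 : `|L| / 2 < `|L| by rewrite ltr_pdivrMr// ltr_pMr ?normr_gt0// ltr1n.
  exact: (cvgr_gt _ cn _ L2).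
apply: ebigO_variance; exists (D * c / (`|L| / 2) ^+ 2).
  by rewrite divr_gt0 ?exprn_gt0// mulr_gt0.
near=> n.
have n1 : (1 < n)%N by near: n; exists 2%N.
have n0 : 0 < n%:R :> R by rewrite ltr0n ltnW.
have h1 : `|L| / 2 < `|EV n / (n%:R * ln n%:R)| by near: n.
have h2 : S2 n <= D * n%:R `^ (2 * 4^-1 + 1) * psum (2 * 4^-1) n by near: n.
have nl := nln_gt0 n1.
have l0 : 0 < ln n%:R :> R by rewrite ln_gt0// ltr1n.
have hE : `|EV n / (n%:R * ln n%:R)| = `|EV n| / (n%:R * ln n%:R).
  by rewrite normrM normfV (gtr0_norm nl).
rewrite hE ltr_pdivlMr// in h1.
have E0 : EV n != 0 by rewrite -normr_gt0; apply: lt_trans h1; exact: mulr_gt0.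
split => //; apply: le_trans h2 _.
have h3 : (`|L| / 2 * (n%:R * ln n%:R)) ^+ 2 <= EV n ^+ 2.
  rewrite -[leRHS]real_normK ?num_real//; apply: lerXn2r; rewrite ?nnegrE ?(ltW h1)//.
  by apply: mulr_ge0; exact: ltW.
apply: (@le_trans _ _ (D * n%:R `^ (2 * 4^-1 + 1) * (c * n%:R `^ (1 - 2 * 4^-1)))).
  by rewrite ler_wpM2l ?Hc ?mulr_ge0 ?powR_ge0 ?(ltW D0)// ltnW.
have -> : D * n%:R `^ (2 * 4^-1 + 1) * (c * n%:R `^ (1 - 2 * 4^-1)) = D * c * n%:R ^+ 2.
  rewrite mulrACA -powRD; last by rewrite (gt_eqF n0) implybT.
  by rewrite -(powR_mulrn 2 (ltW n0)); congr (_ * _ `^ _); field.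
apply: le_trans (ler_wpM2l _ h3); last first.
  by rewrite !mulr_ge0 ?invr_ge0 ?exprn_ge0 ?(ltW D0) ?(ltW c0) ?(ltW l0) ?(ltW L0).
rewrite le_eqVlt; apply/orP; left; apply/eqP; field.
by rewrite (gt_eqF l0) normr_eq0 L_neq0.
Unshelve. all: by end_near. Qed.

End Critical.

Section Smooth.
Hypothesis nu_gt : l%:R < nu.
Let L := beta l * ((-1) ^+ l * (2 * l)`!%:R).

Let bl : beta l != 0.
Proof. exact: (beta_neq0 HX nu_gt0 b_neq0 model l_gt0 nu_gt). Qed.

Let L_neq0 : L != 0.
Proof. by rewrite mulf_neq0// mulf_neq0 ?signr_eq0// pnatr_eq0 gtn_eqF// fact_gt0. Qed.

Let EV_cvg : (fun n => EV n / n%:R) @ \oo --> L.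
Proof.
have c := trace_cov_gt phi_C2 dphi_gt0 theta_gt0 l_gt0 nu_gt0 model nu_gt.
by apply: cvg_near_eq c; apply: nearW => n; rewrite EV_trace.
Qed.

Lemma mean_asymp_smooth : asymp_equiv EV
  (fun n => (-1) ^+ l * beta l * (2 * l)`!%:R * n%:R).
Proof.
have ne : \forall n \near \oo, n%:R != 0 :> R.
  by exists 1%N => // n /= n1; rewrite pnatr_eq0 gtn_eqF.
apply: (ratio_cvg1 L_neq0 ne EV_cvg); apply: cvg_near_cst.
by apply: filterS ne => n h; rewrite mulfK// /L; ring.
Qed.

(** Numerator and denominator of 2 sum_cov2 / (EV)^2 are both of order n^2. *)
Lemma variance_smooth (I : set R) : open_interval_over01 I -> class_C (2 * l) Kt I ->
  (0 < limn_einf (fun n => variance P (normV phi theta l X n)))%E.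
Proof.
move=> hI KC.
have [x x01 gx] := derivative_nonzero nu_gt0 model nu_gt bl hI KC.
have [c c0 Hc] := sum_cov2_lower phi_C2 phi0 phi1 dphi_gt0 theta_gt0 l_gt0 hI KC x01 gx.
have nL : \forall n \near \oo, `|L| / 2 < `|EV n / n%:R|.
  have cn : (fun n => `|EV n / n%:R|) @ \oo --> (`|L| : R) by exact: cvg_norm.
  have L2 : `|L| / 2 < `|L| by rewrite ltr_pdivrMr// ltr_pMr ?normr_gt0// ltr1n.
  exact: (cvgr_gt _ cn _ L2).
have nU : \forall n \near \oo, `|EV n / n%:R| < 2 * `|L|.
  have cn : (fun n => `|EV n / n%:R|) @ \oo --> (`|L| : R) by exact: cvg_norm.
  have L2 : `|L| < 2 * `|L| by rewrite ltr_pMl ?normr_gt0// ltr1n.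
  exact: (cvgr_lt _ cn _ L2).
have L0 : 0 < `|L| by rewrite normr_gt0.
apply: (@limn_einf_gt0 _ _ (2 * c / (2 * `|L|) ^+ 2)).
  by rewrite divr_gt0 ?mulr_gt0// exprn_gt0// mulr_gt0.
near=> n.
have n0 : 0 < n%:R :> R by near: n; exists 1%N => // n /= n1; rewrite ltr0n.
have h1 : `|L| / 2 < `|EV n / n%:R| by near: n.
have h2 : `|EV n / n%:R| < 2 * `|L| by near: n.
have h3 : c * n%:R ^+ 2 <= S2 n by near: n.
have hE : `|EV n / n%:R| = `|EV n| / n%:R by rewrite normrM normfV (gtr0_norm n0).
rewrite hE ltr_pdivlMr// in h1; rewrite hE ltr_pdivrMr// in h2.
have E0 : EV n != 0.
  by rewrite -normr_gt0; apply: lt_trans h1; apply: mulr_gt0 => //; exact: divr_gt0.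
rewrite (variance_normV HX (@nice n) E0) lee_fin.
have E2 : 0 < EV n ^+ 2 by rewrite exprn_even_gt0.
rewrite ler_pdivlMr//.
have h4 : EV n ^+ 2 <= (2 * `|L| * n%:R) ^+ 2.
  rewrite -[leLHS]real_normK ?num_real//; apply: lerXn2r; rewrite ?nnegrE ?(ltW h2)//.
apply: le_trans (ler_wpM2l _ h4) _.
  apply: divr_ge0; first by apply: mulr_ge0 => //; exact: ltW.
  by apply: exprn_ge0; exact: mulr_ge0.
have -> : 2 * c / (2 * `|L|) ^+ 2 * (2 * `|L| * n%:R) ^+ 2 = 2 * (c * n%:R ^+ 2).
  by field; rewrite gt_eqF.
by rewrite ler_wpM2l.
Unshelve. all: by end_near. Qed.

End Smooth.
End Rates.

Theorem theorem1 (R : realType) (d : measure_display) (T : measurableType d)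
    (P : probability T R) (X : R -> {RV P >-> R})
    (mu nu bstar : R) (beta : nat -> R) (Kt : R -> R)
    (theta l : nat) (phi : R -> R)
    (nu_gt0 : 0 < nu) (bstar_neq0 : bstar != 0)
    (X_gauss : stationary_gaussian_process X mu Kt)
    (K_model : covariance_model nu bstar beta Kt)
    (theta12 : theta = 1%N \/ theta = 2%N) (l_gt0 : (0 < l)%N)
    (phi_C2 : class_C 2 phi setT) (phi0 : phi 0 = 0) (phi1 : phi 1 = 1)
    (dphi_gt0 : 0 < inf [set derive1 phi s | s in `[0, 1]%classic]) :
  [/\ (* (a) *)
      nu < l%:R -> (l <= 10)%N ->
      [/\ asymp_equiv (EV phi theta l X)
            (fun n => fvar (design phi n) n theta l bstar nu),
          same_order (fun n => fvar (design phi n) n theta l bstar nu)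
            (fun n => n%:R `^ (2 * l%:R + 1 - 2 * nu)) &
          forall (I : set R) (C : R),
            open_interval_over01 I -> class_C (2 * l) Kt I ->
            (forall t, 0 < t <= 1 ->
               `|derive1n (2 * l) Kt t| <= C * t `^ (2 * nu - 2 * l%:R)) ->
            [/\ nu < (4 * l%:R - 1) / 4 ->
                ebigO (fun n => variance P (normV phi theta l X n))
                  (fun n => n%:R^-1),
                nu = (4 * l%:R - 1) / 4 ->
                ebigO (fun n => variance P (normV phi theta l X n))
                  (fun n => n%:R^-1 * ln n%:R),
                (4 * l%:R - 1) / 4 < nu ->
                ebigO (fun n => variance P (normV phi theta l X n))
                  (fun n => n%:R `^ (- (4 * l%:R) + 4 * nu)) &
                {ae P, forall w,
                   (fun n => normV phi theta l X n w) @ \oo --> (1 : R)}]],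
      (* (b) *)
      nu = l%:R ->
      asymp_equiv (EV phi theta l X)
        (fun n => (-1) ^+ l.+1 * bstar * (2 * l)`!%:R * n%:R * ln n%:R) /\
      (forall (I : set R) (C : R),
         open_interval_over01 I -> class_C (2 * l) Kt I ->
         (forall t, 0 < t <= 1 ->
            `|derive1n (2 * l) Kt t| <= C * ln (2 / t)) ->
         ebigO (fun n => variance P (normV phi theta l X n))
           (fun n => ln n%:R ^- 2)) &
      (* (c) *)
      l%:R < nu ->
      asymp_equiv (EV phi theta l X)
        (fun n => (-1) ^+ l * beta l * (2 * l)`!%:R * n%:R) /\
      (forall I : set R,
         open_interval_over01 I -> class_C (2 * l) Kt I ->
         (exists2 t, I t & derive1n (2 * l) Kt t != 0) ->
         (0 < limn_einf (fun n => variance P (normV phi theta l X n)))%E)].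
Proof.
have theta_gt0 : (0 < theta)%N by case: theta12 => ->.
split.
- move=> nul _; split.
  + exact: (mean_asymp_rough nu_gt0 bstar_neq0 X_gauss K_model theta_gt0 l_gt0
      phi_C2 dphi_gt0 nul).
  + exact: (fvar_same_order nu_gt0 bstar_neq0 X_gauss K_model theta_gt0 l_gt0
      phi_C2 dphi_gt0 nul).
  + move=> I C hI KC hK; split.
    * exact: (variance_rough_lt nu_gt0 bstar_neq0 X_gauss K_model theta_gt0 l_gt0
        phi_C2 phi0 phi1 dphi_gt0 nul hI KC hK).
    * exact: (variance_rough_eq nu_gt0 bstar_neq0 X_gauss K_model theta_gt0 l_gt0
        phi_C2 phi0 phi1 dphi_gt0 nul hI KC hK).
    * exact: (variance_rough_gt nu_gt0 bstar_neq0 X_gauss K_model theta_gt0 l_gt0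
        phi_C2 phi0 phi1 dphi_gt0 nul hI KC hK).
    * exact: (almost_sure_rough nu_gt0 bstar_neq0 X_gauss K_model theta_gt0 l_gt0
        phi_C2 phi0 phi1 dphi_gt0 nul hI KC hK).
- move=> nul; split.
    exact: (mean_asymp_critical nu_gt0 bstar_neq0 X_gauss K_model theta_gt0 l_gt0
      phi_C2 dphi_gt0 nul).
  move=> I C; exact: (variance_critical nu_gt0 bstar_neq0 X_gauss K_model theta_gt0
    l_gt0 phi_C2 phi0 phi1 dphi_gt0 nul).
- move=> nul; split.
    exact: (mean_asymp_smooth nu_gt0 bstar_neq0 X_gauss K_model theta_gt0 l_gt0
      phi_C2 dphi_gt0 nul).
  move=> I hI KC _.
  exact: (variance_smooth nu_gt0 bstar_neq0 X_gauss K_model theta_gt0 l_gt0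
    phi_C2 phi0 phi1 dphi_gt0 nul hI KC).
Qed.
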